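(* Let $p,q\ge 2$ be integers and let $M\in AD_{p,q}$ be a weakly dual-compatible T-mesh (of any one of the types RD, RU, LD, LU). Then $M$ is a VMCR T-mesh.
   Context: **T-meshes.** Let $p,q\ge2$ be integers (orders), $\mu,\nu$ positive integers, and $\mathbf{\Sigma^s}=\{s_{-\lfloor p/2\rfloor+1}\le\dots\le s_{\mu+\lfloor p/2\rfloor}\}$, $\mathbf{\Sigma^t}=\{t_{-\lfloor q/2\rfloor+1}\le\dots\le t_{\nu+\lfloor q/2\rfloor}\}$ knot vectors in which each knot has multiplicity at most $p$, resp. $q$. An index T-mesh $M$ is a partition of the index domain $[-\lfloor p/2\rfloor+1,\mu+\lfloor p/2\rfloor]\times[-\lfloor q/2\rfloor+1,\nu+\lfloor q/2\rfloor]$ into (open) rectangles, called cells, whose vertices have integer coordinates (T-junctions are allowed, L- and I-junctions are not). $\mathcal V$ is the set of vertices; edges are the (open) horizontal or vertical segments of the mesh linking two consecutive vertices; $hE$, $vE$ are the sets of horizontal and vertical edges; $S$ is the union of all edges and vertices, $hS$ (resp. $vS$) the union of all horizontal (resp. vertical) edges and all vertices. The valence of a vertex is the number of edges having it as an endpoint. The active region is $AR_{p,q}=[1,\mu]\times[1,\nu]$; the frame region is $FR_{p,q}=\big([-\lfloor p/2\rfloor+1,1]\cup[\mu,\mu+\lfloor p/2\rfloor]\big)\times[-\lfloor q/2\rfloor+1,\nu+\lfloor q/2\rfloor]\ \cup\ [-\lfloor p/2\rfloor+1,\mu+\lfloor p/2\rfloor]\times\big([-\lfloor q/2\rfloor+1,1]\cup[\nu,\nu+\lfloor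 q/2\rfloor]\big)$. $M\in AD_{p,q}$ (admissible) if $S\cap FR_{p,q}$ contains the segments $\{l\}\times[-\lfloor q/2\rfloor+1,\nu+\lfloor q/2\rfloor]$ for $l=-\lfloor p/2\rfloor+1,\dots,1$ and $l=\mu,\dots,\mu+\lfloor p/2\rfloor$, and $[-\lfloor p/2\rfloor+1,\mu+\lfloor p/2\rfloor]\times\{l\}$ for $l=-\lfloor q/2\rfloor+1,\dots,1$ and $l=\nu,\dots,\nu+\lfloor q/2\rfloor$, and all vertices in $(-\lfloor p/2\rfloor+1,\mu+\lfloor p/2\rfloor)\times(-\lfloor q/2\rfloor+1,\nu+\lfloor q/2\rfloor)\cap FR_{p,q}$ have valence 4. **Anchors and index vectors.** $\mathcal{A}_{p,q}(M)$ is the set of all $A\subset AR_{p,q}$ that are: vertices if $p,q$ are even; horizontal edges if $p$ is odd and $q$ even; vertical edges if $p$ is even and $q$ odd; cells if $p,q$ are odd. Write $A=a\times b$ with each of $a,b$ a singleton or an open interval. The global horizontal index vector is $\mathbf{I^s}(A)=\{i\in\mathbb Z:\{i\}\times b\subset vS\}$ and the global vertical one is $\mathbf{I^t}(A)=\{j\in\mathbb Z: a\times\{j\}\subset hS\}$, in increasing order. The local horizontal index vector $\mathbf{I^s_l}(A)=\{i_1<\dots<i_{p+1}\}$ consists of $p+1$ consecutive elements of $\mathbf{I^s}(A)$ with $a=\{i_{p/2+1}\}$ if $p$ is even and $a=(i_{(p+1)/2},i_{(p+1)/2+1})$ if $p$ is odd; $\mathbf{I^t_l}(A)$ ($q+1$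 elements) is defined analogously from $\mathbf{I^t}(A)$ and $b$. For an index vector $\mathbf{I^s}$, $\mathbf{\Sigma^s}(\mathbf{I^s})=\{s_i:i\in\mathbf{I^s}\}$ (with repetitions), similarly $\mathbf{\Sigma^t}(\mathbf{I^t})$. **Weak dual-compatibility.** Two anchors $A_1,A_2$ are left-horizontally shifted if $|\min\mathbf{I^s_l}(A_1)-\min\mathbf{I^s_l}(A_2)|>0$ and, if $\min\mathbf{\Sigma^s}(\mathbf{I^s_l}(A_1))=\min\mathbf{\Sigma^s}(\mathbf{I^s_l}(A_2))$, the respective multiplicities of these minimal knots in $\mathbf{\Sigma^s}(\mathbf{I^s_l}(A_1))$ and $\mathbf{\Sigma^s}(\mathbf{I^s_l}(A_2))$ are different. They are right-horizontally shifted if the same holds with $\max$ in place of $\min$. They are down-vertically (resp. up-vertically) shifted if the condition with $\min$ (resp. $\max$) holds for $\mathbf{I^t_l}$, $\mathbf{\Sigma^t}$ in place of $\mathbf{I^s_l}$, $\mathbf{\Sigma^s}$. The T-mesh is weakly dual-compatible of type RD if any two distinct anchors are right-horizontally or down-vertically shifted; of type RU if any two distinct anchors are right-horizontally or up-vertically shifted; of type LD if any two distinct anchors are left-horizontally or down-vertically shifted; of type LU if any two distinct anchors are left-horizontally or up-vertically shifted (''or'' inclusive). **GB-splines.** Given a knot vector $s_1\le\dots\le s_{n+p}$ (multiplicities at most $p$) and functions $u_i,v_i\in C^{p-2}[s_i,s_{i+1}]$, $i=1,\dots,n+p-1$, such that the span $W$ of $\frac{d^{p-2}u_i}{ds^{p-2}},\frac{d^{p-2}v_i}{ds^{p-2}}$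 is a (two-dimensional) Chebyshev space on $[s_i,s_{i+1}]$ (each nonzero element has at most one zero there), choose generators $U_i,V_i$ of $W$ with $U_i(s_i)>0$, $U_i(s_{i+1})=0$, $V_i(s_i)=0$, $V_i(s_{i+1})>0$. Put $N^{(2)}_i(s)=V_i(s)/V_i(s_{i+1})$ on $[s_i,s_{i+1})$, $U_{i+1}(s)/U_{i+1}(s_{i+1})$ on $[s_{i+1},s_{i+2})$, and $0$ otherwise; for $3\le k\le p$, $N^{(k)}_i(s)=\int_{-\infty}^s\big(\delta^{(k-1)}_iN^{(k-1)}_i(r)-\delta^{(k-1)}_{i+1}N^{(k-1)}_{i+1}(r)\big)dr$ with $\delta^{(k)}_i=\big[\int_{-\infty}^{\infty} N^{(k)}_i(r)\,dr\big]^{-1}$, where if $N^{(k)}_i\equiv0$ one sets $\int_{-\infty}^s\delta^{(k)}_iN^{(k)}_i(r)\,dr=1$ for $s\ge s_{i+k}$ and $0$ for $s<s_{i+k}$. The $N^{(p)}_i$ are the GB-splines of order $p$. **GT-splines.** To $\mathbf{\Sigma^s}$ are associated vectors of functions $\mathbf{\Omega^s_u}=\{u^s_i\}$, $\mathbf{\Omega^s_v}=\{v^s_i\}$, one pair per knot interval index, and similarly $\mathbf{\Omega^t_u},\mathbf{\Omega^t_v}$ to $\mathbf{\Sigma^t}$. $\mathbf{\Omega^s_u}(\mathbf{I^s})$, $\mathbf{\Omega^s_v}(\mathbf{I^s})$ consist of the $u^s_i$, $v^s_i$ with $i\in\mathbf{I^s}$ other than the last index (similarly for $t$). For each anchor $A$,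 the GT-spline is $N_A(s,t)=N[\mathbf{\Sigma^s}(\mathbf{I^s_l}(A)),\mathbf{\Omega^s_u}(\mathbf{I^s_l}(A)),\mathbf{\Omega^s_v}(\mathbf{I^s_l}(A))](s)\cdot N[\mathbf{\Sigma^t}(\mathbf{I^t_l}(A)),\mathbf{\Omega^t_u}(\mathbf{I^t_l}(A)),\mathbf{\Omega^t_v}(\mathbf{I^t_l}(A))](t)$, where $N[\cdot]$ is the single univariate GB-spline (order $p$ in $s$, $q$ in $t$) on the given knots and functions. The functions are assumed compatible with knot insertion: for every anchor $A$ and consecutive indices $i<i'$ of $\mathbf{I^s}(A)$, $u^s_i,v^s_i$ are admissible (smooth, with the Chebyshev property) on $[s_i,s_{i'}]$ and $u^s_k=u^s_i$, $v^s_k=v^s_i$ for $i\le k<i'$; similarly in $t$. **VMCR T-meshes.** The underlying tensor-product mesh $\hat M$ of $M$ is the mesh on the same index domain, with the same knot and function vectors, obtained by adding vertices and edges to $M$ so that all vertices have valence 4 (the full integer grid, so that global index vectors of its anchors contain all indices). Let $\mathcal{A}_{p,q}(M)=\{A_1,\dots,A_n\}$, $\mathcal{A}_{p,q}(\hat M)=\{\hat A_1,\dots,\hat A_{\hat n}\}$. $\mathbf C=(c_{ij})$ is the $n\times\hat n$ matrix, obtained by repeated knot insertion, with $N_{A_i}=\sum_j c_{ij}\hat N_{\hat A_j}$, where $\hat N_{\hat A_j}$ are the (linearly independent) GT-splines associated to $\hat M$. In a matrix, if all elements of some row are zero except the one in column $j$, column $j$ is called innocuous; the column reduction procedure removes all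 innocuous columns and all zero rows left after this removal, repeatedly until no further reduction is possible. $M$ is VMCR if column reduction applied to $\mathbf C^T$ gives the void ($0\times0$) matrix. (Equivalently, the same holds for the analogous matrix $\mathbf D$ of the polynomial T-splines of bi-degree $(p-1,q-1)$, built with B-splines on the same local knot vectors.) *)

(* Defs.v *)
From HB Require Import structures.
From mathcomp Require Import all_boot all_order all_algebra.
From mathcomp Require Import all_classical all_reals all_analysis.

Set Implicit Arguments.
Unset Strict Implicit.
Unset Printing Implicit Defensive.

Import Order.TTheory GRing.Theory Num.Theory.
Import numFieldNormedType.Exports.

Local Open Scope classical_set_scope.
Local Open Scope ring_scope.

(* The mu + 2 * floor(p/2) knot indices of one direction. The ordinal i stands
   for the integer index i - floor(p/2) + 1, see [grid_coord]. *)
Notation idx p mu := 'I_(mu + p./2.*2).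

(* A vertex, open edge or open cell a x b is encoded as (a, b), where each side
   is a pair of indices: (i, i) encodes the singleton {i} and (i, j) with i < j
   encodes the open interval ]i, j[. *)
Notation box p q mu nu := ((idx p mu * idx p mu) * (idx q nu * idx q nu))%type.

Section IndexTMesh.
Variables (R : realType) (p q mu nu : nat).
Local Notation box := (box p q mu nu).

Definition grid_coord (o n : nat) (i : idx o n) : R := i%:R - (o./2)%:R + 1.

Definition side (o n : nat) (a : idx o n * idx o n) : set R :=
  [set x | if a.1 == a.2 then x = grid_coord a.1 else grid_coord a.1 < x < grid_coord a.2].

Definition region (A : box) : set (R * R) := side A.1 `*` side A.2.

Definition closed_region (A : box) : set (R * R) :=
  `[grid_coord A.1.1, grid_coord A.1.2] `*` `[grid_coord A.2.1, grid_coord A.2.2].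

Definition extent (o n : nat) : set R :=
  `[1 - (o./2)%:R, n%:R + (o./2)%:R].

Definition open_extent (o n : nat) : set R :=
  `]1 - (o./2)%:R, n%:R + (o./2)%:R[.

Definition frame_extent (o n : nat) : set R :=
  `[1 - (o./2)%:R, 1] `|` `[n%:R, n%:R + (o./2)%:R].

Definition index_domain : set (R * R) := extent p mu `*` extent q nu.

Definition active_region : set (R * R) := `[1, mu%:R] `*` `[1, nu%:R].

Definition frame_region : set (R * R) :=
  frame_extent p mu `*` extent q nu `|` extent p mu `*` frame_extent q nu.

(* A mesh is given by its set of cells. Its vertices are the corners of its
   cells; this leaves no room for I-junctions, nor for L-junctions other than
   the four corners of the index domain. *)
Definition index_tmesh (M : {set box}) : Prop :=
  [/\ forall c, c \in M -> (c.1.1 < c.1.2)%N /\ (c.2.1 < c.2.2)%N,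
      forall c d, c \in M -> d \in M -> c != d ->
        region c `&` region d = set0
    & \bigcup_(c in [set` M]) closed_region c = index_domain].

Definition vtx (i : idx p mu) (j : idx q nu) : box := ((i, i), (j, j)).

Definition vertices (M : {set box}) : {set box} :=
  [set vtx w.1 w.2 | w : idx p mu * idx q nu & [exists c in M,
    ((w.1 == c.1.1) || (w.1 == c.1.2)) && ((w.2 == c.2.1) || (w.2 == c.2.2))]].

Definition skeleton (M : {set box}) : set (R * R) :=
  index_domain `\` \bigcup_(c in [set` M]) region c.

Definition hedges (M : {set box}) : {set box} :=
  [set e : box | [&& (e.1.1 < e.1.2)%N, e.2.1 == e.2.2,
     vtx e.1.1 e.2.1 \in vertices M, vtx e.1.2 e.2.1 \in vertices M,
     ~~ [exists k : idx p mu,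
           (e.1.1 < k < e.1.2)%N && (vtx k e.2.1 \in vertices M)]
   & `[< region e `<=` skeleton M >]]].

Definition vedges (M : {set box}) : {set box} :=
  [set e : box | [&& e.1.1 == e.1.2, (e.2.1 < e.2.2)%N,
     vtx e.1.1 e.2.1 \in vertices M, vtx e.1.1 e.2.2 \in vertices M,
     ~~ [exists k : idx q nu,
           (e.2.1 < k < e.2.2)%N && (vtx e.1.1 k \in vertices M)]
   & `[< region e `<=` skeleton M >]]].

Definition hS (M : {set box}) : set (R * R) :=
  \bigcup_(A in [set` hedges M :|: vertices M]) region A.

Definition vS (M : {set box}) : set (R * R) :=
  \bigcup_(A in [set` vedges M :|: vertices M]) region A.

Definition meshS (M : {set box}) : set (R * R) := hS M `|` vS M.

Definition valence (M : {set box}) (w : box) : nat :=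
  #|[pred e in hedges M :|: vedges M |
      (w == vtx e.1.1 e.2.1) || (w == vtx e.1.2 e.2.2)]|.

Definition admissible (M : {set box}) : Prop :=
  [/\ index_tmesh M,
      forall l : idx p mu, grid_coord l <= 1 \/ mu%:R <= grid_coord l ->
        [set grid_coord l] `*` extent q nu `<=` meshS M `&` frame_region,
      forall l : idx q nu, grid_coord l <= 1 \/ nu%:R <= grid_coord l ->
        extent p mu `*` [set grid_coord l] `<=` meshS M `&` frame_region
    & forall w, w \in vertices M ->
        region w `<=` (open_extent p mu `*` open_extent q nu) `&` frame_region ->
        valence M w = 4%N].

Definition anchors (M : {set box}) : {set box} :=
  [set A in match odd p, odd q with
            | false, false => vertices M
            | true, false => hedges M
            | false, true => vedges M
            | true, true => M
            end | `[< region A `<=` active_region >]].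

(* Indices outside of the index domain never satisfy these conditions; [enum]
   lists ordinals in increasing order. *)
Definition hindex (M : {set box}) (A : box) : seq (idx p mu) :=
  [seq i <- enum (idx p mu) |
     `[< [set grid_coord i] `*` side A.2 `<=` vS M >]].

Definition vindex (M : {set box}) (A : box) : seq (idx q nu) :=
  [seq j <- enum (idx q nu) |
     `[< side A.1 `*` [set grid_coord j] `<=` hS M >]].

(* The o + 1 consecutive elements of I among which i has rank floor(o/2),
   counting from 0. Applied to the lower end i of the side a of an anchor, this
   puts a at rank o/2 + 1 (counting from 1) when o is even, and the ends of a at
   ranks (o+1)/2 and (o+1)/2 + 1 when o is odd. *)
Definition window (o n : nat) (I : seq 'I_n) (i : 'I_n) : seq 'I_n :=
  take o.+1 (drop (index i I - o./2) I).

Definition hlocal (M : {set box}) (A : box) : seq (idx p mu) :=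
  window p (hindex M A) A.1.1.

Definition vlocal (M : {set box}) (A : box) : seq (idx q nu) :=
  window q (vindex M A) A.2.1.

(* The mesh whose cells are all the unit squares of the index domain. *)
Definition tensor_mesh : {set box} :=
  [set c : box | (c.1.2 == c.1.1.+1 :> nat) && (c.2.2 == c.2.1.+1 :> nat)].

End IndexTMesh.

Section WeakDualCompatibility.
Variables (R : realType) (n : nat) (knot : 'I_n -> R).
Implicit Type I : seq 'I_n.

Definition local_knots I : seq R := map knot I.

(* Index vectors are increasing and knots nondecreasing: minima are heads and
   maxima are last elements. *)
Definition min_shifted I1 I2 : Prop :=
  let k1 := head 0 (local_knots I1) in
  let k2 := head 0 (local_knots I2) in
  head 0%N (map val I1) <> head 0%N (map val I2) /\
  (k1 = k2 ->
   count_mem k1 (local_knots I1) <> count_mem k2 (local_knots I2)).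

Definition max_shifted I1 I2 : Prop :=
  let k1 := last 0 (local_knots I1) in
  let k2 := last 0 (local_knots I2) in
  last 0%N (map val I1) <> last 0%N (map val I2) /\
  (k1 = k2 ->
   count_mem k1 (local_knots I1) <> count_mem k2 (local_knots I2)).

End WeakDualCompatibility.

Variant wdc_type := RD | RU | LD | LU.

Definition weakly_dual_compatible (R : realType) (p q mu nu : nat)
    (s : idx p mu -> R) (t : idx q nu -> R) (ty : wdc_type)
    (M : {set box p q mu nu}) : Prop :=
  forall A1 A2, A1 \in anchors R M -> A2 \in anchors R M -> A1 != A2 ->
  let hs1 := hlocal R M A1 in let hs2 := hlocal R M A2 in
  let vt1 := vlocal R M A1 in let vt2 := vlocal R M A2 in
  match ty with
  | RD => max_shifted s hs1 hs2 \/ min_shifted t vt1 vt2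
  | RU => max_shifted s hs1 hs2 \/ max_shifted t vt1 vt2
  | LD => min_shifted s hs1 hs2 \/ min_shifted t vt1 vt2
  | LU => min_shifted s hs1 hs2 \/ max_shifted t vt1 vt2
  end.

Section GBSplines.
Variable R : realType.

(* f' is the derivative of f on D, one-sided at the ends of D. *)
Definition derivative_on (D : set R) (f f' : R -> R) : Prop :=
  forall x, D x -> (f y - f x) / (y - x) @[y --> within D x^'] --> f' x.

Fixpoint Ck_derivative_on (D : set R) (k : nat) (f g : R -> R) : Prop :=
  match k with
  | 0 => {within D, continuous f} /\ {in D, f =1 g}
  | k'.+1 => exists2 f', derivative_on D f f' & Ck_derivative_on D k' f' g
  end.

Definition span2 (D : set R) (f g : R -> R) : set (R -> R) :=
  [set h | exists a b, forall x, D x -> h x = a * f x + b * g x].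

Definition chebyshev2 (D : set R) (f g : R -> R) : Prop :=
  (forall a b, (forall x, D x -> a * f x + b * g x = 0) -> a = 0 /\ b = 0) /\
  (forall h, span2 D f g h -> (exists2 x, D x & h x != 0) ->
     forall x y, D x -> D y -> h x = 0 -> h y = 0 -> x = y).

Definition admissible_pair (p : nat) (a b : R) (u v : R -> R) : Prop :=
  exists f g, [/\ Ck_derivative_on `[a, b] (p - 2) u f,
                  Ck_derivative_on `[a, b] (p - 2) v g
                & chebyshev2 `[a, b] f g].

Definition generators (p : nat) (a b : R) (u v : R -> R) :
    set ((R -> R) * (R -> R)) :=
  [set UV | exists f g,
    [/\ Ck_derivative_on `[a, b] (p - 2) u f,
        Ck_derivative_on `[a, b] (p - 2) v g,
        span2 `[a, b] UV.1 UV.2 = span2 `[a, b] f g,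
        0 < UV.1 a /\ UV.1 b = 0
      & UV.2 a = 0 /\ 0 < UV.2 b]].

(* The generators are unique up to positive factors, which cancel out in [gbN];
   hence the choice made here is immaterial. *)
Definition generator_pair (p : nat) (a b : R) (u v : R -> R) :
    (R -> R) * (R -> R) :=
  xget (cst 0, cst 0) (generators p a b u v).

(* The integral of delta * f over ]-oo, s], where delta is the inverse of the
   integral of f; if f = 0, the Heaviside function jumping at x instead. *)
Definition normalized_cumulative (f : R -> R) (x s : R) : R :=
  if `[< f = cst 0 >] then (x <= s)%R%:R
  else let delta := (\int[lebesgue_measure]_r f r)^-1 in
       \int[lebesgue_measure]_(r in `]-oo, s]) (delta * f r).

Section Recursion.
Variables (p : nat) (xi : seq R) (u v : seq (R -> R)).

Definition genU (i : nat) : R -> R :=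
  (generator_pair p xi`_i xi`_i.+1 (nth (cst 0) u i) (nth (cst 0) v i)).1.

Definition genV (i : nat) : R -> R :=
  (generator_pair p xi`_i xi`_i.+1 (nth (cst 0) u i) (nth (cst 0) v i)).2.

(* [gbN m i] is the spline of order m + 2 supported on the knots of ranks
   i, ..., i + m + 2, counting from 0. *)
Fixpoint gbN (m i : nat) : R -> R :=
  match m with
  | 0 => fun s =>
      if xi`_i <= s < xi`_i.+1 then genV i s / genV i xi`_i.+1
      else if xi`_i.+1 <= s < xi`_i.+2 then genU i.+1 s / genU i.+1 xi`_i.+1
      else 0
  | m'.+1 => fun s =>
      normalized_cumulative (gbN m' i) xi`_(i + m'.+2) s
      - normalized_cumulative (gbN m' i.+1) xi`_(i.+1 + m'.+2) s
  end.

Definition gb_spline : R -> R := gbN (p - 2) 0.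

End Recursion.

Definition local_gb_spline (p n : nat) (knot : 'I_n -> R)
    (u v : 'I_n -> R -> R) (I : seq 'I_n) : R -> R :=
  let J := take (size I).-1 I in
  gb_spline p (local_knots knot I) (map u J) (map v J).

Definition knot_vector (p n : nat) (knot : 'I_n -> R) : Prop :=
  (forall i j : 'I_n, (i <= j)%N -> knot i <= knot j) /\
  (forall i : 'I_n, (#|[pred j | knot j == knot i]| <= p)%N).

(* u i and v i only matter on the knot interval starting at the i-th knot, and
   nothing is required when it has length 0; the last index is never used. *)
Definition function_vectors (p n : nat) (knot : 'I_n -> R)
    (u v : 'I_n -> R -> R) : Prop :=
  forall i i' : 'I_n, i' = i.+1 :> nat -> knot i < knot i' ->
    admissible_pair p (knot i) (knot i') (u i) (v i).

Definition insertion_compatible (p n : nat) (knot : 'I_n -> R)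
    (u v : 'I_n -> R -> R) (I : seq 'I_n) : Prop :=
  forall i i' : 'I_n, i \in I -> i' \in I -> (i < i')%N ->
    (forall k : 'I_n, k \in I -> ~~ (i < k < i')%N) -> knot i < knot i' ->
    admissible_pair p (knot i) (knot i') (u i) (v i) /\
    (forall k : 'I_n, (i <= k < i')%N ->
       {in `[knot i, knot i'], u k =1 u i} /\
       {in `[knot i, knot i'], v k =1 v i}).

End GBSplines.

Section ColumnReduction.
Variables (R : realType) (m n : nat) (A : 'M[R]_(m, n)).

(* Submatrices of A are given by their sets of rows and columns. *)
Definition innocuous (X : {set 'I_m} * {set 'I_n}) (j : 'I_n) : bool :=
  (j \in X.2) &&
  [exists i in X.1,
    (A i j != 0) && [forall k in X.2, (k != j) ==> (A i k == 0)]].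

Definition reduction_step (X : {set 'I_m} * {set 'I_n}) :
    {set 'I_m} * {set 'I_n} :=
  let cols := [set j in X.2 | ~~ innocuous X j] in
  ([set i in X.1 | [exists j in cols, A i j != 0]], cols).

(* Each step that is not idle removes a row or a column, so that m + n steps
   reach the fixpoint. *)
Definition column_reduction : {set 'I_m} * {set 'I_n} :=
  iter (m + n) reduction_step (finset.setT, finset.setT).

End ColumnReduction.

Section VMCR.
Variables (R : realType) (p q mu nu : nat).
Variables (s : idx p mu -> R) (us vs : idx p mu -> R -> R).
Variables (t : idx q nu -> R) (ut vt : idx q nu -> R -> R).
Local Notation box := (box p q mu nu).

Definition gt_spline (M : {set box}) (A : box) (x y : R) : R :=
  local_gb_spline p s us vs (hlocal R M A) x *
  local_gb_spline q t ut vt (vlocal R M A) y.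

Local Notation Mhat := (tensor_mesh p q mu nu).

Definition insertion_matrix (M : {set box})
    (C : 'M[R]_(#|anchors R M|, #|anchors R Mhat|)) : Prop :=
  forall i x y, gt_spline M (enum_val i) x y =
    \sum_j C i j * gt_spline Mhat (enum_val j) x y.

(* The GT-splines of Mhat are linearly independent, so that [insertion_matrix]
   determines C; the empty pair of index sets is the void matrix. *)
Definition VMCR (M : {set box}) : Prop :=
  exists2 C, @insertion_matrix M C & column_reduction C^T = (finset.set0, finset.set0).

End VMCR.

(* Main.v *)
Require Import Defs.
From mathcomp Require Import all_boot all_order all_algebra.
From mathcomp Require Import all_classical all_reals all_analysis.
From mathcomp Require Import measurable_realfun.
From mathcomp Require Import ring lra zify.

Set Implicit Arguments.
Unset Strict Implicit.
Unset Printing Implicit Defensive.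

Import Order.TTheory GRing.Theory Num.Theory.
Import numFieldNormedType.Exports.

Local Open Scope classical_set_scope.
Local Open Scope ring_scope.

(** The spline of an anchor is a product of two univariate splines on local
    knots, so its expansion over the tensor-product mesh is the product of two
    univariate expansions.  In such an expansion the first fine spline with a
    nonzero coefficient is the one that leaves zero with the same smoothness at
    the same place: its least knot has the value and the multiplicity of the least
    coarse knot.  Symmetrically, the last one has the greatest coarse knot as its
    greatest knot, with the same multiplicity.  The position of this extreme
    coefficient is the key of a local index vector ([knot_key]).  It determines
    the extreme knot and its multiplicity ([knot_key_inj]), hence two shifted
    anchors have different keys, and under weak dual-compatibility the pairs of
    keys, first or last in each direction according to the type, are pairwise
    distinct.

    This makes the transposed matrix triangular enough.  Consider its row indexed
    by the pair of keys of an anchor A.  The entry of A is a product of two extreme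
    coefficients and does not vanish.  Any other nonzero entry comes from an anchor
    whose keys are at most those of A in the directions where keys are positions of
    first coefficients, and at least those of A where they are positions of last
    coefficients.  Among the remaining columns, one that is extremal in this sense
    is therefore innocuous, and column reduction never gets stuck
    ([column_reduction_void]).

    The expansion itself ([knot_insertion]) is obtained by inserting all knots at
    once, by induction on the order.  A spline of the next order is the difference
    of two consecutive normalized primitives of splines.  If the coarse splines
    are combinations of fine ones, then their normalized primitives are
    combinations of the fine normalized primitives with weights of sum 1, and
    summation by parts turns the difference of two such families of weights into
    coefficients for the next order.  The outermost weight belongs to only one of
    the two families, so the extreme coefficient cannot cancel.

    Normalizing requires that a spline whose knots are not all equal has a nonzero
    integral.  It is nonnegative because a combination of n consecutive splines
    takes at most n values of alternating signs ([spl_alternates]): at order two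
    this is the Chebyshev property, and the recursion preserves it by Rolle's
    argument, in the form that a primitive can only increase where its density is
    positive somewhere.  It is not zero because it is positive just after its
    least knot ([spl_pos]), where each spline dominates the next one if they start
    at the same knot ([spl_dom]).

    The geometry of the mesh enters only through the local index vectors: the lines
    of the frame leave enough indices on both sides of an anchor for a full window
    ([size_hlocal], [size_vlocal]). *)

(** * Integrals over half-lines *)

Section Cumulative.
Variable R : realType.
Implicit Types (f g : R -> R) (a b x y : R).

Local Notation mu := (@lebesgue_measure R).

Definition integrableR f : Prop := mu.-integrable setT (EFin \o f).

Definition mass f : R := \int[mu]_r f r.

Definition cumul f x : R := \int[mu]_(r in `]-oo, x]) f r.

Lemma integrableR_on f (D : set R) :
  measurable D -> integrableR f -> mu.-integrable D (EFin \o f).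
Proof. by move=> mD; apply: integrableS. Qed.

Lemma integrableR_sum n (c : nat -> R) (F : nat -> R -> R) :
  (forall k, (k < n)%N -> integrableR (F k)) ->
  integrableR (fun x => \sum_(k < n) c k * F k x).
Proof.
move=> hF; rewrite /integrableR.
have -> : EFin \o (fun x => \sum_(k < n) c k * F k x) =
   (fun x => \sum_(k <- index_enum 'I_n) (c k * F k x)%:E)%E.
  by apply/funext => x /=; rewrite sumEFin.
apply: integrable_sum => //= k _.
have -> : (fun x => (c k * F k x)%:E) = (fun x => (c k)%:E * (EFin \o F k) x)%E.
  by apply/funext => x /=; rewrite EFinM.
by apply: integrableZl => //; exact: hF.
Qed.

Lemma Rintegral_lincomb (D : set R) n (c : nat -> R) (F : nat -> R -> R) :
  measurable D -> (forall k, (k < n)%N -> integrableR (F k)) ->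
  \int[mu]_(x in D) (\sum_(k < n) c k * F k x) =
  \sum_(k < n) c k * \int[mu]_(x in D) F k x.
Proof.
move=> mD; elim: n => [|n IH] hF.
  under eq_Rintegral do rewrite big_ord0.
  by rewrite big_ord0 Rintegral_cst// mul0r.
under eq_Rintegral do rewrite big_ord_recr /=.
have hn : mu.-integrable D (EFin \o F n) by apply: integrableR_on => //; exact: hF.
rewrite RintegralD //; last 2 first.
- apply: integrableR_on => //; apply: integrableR_sum => k kn; apply: hF.
  by rewrite ltnS ltnW.
- have -> : EFin \o (fun x => c n * F n x) = (fun x => (c n)%:E * (EFin \o F n) x)%E.
    by apply/funext => x /=; rewrite EFinM.
  exact: integrableZl.
rewrite RintegralZl // big_ord_recr IH // => k kn.
by apply: hF; rewrite ltnS ltnW.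
Qed.

Lemma cumul_lincomb n (c : nat -> R) (F : nat -> R -> R) x :
  (forall k, (k < n)%N -> integrableR (F k)) ->
  cumul (fun x => \sum_(k < n) c k * F k x) x = \sum_(k < n) c k * cumul (F k) x.
Proof. by move=> hF; apply: Rintegral_lincomb. Qed.

Lemma mass_lincomb n (c : nat -> R) (F : nat -> R -> R) :
  (forall k, (k < n)%N -> integrableR (F k)) ->
  mass (fun x => \sum_(k < n) c k * F k x) = \sum_(k < n) c k * mass (F k).
Proof. by move=> hF; apply: Rintegral_lincomb. Qed.

Lemma cumulZ f (c : R) x :
  integrableR f -> \int[mu]_(r in `]-oo, x]) (c * f r) = c * cumul f x.
Proof. by move=> hf; rewrite RintegralZl //; apply: integrableR_on. Qed.

Lemma cumulB f x y : integrableR f -> x <= y ->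
  cumul f y - cumul f x = \int[mu]_(r in `]x, y]) f r.
Proof.
move=> hf xy; rewrite /cumul Rintegral_itvB //.
exact: integrableR_on.
Qed.

Lemma cumul_mass f x : (forall r, x < r -> f r = 0) -> cumul f x = mass f.
Proof.
move=> hf; rewrite /cumul Rintegral_mkcond; congr Rintegral.
apply/funext => r; rewrite patchE; case: ifPn => // /negP h.
rewrite hf // ltNge; apply/negP => rx; apply: h.
by rewrite inE /= in_itv.
Qed.

Lemma cumul_eq0 f x : (forall r, r <= x -> f r = 0) -> cumul f x = 0.
Proof.
move=> hf; rewrite /cumul.
rewrite (@eq_Rintegral _ _ _ _ _ (fun=> 0 : R)); last first.
  by move=> r; rewrite inE /= in_itv /= => rx; rewrite hf.
by rewrite Rintegral_cst// mul0r.
Qed.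

Lemma cumul_ge0 f x : (forall r, 0 <= f r) -> 0 <= cumul f x.
Proof. by move=> hf; apply: Rintegral_ge0. Qed.

Lemma le_cumul f g x : integrableR f -> integrableR g ->
  (forall r, r <= x -> f r <= g r) -> cumul f x <= cumul g x.
Proof.
move=> hf hg fg; apply: le_Rintegral => //; try exact: integrableR_on.
Qed.

Lemma cumul_homo f x y : integrableR f -> (forall r, 0 <= f r) ->
  x <= y -> cumul f x <= cumul f y.
Proof.
move=> hf f0 xy; rewrite -subr_ge0 cumulB //; exact: Rintegral_ge0.
Qed.

(** Rolle's theorem for primitives, without continuity of the density.  The factor
    c stands for a sign, so that decreasing primitives are covered too. *)
Lemma cumulB_gt0 f (c x y : R) : integrableR f -> x <= y ->
  0 < c * (cumul f y - cumul f x) -> exists2 z, x < z <= y & 0 < c * f z.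
Proof.
move=> hf xy; rewrite cumulB // -RintegralZl //; last exact: integrableR_on.
move=> hpos; apply/not_exists2P => hn; move: hpos; apply/negP; rewrite -leNgt.
rewrite -(mul0r (fine (mu `]x, y])%E)) -Rintegral_cst//.
apply: le_Rintegral => //; [|exact: integrable0|].
  have -> : EFin \o (fun r => c * f r) = (fun r => c%:E * (EFin \o f) r)%E.
    by apply/funext => r /=; rewrite EFinM.
  by apply: integrableZl => //; exact: integrableR_on.
move=> r /=; rewrite in_itv /= => xry.
by case: (hn r) => [/negP|/negP]; rewrite ?xry // -leNgt.
Qed.

Lemma cumulB_le f (C x y : R) : integrableR f -> (forall r, f r <= C) ->
  x <= y -> cumul f y - cumul f x <= C * (y - x).
Proof.
move=> hf fC xy; rewrite cumulB //.
have -> : y - x = fine (mu `]x, y]).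
  rewrite lebesgue_measure_itv /= lte_fin; case: ltP => [//|yx].
  by apply/eqP; rewrite subr_eq0 eq_le xy yx.
rewrite -Rintegral_cst //; apply: le_Rintegral => //; first exact: integrableR_on.
have h : mu.-integrable `[x, y] (EFin \o cst C).
  apply: continuous_compact_integrable; first exact: segment_compact.
  by apply: continuous_subspaceT => r; exact: cst_continuous.
by apply: integrableS h => //; apply: subset_itvr; rewrite bnd_simp.
Qed.

(** If the integral vanished, f would vanish almost everywhere, contrary to its
    positivity on an interval of positive length. *)
Lemma cumul_gt0 f a b x : integrableR f -> (forall r, 0 <= f r) ->
  a < b -> (forall r, a < r < b -> 0 < f r) -> a < x -> 0 < cumul f x.
Proof.
move=> hf f0 ab fpos ax.
rewrite lt_neqAle cumul_ge0 // andbT; apply/negP => /eqP h0.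
pose c := Num.min b x.
have ac : a < c by rewrite lt_min ab ax.
have mD : measurable `]-oo, x] by [].
have hi : mu.-integrable `]-oo, x] (EFin \o f) by exact: integrableR_on.
have [mf _] := integrableP _ _ _ hi.
have hz : (\int[mu]_(r in `]-oo, x]) `|(EFin \o f) r| = 0)%E.
  under eq_integral => r _ do rewrite /= ger0_norm //.
  by rewrite -(fineK (integrable_fin_num _ hi)) // -[fine _]/(cumul f x) -h0.
have /= [N [mN N0 hN]] := (ae_eq_integral_abs mu mD mf).1 hz.
have : (mu `]a, c[ <= mu N)%E.
  apply: le_measure; rewrite ?inE // => r /=; rewrite in_itv /= => /andP[ar rc].
  apply: hN => /= h; move: rc; rewrite lt_min => /andP[rb rx].
  have /= : r \in `]-oo, x] by rewrite in_itv /= ltW.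
  move=> rin; have [] := h rin => /eqP; rewrite gt_eqF // fpos //.
  by rewrite ar rb.
rewrite N0 lebesgue_measure_itv /= lte_fin ac -EFinD lee_fin leNgt subr_gt0.
by rewrite ac.
Qed.

Lemma mass_gt0 f a b : integrableR f -> (forall r, 0 <= f r) ->
  a < b -> (forall r, a < r < b -> 0 < f r) -> 0 < mass f.
Proof.
move=> hf f0 ab fpos.
apply: (lt_le_trans (cumul_gt0 hf f0 ab fpos ab)).
rewrite /cumul Rintegral_mkcond; apply: le_Rintegral => //.
- by rewrite -restrict_EFin; apply/(integrable_mkcond _ _).1 => //; exact: integrableR_on.
- by move=> r _; rewrite patchE; case: ifP.
Qed.

End Cumulative.

(** * Alternating values *)

Section Alternation.
Variable R : realType.
Implicit Types (f g G : R -> R) (b : nat) (x y : R) (xs ys : seq R).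

(** The parity of b fixes the sign expected at the first point.  Keeping it as a
    number makes the signs of a concatenation add up. *)
Fixpoint altsgn f b xs : Prop :=
  if xs is x :: xs' then 0 < (-1) ^+ b * f x /\ altsgn f b.+1 xs' else True.

Definition alternates f b xs : Prop := sorted <%R xs /\ altsgn f b xs.

Fixpoint zigzag G b x xs : Prop :=
  if xs is y :: xs' then 0 < (-1) ^+ b * (G y - G x) /\ zigzag G b.+1 y xs'
  else True.

Lemma altsgn_cat f b xs ys :
  altsgn f b (xs ++ ys) <-> altsgn f b xs /\ altsgn f (b + size xs) ys.
Proof.
elim: xs b => [|x xs IH] b /=; first by rewrite addn0; split => [|[]].
by rewrite IH addSnnS; split => [[? []]|[[]]].
Qed.

Lemma eq_altsgn f g b xs : {in xs, f =1 g} -> altsgn f b xs -> altsgn g b xs.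
Proof.
elim: xs b => [//|x xs IH] b fg /= [fx fxs]; split.
  by rewrite -fg ?mem_head.
by apply: IH fxs => y yxs; apply: fg; rewrite inE yxs orbT.
Qed.

Lemma altsgn_neq0 f b xs x : altsgn f b xs -> x \in xs -> f x != 0.
Proof.
elim: xs b => [//|y xs IH] b /= [fy fxs]; rewrite inE => /predU1P[->|]; last exact: IH fxs.
by apply: contraTneq fy => ->; rewrite mulr0 ltxx.
Qed.

Lemma altsgn_last f b x xs :
  altsgn f b (x :: xs) -> 0 < (-1) ^+ (b + size xs) * f (last x xs).
Proof.
elim: xs b x => [|y xs IH] b x /=; first by rewrite addn0 => -[].
by case=> _ /IH; rewrite addSnnS.
Qed.

Lemma altsgn_zigzag f b x xs : altsgn f b (x :: xs) -> zigzag f b.+1 x xs.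
Proof.
elim: xs b x => [//|y xs IH] b x /= [fx [fy fxs]]; split; last exact: IH.
by rewrite mulrBr subr_gt0; apply: lt_trans fy; rewrite exprS mulN1r mulNr oppr_lt0.
Qed.

Lemma zigzag_rcons G b x xs y : zigzag G b x xs ->
  0 < (-1) ^+ (b + size xs) * (G y - G (last x xs)) -> zigzag G b x (rcons xs y).
Proof.
elim: xs b x => [|z xs IH] b x /=; first by rewrite addn0.
by case=> Gz zz; rewrite -addSnnS => h; split => //; exact: IH.
Qed.

Lemma sorted_split xs y : sorted <%R xs -> exists ys zs,
  [/\ xs = ys ++ zs, {in ys, forall x, x < y} & {in zs, forall x, y <= x}].
Proof.
elim: xs => [|x xs IH] sx; first by exists [::], [::].
have [xy|yx] := ltP x y.
  have [ys [zs [-> h1 h2]]] := IH (path_sorted sx).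
  exists (x :: ys), zs; split => // z; rewrite inE => /predU1P[->//|]; exact: h1.
exists [::], (x :: xs); split => // z; rewrite inE => /predU1P[->//|zxs].
move: sx => /= /(order_path_min lt_trans) /allP /(_ z zxs) xz.
exact: le_trans (ltW xz).
Qed.

Lemma alternates_split f b xs y : alternates f b xs -> exists ys zs,
  [/\ xs = ys ++ zs, {in ys, forall x, x < y}, {in zs, forall x, y <= x},
      alternates f b ys & alternates f (b + size ys) zs].
Proof.
move=> [sx ax]; have [ys [zs [E h1 h2]]] := sorted_split y sx.
exists ys, zs; move: sx ax; rewrite E => sx /altsgn_cat[a1 a2].
have sub u v : subseq u v -> sorted <%R v -> sorted <%R u.
  by move=> *; apply: subseq_sorted; eauto; apply: lt_trans.
split => //; split => //; apply: sub sx; [exact: prefix_subseq|exact: suffix_subseq].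
Qed.

(** The iterated Rolle argument: each increment of G yields a point where g has
    the sign of that increment, and the half-open intervals between consecutive
    points keep these new points in order. *)
Lemma zigzag_alternates G g b x xs :
  path <%R x xs -> zigzag G b x xs ->
  {in x :: xs &, forall y z, y < z -> forall k,
     0 < (-1) ^+ k * (G z - G y) -> exists2 r, y < r <= z & 0 < (-1) ^+ k * g r} ->
  exists ys, [/\ path <%R x ys, altsgn g b ys & size ys = size xs].
Proof.
elim: xs b x => [|y xs IH] b x /=; first by exists [::].
move=> /andP[xy pxs] [Gy zz] H.
have [|ys [p a s]] := IH b.+1 y pxs zz.
  by move=> u v uin vin; apply: H; rewrite inE ?uin ?vin orbT.
have [||r /andP[xr ry] gr] := H x y _ _ xy b Gy; rewrite ?inE ?eqxx ?orbT //.
exists (r :: ys); split => //=; last by rewrite s.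
rewrite xr /=; case: ys p {a s} => [//|u us] /= /andP[yu ->].
by rewrite (le_lt_trans ry yu).
Qed.

End Alternation.

Section GoodPairs.
Variable R : realType.

(** What the splines use of the generators U and V of a Chebyshev space on [a, b].
    The field [good_UV] is the Chebyshev property in determinant form: the quotient
    V / U is strictly increasing. *)
Record good_pair (a b : R) (U V : R -> R) : Prop := GoodPair {
  good_contU : {within `[a, b], continuous U};
  good_contV : {within `[a, b], continuous V};
  good_Ub : U b = 0;
  good_Va : V a = 0;
  good_U : forall x, a <= x < b -> 0 < U x;
  good_V : forall x, a < x <= b -> 0 < V x;
  good_UV : forall x y, a <= x -> x < y -> y < b -> U y * V x < U x * V y
}.

Lemma integrableR_restrict (a b : R) (f : R -> R) :
  (a < b -> {within `[a, b], continuous f}) -> integrableR (f \_ `[a, b[).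
Proof.
move=> hf; rewrite /integrableR -restrict_EFin.
apply/(integrable_mkcond _ _).1 => //.
have [ab|ba] := ltP a b; last first.
  by rewrite set_itv_ge ?bnd_simp -?leNgt //; exact: integrable_set0.
have h := continuous_compact_integrable (@segment_compact _ a b) (hf ab).
by apply: integrableS h => //; apply: subset_itvl; rewrite bnd_simp.
Qed.

Lemma continuous_bounded (a b : R) (f : R -> R) : a <= b ->
  {within `[a, b], continuous f} -> exists2 C, 0 < C & forall x, a <= x <= b -> f x <= C.
Proof.
move=> ab cf; have [c cab hc] := EVT_max ab cf.
exists (Num.max 1 (f c)); first by rewrite lt_max ltr01.
by move=> x xab; rewrite le_max hc ?orbT // in_itv.
Qed.

Lemma continuous_right_end (a b : R) (f : R -> R) (e : R) : a < b -> 0 < e ->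
  {within `[a, b], continuous f} ->
  exists2 d, 0 < d & forall x, a <= x < a + d -> x < b /\ `|f a - f x| < e.
Proof.
move=> ab e0 /continuous_within_itvP => /(_ ab)[_ /cvgrPdist_lt/(_ e e0) h _].
have : \forall x \near a^'+, x < b /\ `|f a - f x| < e.
  by near=> x; split; near: x; [exact: nbhs_right_lt|exact: h].
move=> [d /= d0 hd]; exists d => // x /andP[ax xd].
move: ax; rewrite le_eqVlt => /predU1P[<-|ax]; first by rewrite subrr normr0.
by apply: hd => //=; rewrite ltr_distlC; apply/andP; split; lra.
Unshelve. all: by end_near.
Qed.

End GoodPairs.

(** * Splines of order two *)

Section Hats.
Variable R : realType.

(** The recursion of GB-splines over infinite knot sequences, with given
    generators on every knot interval; [spl xi U V m i] has order m + 2 and the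
    knots xi i, ..., xi (i + m + 2). *)
Fixpoint spl (xi : nat -> R) (U V : nat -> R -> R) (m i : nat) : R -> R :=
  match m with
  | 0 => fun s =>
      if xi i <= s < xi i.+1 then V i s / V i (xi i.+1)
      else if xi i.+1 <= s < xi i.+2 then U i.+1 s / U i.+1 (xi i.+1)
      else 0
  | m'.+1 => fun s =>
      normalized_cumulative (spl xi U V m' i) (xi (i + m'.+2)%N) s
      - normalized_cumulative (spl xi U V m' i.+1) (xi (i.+1 + m'.+2)%N) s
  end.

Variables (xi : nat -> R) (U V : nat -> R -> R).

Hypothesis xi_le : forall i j, (i <= j)%N -> xi i <= xi j.
Hypothesis goodUV : forall i, xi i < xi i.+1 ->
  good_pair (xi i) (xi i.+1) (U i) (V i).

Local Notation N := (spl xi U V).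

Lemma hat_left i x : xi i <= x < xi i.+1 -> N 0 i x = V i x / V i (xi i.+1).
Proof. by move=> /= ->. Qed.

Lemma hat_right i x :
  xi i.+1 <= x < xi i.+2 -> N 0 i x = U i.+1 x / U i.+1 (xi i.+1).
Proof.
by move=> /[dup] /andP[h _] /= ->; rewrite [x < xi i.+1]ltNge h andbF.
Qed.

Lemma hat_support i x : x < xi i \/ xi i.+2 <= x -> N 0 i x = 0.
Proof.
move=> /= [h|h].
  have h' : x < xi i.+1 by apply: (lt_le_trans h); apply: xi_le; lia.
  by rewrite leNgt h /= leNgt h'.
have h' : xi i.+1 <= x by apply: le_trans h; apply: xi_le; lia.
by rewrite [x < xi i.+1]ltNge h' andbF [x < xi i.+2]ltNge h andbF.
Qed.

Lemma hat_sum n i (a : nat -> R) x : xi (i + n)%N <= x < xi (i + n).+1 ->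
  \sum_(j < n.+1) a j * N 0 (i + j)%N x =
  (if n is n'.+1 then a n' / U (i + n)%N (xi (i + n)%N) else 0) * U (i + n)%N x
  + a n / V (i + n)%N (xi (i + n).+1) * V (i + n)%N x.
Proof.
move=> xn; rewrite big_ord_recr (hat_left xn); congr (_ + _); last first.
  by rewrite [RHS]mulrAC mulrA.
case: n xn => [|n] xn; first by rewrite big_ord0 mul0r.
rewrite big_ord_recr big1 /= ?add0r => [|j _].
  by rewrite addnS in xn *; rewrite -[X in _ * X]/(N 0 (i + n)%N x) hat_right // mulrA mulrAC.
rewrite -[X in _ * X]/(N 0 (i + j)%N x) hat_support ?mulr0 //; right.
by case/andP: xn => h _; apply: le_trans h; apply: xi_le; have := ltn_ord j; lia.
Qed.

(** Cramer's rule: two values of opposite signs of a combination of u and v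
    determine the signs of both coefficients, since the determinant of the system
    is positive. *)
Lemma good_pair_signs c d u v (al be y1 y2 e : R) : good_pair c d u v ->
  c <= y1 -> y1 < y2 -> y2 < d ->
  0 < e * (al * u y1 + be * v y1) -> e * (al * u y2 + be * v y2) < 0 ->
  0 < e * al /\ e * be < 0.
Proof.
move=> g cy y12 yd h1 h2.
have cy2 := le_lt_trans cy y12.
have u1 : 0 < u y1 by apply: (good_U g); rewrite cy (lt_trans y12).
have u2 : 0 < u y2 by apply: (good_U g); rewrite ltW.
have v2 : 0 < v y2 by apply: (good_V g); rewrite cy2 ltW.
have v1 : 0 <= v y1.
  move: cy; rewrite le_eqVlt => /predU1P[<-|cy]; first by rewrite (good_Va g).
  by apply/ltW/(good_V g); rewrite cy ltW // (lt_trans y12).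
have uv := good_UV g cy y12 yd.
have D : 0 < u y1 * v y2 - u y2 * v y1 by rewrite subr_gt0.
have E1 : (e * al) * (u y1 * v y2 - u y2 * v y1) =
   (e * (al * u y1 + be * v y1)) * v y2 - (e * (al * u y2 + be * v y2)) * v y1.
  by ring.
have E2 : (e * be) * (u y1 * v y2 - u y2 * v y1) =
   (e * (al * u y2 + be * v y2)) * u y1 - (e * (al * u y1 + be * v y1)) * u y2.
  by ring.
split.
  rewrite -(pmulr_lgt0 _ D) E1 subr_gt0.
  apply: (@le_lt_trans _ _ 0); last exact: mulr_gt0.
  by apply: mulr_le0_ge0 => //; exact: ltW.
rewrite -(pmulr_llt0 _ D) E2 subr_lt0; apply: (@lt_trans _ _ 0).
  by rewrite pmulr_llt0.
exact: mulr_gt0.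
Qed.

(** The induction on n needs more than a bound: the values taken before the middle
    knot of the last hat alternate at most n times, and if they do n times, the
    last coefficient has the sign of the last value. *)
Lemma hat_alternates_below n i (a : nat -> R) b xs :
  alternates (fun x => \sum_(j < n) a j * N 0 (i + j)%N x) b xs ->
  {in xs, forall x, x < xi (i + n)%N} ->
  (size xs < n)%N \/
  size xs = n /\ ((0 < n)%N -> 0 < (-1) ^+ (b + n.-1) * a n.-1).
Proof.
elim: n xs => [|n IH] xs ax xn.
  case: xs ax xn => [|x xs] ax _; first by right.
  by have := altsgn_neq0 ax.2 (mem_head _ _); rewrite big_ord0 eqxx.
have [ys [zs [E ysn zsn ay az]]] := alternates_split (xi (i + n)%N) ax.
have {}ay : alternates (fun x => \sum_(j < n) a j * N 0 (i + j)%N x) b ys.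
  split; first exact: ay.1.
  apply: eq_altsgn ay.2 => x xys; rewrite big_ord_recr /= -[X in _ * X]/(N 0 (i + n)%N x).
  by rewrite hat_support ?mulr0 ?addr0 //; left; exact: ysn.
have := IH ys ay ysn; rewrite {xs ax}E size_cat in xn *.
set k := size ys; set c := xi (i + n)%N; set d := xi (i + n).+1 => IHk.
case: zs zsn az xn => [|y1 zs] zsn az xn.
  by left; rewrite addn0; case: IHk => [|[-> _]] //; exact: ltnW.
have zscd y : y \in y1 :: zs -> c <= y < d.
  by move=> yzs; rewrite zsn // /d -addnS xn // mem_cat yzs orbT.
have y1cd : c <= y1 < d by apply: zscd; exact: mem_head.
have cd : c < d by case/andP: y1cd; exact: le_lt_trans.
have g := goodUV cd.
have uc : 0 < U (i + n)%N c by apply: (good_U g); rewrite lexx.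
have vd : 0 < V (i + n)%N d by apply: (good_V g); rewrite lexx andbT.
set al := if n is n'.+1 then a n' / U (i + n)%N c else 0.
set be := a n / V (i + n)%N d.
have {}az : alternates (fun x => al * U (i + n)%N x + be * V (i + n)%N x) (b + k) (y1 :: zs).
  split; first exact: az.1.
  by apply: eq_altsgn az.2 => x xzs; rewrite hat_sum //; exact: zscd.
(* [al] is zero when there is no previous hat, hence the weak inequality *)
have sal : k = n -> (-1) ^+ (b + k) * al <= 0.
  move=> kn; case: IHk => [|[_]]; first by rewrite kn ltnn.
  rewrite kn /al; move: uc; set u := U _ _ => u0.
  case: (n) => [|n']; first by rewrite mulr0.
  move=> /(_ isT) /= h; rewrite addnS exprS mulN1r mulNr oppr_le0 mulrA.
  by rewrite divr_ge0 // ltW.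
have sbe e : (0 < e * be) = (0 < e * a n) by rewrite mulrA pmulr_lgt0 ?invr_gt0.
case: zs az zscd {zsn xn} => [|y2 zs] [] /=.
  move=> _ [hy1 _] _; case: IHk => [kn|[kn _]]; first by left; rewrite addn1 ltnS.
  right; rewrite addn1 kn; split => // _; rewrite -sbe -kn.
  move: hy1; rewrite mulrDr (mulrA _ al) (mulrA _ be) => h.
  have : 0 < (-1) ^+ (b + k) * be * V (i + n)%N y1.
    apply: lt_le_trans h _; rewrite gerDr; apply: mulr_le0_ge0; first exact: sal.
    exact/ltW/(good_U g).
  case/andP: y1cd; rewrite le_eqVlt => /predU1P[<-|cy1] yd.
    by rewrite (good_Va g) mulr0 ltxx.
  by rewrite pmulr_lgt0 // (good_V g) // cy1 ltW.
move=> /andP[y12 ps] [h1 [h2 h3]] zscd.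
have y2cd : c <= y2 < d by apply: zscd; rewrite !inE eqxx orbT.
have h2' : (-1) ^+ (b + k) * (al * U (i + n)%N y2 + be * V (i + n)%N y2) < 0.
  by move: h2; rewrite exprS mulN1r mulNr oppr_gt0.
have [p1 p2] := good_pair_signs g (andP y1cd).1 y12 (andP y2cd).2 h1 h2'.
have kn : (k < n)%N.
  by case: IHk => [//|[/sal]]; rewrite leNgt p1.
case: zs h3 ps zscd => [|y3 zs] /=; last first.
  move=> [h3 _] /andP[y23 _] zscd.
  have y3cd : c <= y3 < d by apply: zscd; rewrite !inE eqxx !orbT.
  have h3' : (-1) ^+ (b + k).+1 * (al * U (i + n)%N y3 + be * V (i + n)%N y3) < 0.
    by move: h3; rewrite exprS mulN1r mulNr oppr_gt0.
  have [_] := good_pair_signs g (andP y2cd).1 y23 (andP y3cd).2 h2 h3'.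
  by rewrite exprS mulN1r mulNr oppr_lt0 => /(lt_trans p2); rewrite ltxx.
move=> _ _ _; rewrite addn2 !ltnS; move: kn; rewrite leq_eqVlt => /predU1P[kn|]; last by left.
right; split; first by rewrite kn.
move=> _ /=; rewrite -sbe -kn addnS exprS mulN1r mulNr.
by rewrite oppr_gt0.
Qed.

(** One further hat with coefficient 0 leaves no room for a value beyond those
    counted by [hat_alternates_below]. *)
Lemma hat_alternates n i (a : nat -> R) b xs :
  alternates (fun x => \sum_(j < n) a j * N 0 (i + j)%N x) b xs -> (size xs <= n)%N.
Proof.
move=> ax; pose a' j := if (j < n)%N then a j else 0.
have E x : \sum_(j < n) a j * N 0 (i + j)%N x = \sum_(j < n.+1) a' j * N 0 (i + j)%N x.
  rewrite big_ord_recr /= /a' ltnn mul0r addr0; apply: eq_bigr => j _.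
  by rewrite ltn_ord.
have {}ax' : alternates (fun x => \sum_(j < n.+1) a' j * N 0 (i + j)%N x) b xs.
  by split; [exact: ax.1|apply: eq_altsgn ax.2 => x _; exact: E].
have [x xxs||[_ /(_ isT)]] := hat_alternates_below ax'; last 2 first.
- by rewrite ltnS.
- by rewrite /a' /= ltnn mulr0 ltxx.
have := altsgn_neq0 ax.2 xxs; apply: contraNT; rewrite -leNgt => xge.
rewrite big1 // => j _; rewrite hat_support ?mulr0 //; right.
by apply: le_trans xge; apply: xi_le; have := ltn_ord j; lia.
Qed.

End Hats.

(** * The invariants carried along the recursion on the order *)

Section Splines.
Variables (R : realType) (xi : nat -> R) (U V : nat -> R -> R).

Hypothesis xi_le : forall i j, (i <= j)%N -> xi i <= xi j.
Hypothesis goodUV : forall i, xi i < xi i.+1 ->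
  good_pair (xi i) (xi i.+1) (U i) (V i).

Local Notation N := (spl xi U V).

(** The facts that are proved together by induction on the order.  The last two
    describe splines just after their least knot, when they have another one: they
    are positive there, and of two consecutive splines that start at the
    same knot, the second, which is smoother there, is negligible. *)
Record spline_level m : Prop := SplineLevel {
  spl_integrable : forall i, integrableR (N m i);
  spl_bounded : forall i, exists2 C, 0 < C & forall x, N m i x <= C;
  spl_support : forall i x, x < xi i \/ xi (i + m.+2)%N <= x -> N m i x = 0;
  spl_alternates : forall n i (a : nat -> R) b xs,
    alternates (fun x => \sum_(j < n) a j * N m (i + j)%N x) b xs -> (size xs <= n)%N;
  spl_pos : forall i, xi i < xi (i + m.+2)%N ->
    exists2 d, 0 < d & forall x, xi i < x < xi i + d -> 0 < N m i x;
  spl_dom : forall i, xi i = xi i.+1 -> xi i < xi (i + m.+2)%N ->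
    forall e, 0 < e ->
    exists2 d, 0 < d & forall x, x < xi i + d -> N m i.+1 x <= e * N m i x
}.

Lemma spl0_integrable i : integrableR (N 0 i).
Proof.
pose F k := if k is 0%N then V i \_ `[xi i, xi i.+1[ else U i.+1 \_ `[xi i.+1, xi i.+2[.
pose c k := if k is 0%N then (V i (xi i.+1))^-1 else (U i.+1 (xi i.+1))^-1.
have -> : N 0 i = (fun x => \sum_(k < 2) c k * F k x).
  apply/funext => x; rewrite !big_ord_recl big_ord0 addr0 /= !patchE !mem_setE !in_itv /=.
  have [x1|x1] := boolP (xi i <= x < xi i.+1).
    rewrite mulrC ifF ?mulr0 ?addr0 //.
    by case/andP: x1 => _; rewrite ltNge => /negbTE ->.
  by rewrite mulr0 add0r; case: ifP; rewrite ?mulr0 // mulrC.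
apply: integrableR_sum => -[|[|//]] _; apply: integrableR_restrict => h.
  exact: (good_contV (goodUV h)).
exact: (good_contU (goodUV h)).
Qed.

Lemma spl0_bounded i : exists2 C, 0 < C & forall x, N 0 i x <= C.
Proof.
have [C1 C10 h1] : exists2 C, 0 < C &
    forall x, xi i <= x < xi i.+1 -> V i x / V i (xi i.+1) <= C.
  have [h|h] := ltP (xi i) (xi i.+1); last first.
    exists 1 => // x /andP[h1 h2]; have := le_lt_trans h1 h2.
    by rewrite ltNge h.
  have g := goodUV h; have [C C0 hC] := continuous_bounded (ltW h) (good_contV g).
  have v0 : 0 < V i (xi i.+1) by apply: (good_V g); rewrite h lexx.
  exists (C / V i (xi i.+1)); first exact: divr_gt0.
  by move=> x /andP[x1 x2]; rewrite ler_pM2r ?invr_gt0 // hC // x1 ltW.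
have [C2 C20 h2] : exists2 C, 0 < C &
    forall x, xi i.+1 <= x < xi i.+2 -> U i.+1 x / U i.+1 (xi i.+1) <= C.
  have [h|h] := ltP (xi i.+1) (xi i.+2); last first.
    exists 1 => // x /andP[h3 h2]; have := le_lt_trans h3 h2.
    by rewrite ltNge h.
  have g := goodUV h; have [C C0 hC] := continuous_bounded (ltW h) (good_contU g).
  have v0 : 0 < U i.+1 (xi i.+1) by apply: (good_U g); rewrite h lexx.
  exists (C / U i.+1 (xi i.+1)); first exact: divr_gt0.
  by move=> x /andP[x1 x2]; rewrite ler_pM2r ?invr_gt0 // hC // x1 ltW.
exists (C1 + C2); first exact: addr_gt0.
move=> x /=; case: ifP => [/h1 h|_]; first by lra.
by case: ifP => [/h2 h|_]; lra.
Qed.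

Lemma spl0_pos i : xi i < xi i.+2 ->
  exists2 d, 0 < d & forall x, xi i < x < xi i + d -> 0 < N 0 i x.
Proof.
move=> h; have [h1|h1] := ltP (xi i) (xi i.+1).
  exists (xi i.+1 - xi i); first by rewrite subr_gt0.
  move=> x; rewrite addrC subrK => /andP[x1 x2].
  have g := goodUV h1; rewrite hat_left ?x2 ?ltW // divr_gt0 //; apply: (good_V g).
    by rewrite x1 ltW.
  by rewrite h1 lexx.
have {}h1 : xi i.+1 = xi i by apply/le_anti; rewrite h1 xi_le.
have h2 : xi i.+1 < xi i.+2 by rewrite h1.
exists (xi i.+2 - xi i); first by rewrite subr_gt0.
move=> x; rewrite addrC subrK => /andP[x1 x2].
have g := goodUV h2; rewrite hat_right ?h1 ?x2 ?ltW // divr_gt0 //; apply: (good_U g).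
  by rewrite h1 x2 ltW.
by rewrite h1 lexx.
Qed.

Lemma spl0_dom i : xi i = xi i.+1 -> xi i < xi i.+2 -> forall e, 0 < e ->
  exists2 d, 0 < d & forall x, x < xi i + d -> N 0 i.+1 x <= e * N 0 i x.
Proof.
move=> E h e e0; have h' : xi i.+1 < xi i.+2 by rewrite -E.
have g := goodUV h'; set u := U i.+1 in g; set v := V i.+1 in g.
have u0 : 0 < u (xi i.+1) by apply: (good_U g); rewrite h' lexx.
have v0 : 0 < v (xi i.+2) by apply: (good_V g); rewrite h' lexx.
have e1 : 0 < e / 2 * v (xi i.+2) by rewrite !mulr_gt0.
have e2 : 0 < u (xi i.+1) / 2 by rewrite divr_gt0.
have [d1 d10 hd1] := continuous_right_end h' e1 (good_contV g).
have [d2 d20 hd2] := continuous_right_end h' e2 (good_contU g).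
exists (Num.min d1 d2); first by rewrite lt_min d10 d20.
move=> x xd; have [xi1|xi1] := ltP x (xi i.+1).
  by rewrite !hat_support ?E ?mulr0 //; left; rewrite ?E.
have [x1 {}hd1] : x < xi i.+2 /\ `|v (xi i.+1) - v x| < e / 2 * v (xi i.+2).
  by apply: hd1; rewrite xi1 (lt_le_trans xd) // E lerD2l ge_min lexx.
have [_ {}hd2] : x < xi i.+2 /\ `|u (xi i.+1) - u x| < u (xi i.+1) / 2.
  by apply: hd2; rewrite xi1 (lt_le_trans xd) // E lerD2l ge_min lexx orbT.
rewrite hat_left ?xi1 // hat_right ?xi1 // -/u -/v.
move: hd1; rewrite (good_Va g) sub0r normrN => /ltr_normlW hd1.
move: hd2; rewrite ltr_distlC => /andP[hd2 _].
apply: (@le_trans _ _ (e / 2)); first by rewrite ler_pdivrMr // ltW.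
rewrite mulrA ler_pdivlMr // -mulrA ler_pM2l //.
lra.
Qed.

Lemma spline_level0 : spline_level 0.
Proof.
split.
- exact: spl0_integrable.
- exact: spl0_bounded.
- by move=> i x; rewrite addn2; exact: hat_support.
- by move=> n i a b xs h; exact: (hat_alternates xi_le goodUV h).
- by move=> i; rewrite addn2; exact: spl0_pos.
- by move=> i E; rewrite addn2; exact: spl0_dom.
Qed.

Definition spl_cum m i (s : R) : R :=
  normalized_cumulative (N m i) (xi (i + m.+2)%N) s.

Lemma splS m i s : N m.+1 i s = spl_cum m i s - spl_cum m i.+1 s.
Proof. by []. Qed.

Section Level.
Variable m : nat.
Hypothesis L : spline_level m.

(** A single spline cannot change sign, and it is positive somewhere unless all of
    its knots are equal. *)
Lemma spl_ge0 i x : 0 <= N m i x.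
Proof.
rewrite leNgt; apply/negP => Nx.
have xi1 : xi i <= x.
  by rewrite leNgt; apply/negP => h; move: Nx; rewrite (spl_support L) ?ltxx //; left.
have xi2 : x < xi (i + m.+2)%N.
  by rewrite ltNge; apply/negP => h; move: Nx; rewrite (spl_support L) ?ltxx //; right.
have [d d0 hd] := spl_pos L (le_lt_trans xi1 xi2).
pose y := xi i + d / 2.
have Ny : 0 < N m i y by apply: hd; rewrite /y; apply/andP; split; lra.
have E z : \sum_(j < 1) 1 * N m (i + j)%N z = N m i z.
  by rewrite big_ord1 addn0 mul1r.
have [xy|yx|xy] := ltgtP x y.
- have : alternates (fun z => \sum_(j < 1) 1 * N m (i + j)%N z) 1 [:: x; y].
    rewrite /alternates /= !E expr1 mulN1r oppr_gt0 -signr_odd /= expr0 mul1r.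
    by rewrite xy.
  by move=> /(spl_alternates L (a := fun=> 1)).
- have : alternates (fun z => \sum_(j < 1) 1 * N m (i + j)%N z) 0 [:: y; x].
    by rewrite /alternates /= !E expr1 mulN1r oppr_gt0 expr0 mul1r yx.
  by move=> /(spl_alternates L (a := fun=> 1)).
- by move: Nx; rewrite xy => /(lt_trans Ny); rewrite ltxx.
Qed.

Lemma spl_mass_gt0 i : xi i < xi (i + m.+2)%N -> 0 < mass (N m i).
Proof.
move=> h; have [d d0 hd] := spl_pos L h.
apply: mass_gt0 hd; rewrite ?ltrDl //; [exact: (spl_integrable L)|exact: spl_ge0].
Qed.

Lemma spl_eq0 i : xi i = xi (i + m.+2)%N -> N m i = cst 0.
Proof.
move=> E; apply/funext => x; apply: (spl_support L).
by rewrite -E; case: (ltP x (xi i)); [left|right].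
Qed.

Lemma spl_cum_trivial i s : xi i = xi (i + m.+2)%N -> spl_cum m i s = (xi i <= s)%R%:R.
Proof.
by move=> E; rewrite /spl_cum /normalized_cumulative asboolT ?E //; exact: spl_eq0.
Qed.

Lemma spl_cumE i s : xi i < xi (i + m.+2)%N ->
  spl_cum m i s = cumul (N m i) s / mass (N m i).
Proof.
move=> h; rewrite /spl_cum /normalized_cumulative asboolF; last first.
  move=> E; have := spl_mass_gt0 h.
  by rewrite /mass E Rintegral_cst // mul0r ltxx.
by rewrite mulrC -(cumulZ _ _ (spl_integrable L i)).
Qed.

Lemma spl_nontrivial i : xi i <> xi (i + m.+2)%N -> xi i < xi (i + m.+2)%N.
Proof. by move=> /eqP h; rewrite lt_neqAle h xi_le // leq_addr. Qed.

Lemma spl_cum_lo i s : s < xi i -> spl_cum m i s = 0.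
Proof.
move=> si; have [/eqP E|/eqP E] := boolP (xi i == xi (i + m.+2)%N).
  by rewrite spl_cum_trivial // leNgt si.
rewrite spl_cumE ?cumul_eq0 ?mul0r //; last exact: spl_nontrivial.
by move=> r rs; apply: (spl_support L); left; exact: le_lt_trans si.
Qed.

Lemma spl_cum_hi i s : xi (i + m.+2)%N <= s -> spl_cum m i s = 1.
Proof.
move=> si; have [/eqP E|/eqP E] := boolP (xi i == xi (i + m.+2)%N).
  by rewrite spl_cum_trivial // E si.
have h := spl_nontrivial E.
rewrite spl_cumE // cumul_mass ?divff ?gt_eqF ?spl_mass_gt0 // => r rs.
by apply: (spl_support L); right; exact: le_trans (ltW rs).
Qed.

Lemma spl_cum_homo i s s' : s <= s' -> spl_cum m i s <= spl_cum m i s'.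
Proof.
move=> ss; have [/eqP E|/eqP E] := boolP (xi i == xi (i + m.+2)%N).
  rewrite !spl_cum_trivial // ler_nat; case: (leP (xi i) s) => [h|//].
  by rewrite (le_trans h).
have h := spl_nontrivial E.
rewrite !spl_cumE // ler_pM2r ?invr_gt0 ?spl_mass_gt0 //.
by apply: cumul_homo => //; [exact: (spl_integrable L)|exact: spl_ge0].
Qed.

Lemma spl_cum_ge0 i s : 0 <= spl_cum m i s.
Proof.
have [h|h] := ltP s (xi i); first by rewrite spl_cum_lo.
have -> : 0 = spl_cum m i (xi i - 1) by rewrite spl_cum_lo //; lra.
by apply: spl_cum_homo; lra.
Qed.

Lemma spl_cum_le1 i s : spl_cum m i s <= 1.
Proof.
have <- : spl_cum m i (Num.max s (xi (i + m.+2)%N)) = 1.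
  by rewrite spl_cum_hi // le_max lexx orbT.
by apply: spl_cum_homo; rewrite le_max lexx.
Qed.

Lemma spl_cum_gt0 i s : xi i < s -> 0 < spl_cum m i s.
Proof.
move=> si; have [/eqP E|/eqP E] := boolP (xi i == xi (i + m.+2)%N).
  by rewrite spl_cum_trivial // ltW.
have h := spl_nontrivial E; have [d d0 hd] := spl_pos L h.
rewrite spl_cumE // divr_gt0 ?spl_mass_gt0 //.
apply: cumul_gt0 hd _ => //; rewrite ?ltrDl //; [exact: (spl_integrable L)|exact: spl_ge0].
Qed.

Lemma measurable_spl_cum i : measurable_fun setT (spl_cum m i).
Proof. by apply: nondecreasing_measurable => // s s'; exact: spl_cum_homo. Qed.

(** The domination of [spl_dom] passes to primitives.  If the first spline
    degenerates, its normalized primitive jumps to 1 while the other one starts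
    from 0 continuously. *)
Lemma spl_cum_dom i : xi i = xi i.+1 -> xi i < xi (i + m.+3)%N ->
  forall e, 0 < e ->
  exists2 d, 0 < d & forall x, x < xi i + d -> spl_cum m i.+1 x <= e * spl_cum m i x.
Proof.
move=> E h e e0.
have h1 : xi i.+1 < xi (i.+1 + m.+2)%N by rewrite addSnnS -E.
have T1 := spl_mass_gt0 h1; set T' := mass _ in T1.
have [/eqP Et|/eqP Et] := boolP (xi i == xi (i + m.+2)%N); last first.
  have h0 := spl_nontrivial Et.
  have T0 := spl_mass_gt0 h0; set T := mass _ in T0.
  have e1 : 0 < e * T' / T by rewrite !mulr_gt0 ?invr_gt0.
  have [d d0 hd] := spl_dom L E h0 e1; exists d => // x xd.
  rewrite !spl_cumE // -/T -/T' ler_pdivrMr //.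
  have -> : e * (cumul (N m i) x / T) * T' = e * T' / T * cumul (N m i) x by ring.
  have Zi : integrableR (fun r => e * T' / T * N m i r).
    have := @integrableR_sum R 1 (fun=> e * T' / T) (fun=> N m i) (fun k _ => spl_integrable L i).
    by under eq_fun do rewrite big_ord1.
  rewrite -cumulZ; last exact: (spl_integrable L).
  apply: le_cumul => //; first exact: (spl_integrable L).
  by move=> r rx; apply: hd; exact: le_lt_trans xd.
have [C C0 hC] := spl_bounded L i.+1.
have d0 : 0 < e * T' / (2 * C) by rewrite divr_gt0 ?mulr_gt0.
exists (e * T' / (2 * C)) => // x xd; rewrite (spl_cum_trivial _ Et).
have [xi1|xi1] := leP (xi i) x; last by rewrite spl_cum_lo ?mulr0 // -E.
rewrite mulr1 spl_cumE // -/T' ler_pdivrMr //.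
set d := e * T' / (2 * C) in d0 xd *.
have -> : cumul (N m i.+1) x = cumul (N m i.+1) x - cumul (N m i.+1) (xi i - d).
  rewrite [X in _ - X]cumul_eq0 ?subr0 // => r rd; apply: (spl_support L); left.
  by rewrite -E; lra.
apply: le_trans (cumulB_le (spl_integrable L _) hC _) _; first by lra.
apply: (@le_trans _ _ (C * (2 * d))); first by rewrite ler_pM2l //; lra.
have -> // : C * (2 * d) = e * T' by rewrite /d; field; rewrite gt_eqF.
Qed.

End Level.

End Splines.

(** * The recursion step and variation diminution *)

Section SplineStep.
Variables (R : realType) (xi : nat -> R) (U V : nat -> R -> R).

Hypothesis xi_le : forall i j, (i <= j)%N -> xi i <= xi j.
Hypothesis goodUV : forall i, xi i < xi i.+1 ->
  good_pair (xi i) (xi i.+1) (U i) (V i).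

Local Notation N := (spl xi U V).
Local Notation NC := (spl_cum xi U V).
Local Notation level := (spline_level xi U V).

(** The coefficients that summation by parts produces, for a family a extended by
    zero on both sides. *)
Definition jump n (a : nat -> R) j : R :=
  (if (j < n)%N then a j else 0) - (if j is j'.+1 then a j' else 0).

Lemma sum_jump n (a F : nat -> R) :
  \sum_(j < n) a j * (F j - F j.+1) = \sum_(j < n.+1) jump n a j * F j.
Proof.
have E1 : \sum_(j < n) a j * F j = \sum_(j < n.+1) (if (j < n)%N then a j else 0) * F j.
  rewrite big_ord_recr /= ltnn mul0r addr0; apply: eq_bigr => j _.
  by rewrite ltn_ord.
have E2 : \sum_(j < n) a j * F j.+1 =
    \sum_(j < n.+1) (if (j : nat) is j'.+1 then a j' else 0) * F j.
  by rewrite big_ord_recl /= mul0r add0r.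
under eq_bigr do rewrite mulrBr.
rewrite sumrB E1 E2 -sumrB; apply: eq_bigr => j _.
by rewrite /jump mulrBl.
Qed.

Section Step.
Variable m : nat.
Hypothesis L : level m.

Lemma splS_support i x : x < xi i \/ xi (i + m.+3)%N <= x -> N m.+1 i x = 0.
Proof.
rewrite splS => -[h|h].
  rewrite (spl_cum_lo xi_le L h) (spl_cum_lo xi_le L) ?subrr //.
  by apply: lt_le_trans h _; apply: xi_le.
rewrite !(spl_cum_hi xi_le L) ?subrr //; first by rewrite addSnnS.
by apply: le_trans h; apply: xi_le; lia.
Qed.

Lemma splS_integrable i : integrableR (N m.+1 i).
Proof.
have -> : N m.+1 i = (fun x => NC m i x - NC m i.+1 x) \_ `[xi i, xi (i + m.+3)%N].
  apply/funext => x; rewrite patchE mem_setE in_itv /=; case: ifPn => // h.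
  rewrite -splS splS_support //; move: h; rewrite negb_and -!ltNge => /orP[]; first by left.
  by move=> /ltW; right.
rewrite /integrableR -restrict_EFin; apply/(integrable_mkcond _ _).1 => //.
apply: measurable_bounded_integrable => //.
- by rewrite /= lebesgue_measure_itv /= lte_fin; case: ifP => _; rewrite ?ltry.
- apply: measurable_funTS; apply: measurable_funB; exact: (measurable_spl_cum xi_le L).
- exists 1; split; first exact: num_real.
  move=> r r1 x _ /=; apply: le_trans (ltW r1).
  have := spl_cum_ge0 xi_le L i x; have := spl_cum_le1 xi_le L i x.
  have := spl_cum_ge0 xi_le L i.+1 x; have := spl_cum_le1 xi_le L i.+1 x.
  by rewrite ler_norml; lra.
Qed.

Lemma splS_bounded i : exists2 C, 0 < C & forall x, N m.+1 i x <= C.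
Proof.
exists 1 => // x; rewrite splS.
have := spl_cum_le1 xi_le L i x; have := spl_cum_ge0 xi_le L i.+1 x; lra.
Qed.

Lemma splS_pos i : xi i < xi (i + m.+3)%N ->
  exists2 d, 0 < d & forall x, xi i < x < xi i + d -> 0 < N m.+1 i x.
Proof.
move=> h; have [h1|h1] := ltP (xi i) (xi i.+1).
  exists (xi i.+1 - xi i); first by rewrite subr_gt0.
  move=> x; rewrite addrC subrK splS => /andP[x1 x2].
  by rewrite [X in _ - X](spl_cum_lo xi_le L) // subr0 (spl_cum_gt0 xi_le L).
have {}h1 : xi i = xi i.+1 by apply/le_anti; rewrite h1 xi_le.
have e0 : 0 < 2^-1 :> R by [].
have [d d0 hd] := spl_cum_dom xi_le L h1 h e0.
exists d => // x /andP[x1 x2]; rewrite splS subr_gt0.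
apply: le_lt_trans (hd x x2) _.
by have := spl_cum_gt0 xi_le L x1; lra.
Qed.

Lemma splS_dom i : xi i = xi i.+1 -> xi i < xi (i + m.+3)%N ->
  forall e, 0 < e ->
  exists2 d, 0 < d & forall x, x < xi i + d -> N m.+1 i.+1 x <= e * N m.+1 i x.
Proof.
move=> h1 h e e0.
have e1 : 0 < Num.min 2^-1 (e / 2) by rewrite lt_min invr_gt0 ltr0n divr_gt0.
have [d d0 hd] := spl_cum_dom xi_le L h1 h e1.
exists d => // x xd; rewrite !splS.
have := spl_cum_ge0 xi_le L i x; have := spl_cum_ge0 xi_le L i.+2 x.
set A := NC m i x; set B := NC m i.+1 x; set C := NC m i.+2 x => C0 A0.
have BA : B <= 2^-1 * A.
  apply: le_trans (hd x xd) _; rewrite ler_wpM2r //; by rewrite ge_min lexx.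
have BA' : B <= e / 2 * A.
  apply: le_trans (hd x xd) _; rewrite ler_wpM2r //; by rewrite ge_min lexx orbT.
apply: (@le_trans _ _ (e / 2 * A)); first by lra.
by rewrite -mulrA ler_pM2l //; lra.
Qed.

Let nontriv i := xi i != xi (i + m.+2)%N.

(** The coefficients of the density of a combination of splines of the next order.
    A degenerate normalized primitive is a step function and has density 0. *)
Let dens (a : nat -> R) n i j : R :=
  if nontriv (i + j) then jump n a j / mass (N m (i + j)%N) else 0.

Lemma splS_sum n (a : nat -> R) i x : \sum_(j < n) a j * N m.+1 (i + j)%N x =
  \sum_(j < n.+1) jump n a j * NC m (i + j)%N x.
Proof.
rewrite -(sum_jump n a (fun j => NC m (i + j)%N x)).
by apply: eq_bigr => j _; rewrite splS addnS.
Qed.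

(** Between two points that no jump separates, a combination of splines of the
    next order increases by the integral of its density. *)
Lemma splS_sumB n (a : nat -> R) i y z : (0 < n)%N ->
  (forall j, (0 < j < n)%N -> nontriv (i + j)) ->
  (nontriv i || (xi i <= y)) -> (nontriv (i + n) || (z < xi (i + n)%N)) -> y <= z ->
  let f x := \sum_(j < n) a j * N m.+1 (i + j)%N x in
  let g x := \sum_(j < n.+1) dens a n i j * N m (i + j)%N x in
  f z - f y = cumul g z - cumul g y.
Proof.
move=> n0 hn hy hz yz /=; rewrite !splS_sum.
rewrite !(cumul_lincomb (dens a n i) (F := fun j => N m (i + j)%N)); last 2 first.
- by move=> k _; exact: (spl_integrable L).
- by move=> k _; exact: (spl_integrable L).
rewrite -!sumrB; apply: eq_bigr => j _; rewrite -!mulrBr /dens.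
case: ifP => [/eqP nt|triv].
  rewrite !(spl_cumE L) ?(spl_nontrivial xi_le) // -mulrBl; ring.
rewrite mul0r; apply/eqP; rewrite mulf_eq0; apply/orP; right.
have /eqP tr : xi (i + j)%N == xi (i + j + m.+2)%N by move: triv; rewrite /nontriv => /negbFE.
rewrite !(spl_cum_trivial L _ tr).
have [j0|j0] := posnP j.
  move: triv; rewrite j0 addn0 => triv; move: hy; rewrite triv /= => hy.
  by rewrite hy (le_trans hy yz) subrr.
have [jn|jn] := ltnP j n; first by rewrite hn ?j0 in triv.
have {}jn : j = n :> nat by have := ltn_ord j; lia.
move: triv; rewrite jn => triv; move: hz; rewrite triv /= => hz.
by rewrite (leNgt _ z) (leNgt _ y) hz (le_lt_trans yz hz) subrr.
Qed.

(** Degenerate splines at the two ends reduce the number of terms, so that each of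
    them costs one alternation. *)
Lemma dens_alternates n (a : nat -> R) i b xs : (0 < n)%N ->
  alternates (fun x => \sum_(j < n.+1) dens a n i j * N m (i + j)%N x) b xs ->
  (size xs + ~~ nontriv i + ~~ nontriv (i + n) <= n.+1)%N.
Proof.
move=> n0 [sx ax].
have {}ax : altsgn (fun x => \sum_(j < n.+1 - ~~ nontriv (i + n))
    dens a n i j * N m (i + j)%N x) b xs.
  apply: eq_altsgn ax => x _; case hn : (nontriv _); rewrite /= ?subn0 // subSS subn0.
  by rewrite big_ord_recr /= /dens hn mul0r addr0.
case hi : (nontriv i) => /=.
  by have := spl_alternates L (conj sx ax); case: (nontriv (i + n)) => /=; lia.
set K := (n.+1 - _)%N in ax.
have EK : K = K.-1.+1 by rewrite /K; case: (nontriv _); lia.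
have {}ax : altsgn (fun x => \sum_(j < K.-1)
    dens a n i j.+1 * N m (i.+1 + j)%N x) b xs.
  apply: eq_altsgn ax => x _; rewrite EK big_ord_recl /= {1}/dens addn0 hi mul0r add0r.
  by apply: eq_bigr => j _; rewrite /bump /= add1n addSnnS.
have := spl_alternates L (a := fun j => dens a n i j.+1) (conj sx ax).
by rewrite /K; case: (nontriv (i + n)) => /=; lia.
Qed.

(** Rolle's argument loses one alternation between consecutive points and wins one
    at each end of the support, where f vanishes, whereas the density has one term
    more than f.  A degenerate spline at an end spoils both the additional
    alternation and the additional term. *)
Lemma splS_alternates n i (a : nat -> R) b xs :
  alternates (fun x => \sum_(j < n) a j * N m.+1 (i + j)%N x) b xs -> (size xs <= n)%N.
Proof.
elim/ltn_ind: n i a b xs => n IH i a b xs ax.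
(* a degenerate spline in the middle separates the supports of the terms before
   it from those of the terms after it *)
have [/existsP[j /andP[j0 triv]]|] := boolP [exists j : 'I_n, (0 < j)%N && ~~ nontriv (i + j)].
  move: triv; rewrite negbK => /eqP triv.
  have [ys [zs [E ylt zge ay az]]] := alternates_split (xi (i + j)%N) ax.
  have jn := ltn_ord j; move: (nat_of_ord j) j0 triv jn ylt zge {ax} => {j} k k0 triv kn ylt zge.
  have En : n = (k + (n - k))%N by lia.
  rewrite E size_cat En leq_add //.
    apply: (IH k kn i a b); split; first exact: ay.1.
    apply: eq_altsgn ay.2 => x xys; rewrite En big_split_ord /=.
    rewrite [X in _ + X]big1 ?addr0 // => j _; rewrite -[X in _ * X]/(N m.+1 _ x).
    rewrite splS_support ?mulr0 //; left; apply: lt_le_trans (ylt x xys) _.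
    by apply: xi_le; lia.
  apply: (IH (n - k)%N _ (i + k)%N (fun j => a (k + j)%N) (b + size ys)%N); first by lia.
  split; first exact: az.1.
  apply: eq_altsgn az.2 => x xzs; rewrite En big_split_ord /=.
  rewrite [X in X + _]big1 ?add0r // => [|j _].
    rewrite addKn; apply: eq_bigr => j _; by rewrite !addnA.
  rewrite -[X in _ * X]/(N m.+1 _ x).
  rewrite splS_support ?mulr0 //; right; apply: le_trans (zge x xzs).
  by rewrite triv; apply: xi_le; have := ltn_ord j; lia.
rewrite negb_exists => /forallP hn.
have {}hn j : (0 < j < n)%N -> nontriv (i + j).
  by case/andP=> j0 jn; have := hn (Ordinal jn); rewrite /= j0 /= negbK.
case: xs ax => [//|x xs] ax.
have [n0|n0] := posnP n.
  have := altsgn_neq0 ax.2 (mem_head _ _).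
  by move: (x); rewrite n0 => y; rewrite big_ord0 eqxx.
set f := fun _ => _ in ax.
have f_lo y : y < xi i -> f y = 0.
  move=> yi; rewrite /f big1 // => j _; rewrite -[X in _ * X]/(N m.+1 _ y).
  rewrite splS_support ?mulr0 //; left; apply: lt_le_trans yi _.
  by apply: xi_le; lia.
have f_hi y : xi (i + n + m.+2)%N <= y -> f y = 0.
  move=> yi; rewrite /f big1 // => j _; rewrite -[X in _ * X]/(N m.+1 _ y).
  rewrite splS_support ?mulr0 //; right; apply: le_trans yi.
  by apply: xi_le; have := ltn_ord j; lia.
have xsD y : y \in x :: xs -> xi i <= y < xi (i + n + m.+2)%N.
  move=> /(altsgn_neq0 ax.2) fy; apply/andP; split; rewrite leNgt || rewrite ltNge.
    by apply: contra fy => /f_lo ->.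
  by apply: contra fy => /f_hi ->.
(* the point xi i - 1, where f vanishes, precedes the others unless f jumps at
   the beginning of its support *)
have [b0 [x0 [xs0 [z0 p0 D0 sg0]]]] : exists b0 x0 xs0, [/\ zigzag f b0 x0 xs0,
    path <%R x0 xs0, {in x0 :: xs0, forall y, (nontriv i || (xi i <= y)) && (y < xi (i + n + m.+2)%N)}
  & [/\ size xs0 = (size xs + nontriv i)%N, last x0 xs0 = last x xs &
    (b0 + size xs0 = b + (size xs).+1)%N]].
  case hi : (nontriv i) => /=; last first.
    exists b.+1, x, xs; split; [exact: altsgn_zigzag ax.2|exact: ax.1| |].
      by move=> y /xsD.
    by rewrite addn0 addSnnS.
  exists b, (xi i - 1), (x :: xs); split.
  - split; last exact: altsgn_zigzag ax.2.
    by rewrite [X in _ - X]f_lo ?subr0; [exact: ax.2.1|lra].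
  - rewrite /= (ax.1 : path _ _ _) andbT; have /andP[h _] := xsD x (mem_head _ _).
    by lra.
  - move=> y; rewrite inE => /predU1P[->|/xsD /andP[_ ->//]].
    by have /andP[h1 h2] := xsD x (mem_head _ _); lra.
  - by rewrite addn1.
have sl : 0 < (-1) ^+ (b + size xs) * f (last x xs) := altsgn_last ax.2.
(* likewise at the end of the support *)
have [xs1 [z1 p1 D1 s1]] : exists xs1, [/\ zigzag f b0 x0 xs1, path <%R x0 xs1,
    {in x0 :: xs1, forall y, (nontriv i || (xi i <= y)) && (nontriv (i + n) || (y < xi (i + n)%N))}
   & size xs1 = (size xs + nontriv i + nontriv (i + n))%N].
  case: sg0 => ssz slast sb.
  case hn' : (nontriv (i + n)) => /=; last first.
    exists xs0; split; rewrite ?addn0 // => y /D0.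
    by move/negbFE/eqP : hn' => ->.
  have lD := xsD (last x xs) (mem_last _ _).
  exists (rcons xs0 (xi (i + n + m.+2)%N)); split.
  - apply: zigzag_rcons => //; rewrite slast f_hi // sub0r sb addnS exprS.
    by rewrite mulN1r mulrNN.
  - by rewrite rcons_path p0 slast; case/andP: lD.
  - move=> y; rewrite -rcons_cons mem_rcons inE => /predU1P[->|/D0 /andP[-> _//]].
    by rewrite andbT; apply/orP; right; apply: xi_le; lia.
  - by rewrite size_rcons ssz addn1.
pose g y := \sum_(j < n.+1) dens a n i j * N m (i + j)%N y.
have gint : integrableR g.
  apply: (integrableR_sum (dens a n i) (F := fun j => N m (i + j)%N)) => k _.
  exact: (spl_integrable L).
have [|ys [py ay sy]] := zigzag_alternates (g := g) p1 z1.
  move=> y z yin zin yz k.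
  have /andP[Dy _] := D1 y yin; have /andP[_ Dz] := D1 z zin.
  rewrite (splS_sumB a n0 hn Dy Dz (ltW yz)) -/g => h.
  exact: cumulB_gt0 gint (ltW yz) h.
have := dens_alternates n0 (conj (path_sorted py) ay); rewrite sy s1 /=.
by case: (nontriv i); case: (nontriv (i + n)); rewrite /=; lia.
Qed.

Lemma spline_levelS : level m.+1.
Proof.
split.
- exact: splS_integrable.
- exact: splS_bounded.
- exact: splS_support.
- exact: splS_alternates.
- exact: splS_pos.
- exact: splS_dom.
Qed.

End Step.

Theorem spline_levels m : level m.
Proof.
elim: m => [|m]; [exact: spline_level0|exact: spline_levelS].
Qed.

End SplineStep.

(** * Positions of the extreme coefficients *)

Lemma count_iota_initial (P : pred nat) i n :
  (forall k l, (k <= l)%N -> (l < n)%N -> P (i + l)%N -> P (i + k)%N) ->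
  forall k, (k < n)%N -> P (i + k)%N = (k < count P (iota i n))%N.
Proof.
elim: n => [//|n IH] H k kn.
have {}IH := IH (fun k l kl ln => H k l kl (ltnW ln)).
rewrite -[n.+1]addn1 iotaD count_cat /= addn0.
have cn : (count P (iota i n) <= n)%N.
  by apply: leq_trans (count_size _ _) _; rewrite size_iota.
case Pn : (P (i + n)%N) => /=.
  have -> : count P (iota i n) = n.
    rewrite -[RHS](size_iota i n); apply/eqP; rewrite -all_count; apply/allP => l.
    rewrite mem_iota => /andP[il ln]; rewrite -(subnKC il).
    by apply: H (ltnSn n) Pn; lia.
  by rewrite addn1 kn (H k n).
move: kn; rewrite ltnS leq_eqVlt addn0 => /predU1P[->|]; last exact: IH.
by rewrite Pn; lia.
Qed.

Definition at_most (R : realType) (y : R) : pred R := fun z => z <= y.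

Definition below (R : realType) (y : R) : pred R := fun z => z < y.

Section Keys.
Variables (R : realType) (xi : nat -> R) (phi : nat -> nat) (nk : nat).

Hypothesis xi_le : forall i j, (i <= j)%N -> xi i <= xi j.
Hypothesis phi_lt : forall i, (phi i < phi i.+1)%N.

Local Notation zeta := (xi \o phi).

Lemma phi_add i d : (phi i + d <= phi (i + d))%N.
Proof.
elim: d => [|d IH]; rewrite ?addn0 // !addnS; exact: leq_ltn_trans (phi_lt _).
Qed.

Lemma phi_le i j : (i <= j)%N -> (phi i <= phi j)%N.
Proof. by move=> /subnKC <-; apply: leq_trans (phi_add _ _); rewrite leq_addr. Qed.

Lemma zeta_le i j : (i <= j)%N -> zeta i <= zeta j.
Proof. by move=> ij; apply: xi_le; exact: phi_le. Qed.

(** The knots of xi that satisfy a downward closed predicate P form an initial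
    segment, and so do those of a window of zeta.  The key aligns the ends of both
    segments: the window of xi that starts at the key has as many knots in P as the
    window of zeta that starts at j. *)
Definition key (P : pred R) m j : nat :=
  (count (P \o xi) (iota 0 nk) - count (P \o zeta) (iota j m.+3))%N.

(** With this choice of P, the window of xi at the key starts with the knot zeta j,
    with the multiplicity that it has in the window of zeta. *)
Definition min_key m j := key (at_most (zeta j)) m j.

(** Here both windows end with the same knot, with the same multiplicity. *)
Definition max_key m j := key (below (zeta (j + m.+2)%N)) m j.

Section Key.
Variable P : pred R.
Hypothesis P_down : forall y z, y <= z -> P z -> P y.

Let C := count (P \o xi) (iota 0 nk).

Lemma P_xi k : (k < nk)%N -> P (xi k) = (k < C)%N.
Proof.
move=> kn; rewrite -(@count_iota_initial (P \o xi) 0 nk) //= => i l il ln.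
by apply: P_down; apply: xi_le.
Qed.

Lemma key_count m j : (phi (j + m.+2) < nk)%N -> exists2 r,
  r = count (P \o zeta) (iota j m.+3) &
  [/\ (r <= m.+3)%N, (r <= C)%N, key P m j = (C - r)%N,
     forall l, (l < m.+3)%N -> P (zeta (j + l)%N) = (l < r)%N
   & forall l, (l < m.+3)%N -> (phi (j + l) < C)%N = (l < r)%N].
Proof.
move=> jn; set r := count _ _; exists r => //.
have rm : (r <= m.+3)%N by apply: leq_trans (count_size _ _) _; rewrite size_iota.
have Pr l : (l < m.+3)%N -> P (zeta (j + l)%N) = (l < r)%N.
  move=> lm; rewrite /r -(@count_iota_initial (P \o zeta) j m.+3) //= => i k ik kn.
  by apply: P_down; apply: zeta_le; lia.
have phir l : (l < m.+3)%N -> (phi (j + l) < C)%N = (l < r)%N.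
  move=> lm; rewrite -Pr //= -P_xi //.
  by apply: leq_ltn_trans jn; apply: phi_le; lia.
split => //; case: (posnP r) => [->//|r0].
have := phir r.-1; have := phi_add j r.-1; lia.
Qed.

End Key.

Lemma at_most_down (y : R) : forall u v, u <= v -> at_most y v -> at_most y u.
Proof. by move=> u v; exact: le_trans. Qed.

Lemma below_down (y : R) : forall u v, u <= v -> below y v -> below y u.
Proof. by move=> u v; exact: le_lt_trans. Qed.

Lemma count_iota_recl (P : pred nat) j n :
  count P (iota j n.+1) = (P j + count P (iota j.+1 n))%N.
Proof. by []. Qed.

Lemma count_iota_recr (P : pred nat) j n :
  count P (iota j n.+1) = (count P (iota j n) + P (j + n)%N)%N.
Proof. by rewrite -addn1 iotaD count_cat /= addn0. Qed.

Lemma min_keyP m j : (phi (j + m.+2) < nk)%N ->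
  [/\ (min_key m j + m.+2 < nk)%N, (phi j <= min_key m j)%N,
      zeta j = zeta (j + m.+2)%N ->
        xi (min_key m j) = zeta j /\ xi (min_key m j + m.+2)%N = zeta j
    & zeta j < zeta (j + m.+2)%N ->
        xi (min_key m j) < xi (min_key m j + m.+2)%N].
Proof.
move=> jn; have [r _ [rm rC kE Pr phir]] := key_count (@at_most_down (zeta j)) jn.
have {}Pr l : (l < m.+3)%N -> (zeta (j + l)%N <= zeta j) = (l < r)%N := Pr l.
rewrite -/(min_key m j) in kE.
move: rC kE phir; set C := count _ _ => rC kE phir.
have Pxi k : (k < nk)%N -> (xi k <= zeta j) = (k < C)%N.
  by move=> kn; rewrite /C -P_xi //; exact: at_most_down.
have Cn : (C <= nk)%N by apply: leq_trans (count_size _ _) _; rewrite size_iota.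
have r0 : (0 < r)%N by rewrite -Pr // addn0 lexx.
have pk : (phi j <= min_key m j)%N.
  by rewrite kE; have := phir r.-1; have := phi_add j r.-1; lia.
have kn : (min_key m j + m.+2 < nk)%N.
  rewrite kE; have [rm'|rm'] := ltnP r m.+3; last by lia.
  have := phir r rm'; rewrite ltnn => h.
  have := phi_add (j + r) (m.+2 - r)%N; rewrite -addnA subnKC //; lia.
split => //.
  move=> E; have rE : r = m.+3.
    have := Pr m.+2 (ltnSn _); rewrite -E lexx; lia.
  split; apply/le_anti; rewrite [X in _ && X]xi_le ?andbT //; last by lia.
    by rewrite Pxi; lia.
  by rewrite Pxi; lia.
move=> h; have rm' : (r < m.+3)%N.
  by have := Pr m.+2 (ltnSn _); rewrite leNgt h; lia.
apply: (@le_lt_trans _ _ (zeta j)); first by rewrite Pxi; lia.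
by rewrite ltNge Pxi; lia.
Qed.

(** A longer window does not change the key, unless all of its knots are equal, and
    removing the first knot increases the key.  In the recursion on the order, the
    first of two consecutive primitives thus determines the first coefficient. *)
Lemma min_keyS m j : (phi (j + m.+3) < nk)%N -> zeta j < zeta (j + m.+3)%N ->
  min_key m.+1 j = min_key m j /\ (min_key m j < min_key m j.+1)%N.
Proof.
move=> jn h; have jn' : (phi (j + m.+2) < nk)%N by apply: leq_ltn_trans jn; apply: phi_le; lia.
have jn1 : (phi (j.+1 + m.+2) < nk)%N by rewrite addSnnS.
have h' : (at_most (zeta j) \o zeta) (j + m.+3)%N = false.
  by apply/negbTE; rewrite /= /at_most -ltNge.
split; first by rewrite /min_key /key (count_iota_recr _ j m.+3) h' addn0.
have [r rE [rm rC kE Pr phir]] := key_count (@at_most_down (zeta j)) jn'.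
have {}Pr l : (l < m.+3)%N -> (zeta (j + l)%N <= zeta j) = (l < r)%N := Pr l.
rewrite -/(min_key m j) in kE.
have r0 : (0 < r)%N by rewrite -Pr // addn0 lexx.
have [h1|h1] := ltP (zeta j) (zeta j.+1).
  have [_ pk _ _] := min_keyP jn1.
  apply: leq_trans pk; rewrite kE.
  have jn2 : (phi j.+1 < nk)%N by apply: leq_ltn_trans jn; apply: phi_le; lia.
  have e : at_most (zeta j) (xi (phi j.+1)) = false by apply/negbTE; rewrite /= /at_most -ltNge.
  have := P_xi (@at_most_down (zeta j)) jn2; rewrite e; lia.
have {}h1 : zeta j = zeta j.+1 by apply/le_anti; rewrite h1 zeta_le.
rewrite kE /min_key /key -h1.
have : r = (count (at_most (zeta j) \o zeta) (iota j.+1 m.+3)).+1.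
  have e : (at_most (zeta j) \o zeta) j = true by rewrite /= /at_most lexx.
  rewrite rE count_iota_recl e add1n.
  by rewrite -addSnnS in h'; rewrite (count_iota_recr _ j.+1 m.+2) h' addn0.
lia.
Qed.

Lemma max_keyP m j : (phi (j + m.+2) < nk)%N ->
  [/\ (max_key m j + m.+2 < nk)%N, (max_key m j + m.+2 <= phi (j + m.+2))%N,
      zeta j = zeta (j + m.+2)%N ->
        xi (max_key m j) = zeta j /\ xi (max_key m j + m.+2)%N = zeta j
    & zeta j < zeta (j + m.+2)%N ->
        xi (max_key m j) < xi (max_key m j + m.+2)%N].
Proof.
move=> jn; set z := zeta (j + m.+2)%N.
have [r _ [rm rC kE Pr phir]] := key_count (@below_down z) jn.
have {}Pr l : (l < m.+3)%N -> (zeta (j + l)%N < z) = (l < r)%N := Pr l.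
rewrite -/(max_key m j) in kE.
move: rC kE phir; set C := count _ _ => rC kE phir.
have Pxi k : (k < nk)%N -> (xi k < z) = (k < C)%N.
  by move=> kn; rewrite /C -P_xi //; exact: below_down.
have rm' : (r < m.+3)%N by have := Pr m.+2 (ltnSn _); rewrite ltxx; lia.
have kn : (max_key m j + m.+2 <= phi (j + m.+2))%N.
  rewrite kE; have := phir r rm'; rewrite ltnn => h.
  have := phi_add (j + r) (m.+2 - r)%N; rewrite -addnA subnKC //; lia.
have kn' := leq_ltn_trans kn jn.
split => //.
  move=> E; have rE : r = 0%N.
    have := Pr 0%N isT; rewrite addn0 E ltxx; lia.
  have h1 : z <= xi (max_key m j) by rewrite leNgt Pxi; lia.
  have h2 : xi (max_key m j + m.+2)%N <= z by apply: xi_le.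
  have h3 : xi (max_key m j) <= xi (max_key m j + m.+2)%N by apply: xi_le; lia.
  by rewrite E -/z; split; apply/le_anti; apply/andP; split => //; lra.
move=> h; have r0 : (0 < r)%N by rewrite -Pr // addn0.
apply: (@lt_le_trans _ _ z); first by rewrite Pxi; lia.
by rewrite leNgt Pxi; lia.
Qed.

(** The counterpart of [min_keyS]: the last coefficient comes from the second
    primitive, and summation by parts shifts it by one. *)
Lemma max_keyS m j : (phi (j + m.+3) < nk)%N -> zeta j < zeta (j + m.+3)%N ->
  (max_key m.+1 j).+1 = max_key m j.+1 /\ (max_key m j < max_key m j.+1)%N.
Proof.
move=> jn h; have jn' : (phi (j + m.+2) < nk)%N by apply: leq_ltn_trans jn; apply: phi_le; lia.
set z := zeta (j + m.+3)%N in h.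
have zE : zeta (j.+1 + m.+2)%N = z by rewrite addSnnS.
have [r rE [rm rC kE Pr phir]] := key_count (@below_down z) jn.
have {}Pr l : (l < m.+4)%N -> (zeta (j + l)%N < z) = (l < r)%N := Pr l.
have tE : r = (count (below z \o zeta) (iota j.+1 m.+3)).+1.
  by rewrite rE count_iota_recl (h : (below z \o zeta) j = true) add1n.
have k1 : max_key m j.+1 = (count (below z \o xi) (iota 0 nk) - r.-1)%N.
  by rewrite /max_key /key zE tE.
have k0 : (max_key m.+1 j).+1 = max_key m j.+1.
  by rewrite k1 /max_key kE; lia.
split => //.
have := zeta_le (leqnSn (j + m.+2)); rewrite -addnS -/z le_eqVlt => /predU1P[E|E].
  have e : (below z \o zeta) (j + m.+3)%N = false by rewrite /= /below ltxx.
  by rewrite -k0 ltnS /max_key E -/z /key (count_iota_recr _ j m.+3) e addn0.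
have [_ kn _ _] := max_keyP jn'.
have C1 := esym (P_xi (@below_down z) jn'); rewrite [RHS]E in C1.
rewrite k1; have := Pr m.+3 (ltnSn _); rewrite -/z ltxx.
lia.
Qed.

End Keys.

(** * Knot insertion: the recursion step *)

Definition extreme (R : realType) (b : bool) n e (c : nat -> R) : Prop :=
  [/\ (e < n)%N, c e != 0 &
      forall k, (k < n)%N -> c k != 0 -> if b then (e <= k)%N else (k <= e)%N].

Section Insertion.
Variables (R : realType) (xi : nat -> R) (U V : nat -> R -> R).
Variables (phi : nat -> nat) (Uc Vc : nat -> R -> R) (nk : nat).

Hypothesis xi_le : forall i j, (i <= j)%N -> xi i <= xi j.
Hypothesis goodUV : forall i, xi i < xi i.+1 ->
  good_pair (xi i) (xi i.+1) (U i) (V i).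
Hypothesis phi_lt : forall i, (phi i < phi i.+1)%N.

Local Notation zeta := (xi \o phi).

Hypothesis goodUVc : forall j, zeta j < zeta j.+1 ->
  good_pair (zeta j) (zeta j.+1) (Uc j) (Vc j).
Hypothesis spanUVc : forall j k, (phi j <= k < phi j.+1)%N -> xi k < xi k.+1 ->
  forall f, f = Uc j \/ f = Vc j ->
  exists al be, forall x, xi k <= x <= xi k.+1 -> f x = al * U k x + be * V k x.

Local Notation N := (spl xi U V).
Local Notation NC := (spl_cum xi U V).
Local Notation Nc := (spl zeta Uc Vc).
Local Notation NCc := (spl_cum zeta Uc Vc).

Let zeta_le := zeta_le xi_le phi_lt.
Let phi_le := phi_le phi_lt.

Definition extreme_key (b : bool) m j : nat :=
  if b then min_key xi phi nk m j else max_key xi phi nk m j.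

Definition insertion_level b m : Prop := forall j, (phi (j + m.+2) < nk)%N ->
  zeta j < zeta (j + m.+2)%N ->
  exists2 c : nat -> R, forall x, Nc m j x = \sum_(k < nk - m.+2) c k * N m k x
  & extreme b (nk - m.+2) (extreme_key b m j) c.

Section Step.
Variables (b : bool) (m : nat).
Hypothesis IH : insertion_level b m.

Let L : spline_level xi U V m := spline_levels xi_le goodUV m.
Let Lc : spline_level zeta Uc Vc m := spline_levels zeta_le goodUVc m.

(** Primitives of splines with total mass 1 expand with weights of sum 1.  The
    weight of a degenerate coarse spline is concentrated on a fine spline that
    degenerates at the same knot; the one at the key is chosen so that the position
    of the extreme weight obeys the same rule in all cases. *)
Lemma cum_insertion j : (phi (j + m.+2) < nk)%N ->
  exists2 w : nat -> R, forall x, NCc m j x = \sum_(k < nk - m.+2) w k * NC m k x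
  & \sum_(k < nk - m.+2) w k = 1 /\ extreme b (nk - m.+2) (extreme_key b m j) w.
Proof.
move=> jn; set n := (nk - m.+2)%N; set e := extreme_key b m j.
have [en triv nontriv] : [/\ (e < n)%N, zeta j = zeta (j + m.+2)%N ->
   xi e = zeta j /\ xi (e + m.+2)%N = zeta j
   & zeta j < zeta (j + m.+2)%N -> xi e < xi (e + m.+2)%N].
  rewrite /e /extreme_key /n; case: (b).
    by have [h _ ? ?] := min_keyP xi_le phi_lt jn; split => //; lia.
  by have [h _ ? ?] := max_keyP xi_le phi_lt jn; split => //; lia.
have [/eqP E|/eqP E] := boolP (zeta j == zeta (j + m.+2)%N).
  have [E1 E2] := triv E.
  have sum1 (F : nat -> R) : \sum_(k < n) (k == e :> nat)%:R * F k = F e.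
    rewrite (bigD1 (Ordinal en)) //= eqxx mul1r big1 ?addr0 // => k ke.
    by rewrite -val_eqE /= in ke; rewrite (negbTE ke) mul0r.
  exists (fun k => (k == e)%:R).
    move=> x; rewrite [RHS](sum1 (fun k => NC m k x)) (spl_cum_trivial Lc _ E) (spl_cum_trivial L) ?E1 //.
  split; first by rewrite -[RHS](sum1 (fun=> 1)); apply: eq_bigr => k _; rewrite mulr1.
  split => //; first by rewrite eqxx oner_neq0.
  by move=> k _; case: (eqVneq k e) => [->|]; rewrite ?eqxx //; case: (b).
have h := spl_nontrivial zeta_le E.
have [c Nc_eq [_ ce cext]] := IH jn h.
have NcE : Nc m j = fun x => \sum_(k < n) c k * N m k x by apply/funext.
have Fi k : (k < n)%N -> integrableR (N m k) by move=> _; exact: (spl_integrable L).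
have mass0 := spl_mass_gt0 Lc h.
have massE : mass (Nc m j) = \sum_(k < n) c k * mass (N m k).
  by rewrite NcE; exact: mass_lincomb.
set T := mass (Nc m j) in mass0 massE.
exists (fun k => c k * mass (N m k) / T).
  move=> x; rewrite (spl_cumE Lc) // -/T [in LHS]NcE.
  rewrite (cumul_lincomb c x Fi) mulr_suml; apply: eq_bigr => k _.
  have [/eqP Ek|/eqP Ek] := boolP (xi k == xi (k + m.+2)%N).
    rewrite (spl_eq0 L Ek) /mass Rintegral_cst // mul0r mulr0 !mul0r.
    by rewrite cumul_eq0 ?mulr0 ?mul0r.
  have hk := spl_nontrivial xi_le Ek; have := spl_mass_gt0 L hk.
  rewrite (spl_cumE L) // => mk0; field; by rewrite !gt_eqF.
split; first by rewrite -mulr_suml -massE divff // gt_eqF.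
split => //.
  have me := spl_mass_gt0 L (nontriv h).
  by rewrite !mulf_neq0 ?invr_neq0 // gt_eqF.
by move=> k kn; rewrite -mulrA mulf_eq0 negb_or => /andP[ck _]; exact: cext.
Qed.

(** The coefficients are the partial sums c of the differences of the weights.
    Before both keys c vanishes, and after both keys it does too, because both
    families of weights have sum 1. *)
Lemma insertion_step : insertion_level b m.+1.
Proof.
move=> j jn h.
have jn1 : (phi (j.+1 + m.+2) < nk)%N by rewrite addSnnS.
have jn0 : (phi (j + m.+2) < nk)%N by apply: leq_ltn_trans jn; apply: phi_le; lia.
have [w wE [w1 [en we wext]]] := cum_insertion jn0.
have [w' wE' [w1' [en' we' wext']]] := cum_insertion jn1.
set n := (nk - m.+3)%N; have nE : (nk - m.+2)%N = n.+1 by rewrite /n; lia.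
rewrite nE in w1 w1' en en' wext wext'.
pose c k := \sum_(l < k.+1) (w l - w' l).
have cS k : c k.+1 = c k + (w k.+1 - w' k.+1) by rewrite /c big_ord_recr.
have cn : c n = 0 by rewrite /c sumrB w1 w1' subrr.
have abel (F : nat -> R) q : \sum_(k < q.+1) (w k - w' k) * F k =
    \sum_(k < q) c k * (F k - F k.+1) + c q * F q.
  elim: q => [|q IHq]; first by rewrite big_ord1 big_ord0 add0r /c big_ord1.
  by rewrite big_ord_recr IHq [in RHS]big_ord_recr cS /=; ring.
exists c.
  move=> x; rewrite splS wE wE' nE -sumrB.
  under eq_bigr do rewrite -mulrBl.
  by rewrite (abel (fun k => NC m k x)) cn mul0r addr0.
have {abel wE wE'} cz k : (k <= n)%N -> \sum_(l < k.+1) w l + \sum_(k.+1 <= l < n.+1) w l = 1.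
  move=> kn; rewrite -w1 -!(big_mkord xpredT w).
  by rewrite [RHS](big_cat_nat _ (n := k.+1)).
have {}cz' k : (k <= n)%N -> \sum_(l < k.+1) w' l + \sum_(k.+1 <= l < n.+1) w' l = 1.
  move=> kn; rewrite -w1' -!(big_mkord xpredT w').
  by rewrite [RHS](big_cat_nat _ (n := k.+1)).
have bd : (extreme_key b m.+1 j < n)%N.
  rewrite /extreme_key /n; case: (b).
    by have [] := min_keyP xi_le phi_lt jn; lia.
  by have [] := max_keyP xi_le phi_lt jn; lia.
move: wext wext' we we' en en' bd; rewrite /extreme_key; case: (b) => /= wext wext' we we' en en' bd.
  have [-> lt_key] := min_keyS xi_le phi_lt jn h.
  set e := min_key _ _ _ m j in wext we en lt_key *.
  set e' := min_key _ _ _ m j.+1 in wext' we' en' lt_key *.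
  have w0 l : (l < e)%N -> w l = 0.
    move=> le; apply/eqP/negPn/negP => wl.
    have ln : (l < n.+1)%N by lia.
    by have := wext l ln wl; lia.
  have w0' l : (l < e')%N -> w' l = 0.
    move=> le; apply/eqP/negPn/negP => wl.
    have ln : (l < n.+1)%N by lia.
    by have := wext' l ln wl; lia.
  split; first by lia.
    rewrite /c big_ord_recr big1 /= => [|l _]; last by rewrite w0 ?w0' ?subr0 //; have := ltn_ord l; lia.
    by rewrite w0' // subr0 add0r.
  move=> k _; apply: contraNT; rewrite -ltnNge => ke; apply/eqP.
  by rewrite /c big1 // => l _; rewrite w0 ?w0' ?subr0 //; have := ltn_ord l; lia.
have [e1 lt_key] := max_keyS xi_le phi_lt jn h.
set e0 := max_key _ _ _ m.+1 j in bd e1 *.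
set e := max_key _ _ _ m j in wext we en lt_key *.
rewrite -e1 in wext' we' en' lt_key.
have w0 l : (l < n.+1)%N -> (e < l)%N -> w l = 0.
  move=> ln le; apply/eqP/negPn/negP => wl.
  by have := wext l ln wl; lia.
have w0' l : (l < n.+1)%N -> (e0.+1 < l)%N -> w' l = 0.
  move=> ln le; apply/eqP/negPn/negP => wl.
  by have := wext' l ln wl; lia.
(* from the end, c is a difference of tails of the weights *)
have tail k : (k <= n)%N ->
    c k = \sum_(k.+1 <= l < n.+1) w' l - \sum_(k.+1 <= l < n.+1) w l.
  move=> kn; rewrite /c sumrB; have := cz k kn; have := cz' k kn; lra.
have sum0 (F : nat -> R) q : (forall l, (q <= l < n.+1)%N -> F l = 0) ->
    \sum_(q <= l < n.+1) F l = 0.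
  by move=> F0; rewrite big_nat_cond big1 // => l; rewrite andbT; exact: F0.
split; first by lia.
  rewrite tail; last by lia.
  rewrite (big_ltn (n := n.+1)) ?ltnS //.
  rewrite !sum0 ?addr0 ?subr0 // => l /andP[l1 l2]; [apply: w0'|apply: w0]; lia.
move=> k kn; apply: contraNT; rewrite -ltnNge => ke; apply/eqP.
rewrite tail; last by lia.
by rewrite !sum0 ?subrr // => l /andP[l1 l2]; [apply: w0|apply: w0']; lia.
Qed.

End Step.

End Insertion.

(** * Knot insertion: order two *)

Section InsertionBase.
Variables (R : realType) (xi : nat -> R) (U V : nat -> R -> R).
Variables (phi : nat -> nat) (Uc Vc : nat -> R -> R) (nk : nat).

Hypothesis xi_le : forall i j, (i <= j)%N -> xi i <= xi j.
Hypothesis goodUV : forall i, xi i < xi i.+1 ->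
  good_pair (xi i) (xi i.+1) (U i) (V i).
Hypothesis phi_lt : forall i, (phi i < phi i.+1)%N.

Local Notation zeta := (xi \o phi).

Hypothesis goodUVc : forall j, zeta j < zeta j.+1 ->
  good_pair (zeta j) (zeta j.+1) (Uc j) (Vc j).
Hypothesis spanUVc : forall j k, (phi j <= k < phi j.+1)%N -> xi k < xi k.+1 ->
  forall f, f = Uc j \/ f = Vc j ->
  exists al be, forall x, xi k <= x <= xi k.+1 -> f x = al * U k x + be * V k x.

Local Notation N := (spl xi U V).
Local Notation Nc := (spl zeta Uc Vc).

Lemma bracket_le k i x : xi k <= x < xi k.+1 -> (xi i <= x) = (i <= k)%N.
Proof.
move=> /andP[kx xk]; apply/idP/idP => [ix|ik]; last by apply: le_trans kx; exact: xi_le.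
rewrite leqNgt; apply: contraTN (le_lt_trans ix xk) => ki.
by rewrite -leNgt xi_le.
Qed.

Lemma bracket_lt k i x : xi k <= x < xi k.+1 -> (x < xi i) = (k < i)%N.
Proof. by move=> /bracket_le kx; rewrite ltNge kx -ltnNge. Qed.

Lemma bracket_ex n x : xi 0%N <= x < xi n ->
  exists2 k, (k < n)%N & xi k <= x < xi k.+1.
Proof.
elim: n => [|n IH] /andP[x0 xn]; first by have := le_lt_trans x0 xn; rewrite ltxx.
have [h|h] := ltP x (xi n); last by exists n; rewrite ?h.
have [k kn hk] : exists2 k, (k < n)%N & xi k <= x < xi k.+1 by apply: IH; rewrite x0.
by exists k => //; exact: ltnW.
Qed.

(** The coarse hat j on the k-th fine interval, by the formula that is also valid
    at the end of this interval, where the hat itself may jump. *)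
Let piece j k x : R :=
  if (phi j <= k < phi j.+1)%N then Vc j x / Vc j (zeta j.+1)
  else if (phi j.+1 <= k < phi j.+2)%N then Uc j.+1 x / Uc j.+1 (zeta j.+1)
  else 0.

Lemma hat_piece j k x : xi k <= x < xi k.+1 -> Nc 0 j x = piece j k x.
Proof. by move=> kx /=; rewrite !(bracket_le _ kx) !(bracket_lt _ kx). Qed.

Lemma zeta_gt j k : (phi j <= k < phi j.+1)%N -> xi k < xi k.+1 -> zeta j < zeta j.+1.
Proof.
move=> /andP[h1 h2] h; apply: (@le_lt_trans _ _ (xi k)); first exact: xi_le.
by apply: lt_le_trans h _; exact: xi_le.
Qed.

Lemma goodc_V j k : (phi j <= k < phi j.+1)%N -> xi k < xi k.+1 ->
  0 < Vc j (zeta j.+1).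
Proof. by move=> hk /(zeta_gt hk) h; apply: (good_V (goodUVc h)); rewrite h lexx. Qed.

Lemma goodc_U j k : (phi j <= k < phi j.+1)%N -> xi k < xi k.+1 ->
  0 < Uc j (zeta j).
Proof. by move=> hk /(zeta_gt hk) h; apply: (good_U (goodUVc h)); rewrite h lexx. Qed.

Lemma spanned_ends k f : xi k < xi k.+1 ->
  (exists al be, forall x, xi k <= x <= xi k.+1 -> f x = al * U k x + be * V k x) ->
  forall x, xi k <= x <= xi k.+1 ->
  f x = f (xi k) / U k (xi k) * U k x + f (xi k.+1) / V k (xi k.+1) * V k x.
Proof.
move=> h [al [be fE]] x xk; have g := goodUV h.
have U0 : 0 < U k (xi k) by apply: (good_U g); rewrite h lexx.
have V0 : 0 < V k (xi k.+1) by apply: (good_V g); rewrite h lexx.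
have le := ltW h.
rewrite (fE x) // (fE (xi k)) ?lexx // (fE (xi k.+1)) ?lexx ?andbT //.
rewrite (good_Ub g) (good_Va g); field; by rewrite !gt_eqF.
Qed.

Lemma piece_span j k x : xi k < xi k.+1 -> xi k <= x <= xi k.+1 ->
  piece j k x = piece j k (xi k) / U k (xi k) * U k x
                + piece j k (xi k.+1) / V k (xi k.+1) * V k x.
Proof.
move=> h xk; rewrite /piece; case: ifP => [h1|_].
  rewrite {1}(spanned_ends h (spanUVc h1 h (or_intror erefl)) xk); ring.
case: ifP => [h1|_]; last by rewrite !mul0r addr0.
rewrite {1}(spanned_ends h (spanUVc h1 h (or_introl erefl)) xk); ring.
Qed.

(** A coarse hat can only jump at a multiple knot, so the two limits used in [coef]
    agree at a simple fine knot. *)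
Lemma piece_continuous j k : xi k < xi k.+1 -> xi k.+1 < xi k.+2 ->
  piece j k (xi k.+1) = piece j k.+1 (xi k.+1).
Proof.
move=> h h'; have p0 := phi_lt j; have p1 := phi_lt j.+1.
rewrite /piece.
have [h1|h1] := boolP (phi j <= k < phi j.+1)%N.
  have V0 := goodc_V h1 h.
  have [h2|h2] := boolP (phi j <= k.+1 < phi j.+1)%N; first by [].
  have e : k.+1 = phi j.+1 by lia.
  have h3 : (phi j.+1 <= k.+1 < phi j.+2)%N by lia.
  have U0 := goodc_U h3 h'.
  by rewrite h3 e !divff ?gt_eqF.
have [h2|h2] := boolP (phi j.+1 <= k < phi j.+2)%N.
  rewrite ifF; last by lia.
  have [h3|h3] := boolP (phi j.+1 <= k.+1 < phi j.+2)%N; first by [].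
  have e : k.+1 = phi j.+2 by lia.
  by rewrite e (good_Ub (goodUVc (zeta_gt h2 h))) mul0r.
have [h3|h3] := boolP (phi j <= k.+1 < phi j.+1)%N.
  have e : k.+1 = phi j by lia.
  by rewrite {1}e (good_Va (goodUVc (zeta_gt h3 h'))) mul0r.
by rewrite ifF //; lia.
Qed.

(** The coefficient of a fine hat is the value of the coarse one at its middle knot
    xi k.+1: the limit from the left if the fine hat has a left half, and the value
    from the right otherwise. *)
Let coef j k : R := if xi k < xi k.+1 then piece j k (xi k.+1)
  else if xi k.+1 < xi k.+2 then piece j k.+1 (xi k.+1) else 0.

Lemma coef_prev j k : xi k.+1 < xi k.+2 -> coef j k = piece j k.+1 (xi k.+1).
Proof.
by move=> h; rewrite /coef; case: ifP => [h'|_]; rewrite ?h // piece_continuous.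
Qed.

Lemma hat_insertion j x : (phi j.+2 < nk)%N ->
  Nc 0 j x = \sum_(k < nk - 2) coef j k * N 0 k x.
Proof.
move=> jn; have p0 := phi_lt j; have p1 := phi_lt j.+1.
have zeta_le' : forall i i', (i <= i')%N -> zeta i <= zeta i' := zeta_le xi_le phi_lt.
have [x0|x0] := ltP x (xi 0%N).
  rewrite big1 => [|k _]; last first.
    by rewrite (hat_support U V xi_le) ?mulr0 //; left; apply: lt_le_trans x0 _; exact: xi_le.
  by rewrite (hat_support Uc Vc zeta_le') //; left; apply: lt_le_trans x0 _; exact: xi_le.
have [xn|xn] := ltP x (xi nk.-1); last first.
  rewrite big1 => [|k _]; last first.
    rewrite (hat_support U V xi_le) ?mulr0 //; right; apply: le_trans xn; apply: xi_le.
    by have := ltn_ord k; lia.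
  by rewrite (hat_support Uc Vc zeta_le') //; right; apply: le_trans xn; apply: xi_le; lia.
have [k kn kx] : exists2 k, (k < nk.-1)%N & xi k <= x < xi k.+1.
  by apply: bracket_ex; rewrite x0.
have h : xi k < xi k.+1 by case/andP: kx; exact: le_lt_trans.
have kx' : xi k <= x <= xi k.+1 by case/andP: kx => -> /ltW.
rewrite (hat_piece _ kx) (piece_span _ h kx').
have cbeta : coef j k = piece j k (xi k.+1) by rewrite /coef h.
have full : \sum_(l < k.+1) coef j l * N 0 l x =
    piece j k (xi k) / U k (xi k) * U k x + piece j k (xi k.+1) / V k (xi k.+1) * V k x.
  have := hat_sum U V xi_le (n := k) (i := 0) (coef j) kx; rewrite !add0n => ->.
  rewrite cbeta; congr (_ + _).
  case: (k) h => [|k'] h; last by rewrite coef_prev.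
  rewrite mul0r /piece; case: ifP => [h1|_].
    have -> : 0%N = phi j by lia.
    by rewrite (good_Va (goodUVc (zeta_gt h1 h))) !mul0r.
  by rewrite ifF ?mul0r //; lia.
(* on the last fine interval the hat number k would need a knot beyond the given
   ones, and its coefficient is 0 *)
rewrite -full; have [kn'|kn'] := ltnP k (nk - 2).
  have En : (nk - 2 = k.+1 + (nk - 2 - k.+1))%N by lia.
  rewrite En big_split_ord /= [X in _ = _ + X]big1 ?addr0 // => l _.
  rewrite -[X in _ * X]/(N 0 (k.+1 + l)%N x).
  rewrite (hat_support U V xi_le) ?mulr0 //; left; rewrite (bracket_lt _ kx).
  exact: leq_addr.
have {kn'} ek : k = (nk - 2)%N by lia.
rewrite big_ord_recr /= ek -[RHS]addr0; congr (_ + _).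
rewrite -ek cbeta /piece ifF; last by lia.
case: ifP => [h2|_]; last by rewrite mul0r.
have -> : k.+1 = phi j.+2 by lia.
by rewrite (good_Ub (goodUVc (zeta_gt h2 h))) !mul0r.
Qed.

Lemma coef_min j : (phi j.+2 < nk)%N -> zeta j < zeta j.+2 ->
  extreme true (nk - 2) (min_key xi phi nk 0 j) (coef j).
Proof.
move=> jn hj; have p0 := phi_lt j; have p1 := phi_lt j.+1.
have jn' : (phi (j + 2) < nk)%N by rewrite addn2.
have [r _ [rm rC kE Pr phir]] := key_count xi_le phi_lt (@at_most_down _ (zeta j)) jn'.
rewrite -/(min_key xi phi nk 0 j) in kE.
have Pxi k : (k < nk)%N -> (xi k <= zeta j) = (k < count (at_most (zeta j) \o xi) (iota 0 nk))%N.
  by move=> kn; rewrite -(P_xi xi_le) //; exact: at_most_down.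
move: Pxi rC kE phir; set C := count _ _ => Pxi rC kE phir.
have [kn _ _ _] := min_keyP xi_le phi_lt jn'.
have r0 : (0 < r)%N by have := phir 0%N isT; rewrite -(Pr 0%N isT) addn0 /at_most /= lexx.
have r2 : (r <= 2)%N.
  by rewrite leqNgt -(Pr 2%N isT) addn2 /= /at_most -ltNge.
have pr0 := phir 0%N isT; have pr1 := phir 1%N isT; have pr2 := phir 2%N isT.
rewrite addn0 addn1 addn2 in pr0 pr1 pr2.
have Cn : (C <= nk)%N by apply: leq_trans (count_size _ _) _; rewrite size_iota.
set e := min_key _ _ _ _ _ in kE kn *.
(* the intervals before the coarse support *)
have before k x : (k.+1 < C)%N -> xi k < xi k.+1 -> piece j k x = 0.
  move=> kC h; have kj : (k < phi j)%N.
    rewrite ltnNge; apply/negP => jk; have := xi_le jk.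
    by rewrite leNgt (lt_le_trans h) // Pxi //; lia.
  by rewrite /piece !ifF //; lia.
split; first by lia.
  have [rE|rE] : r = 1%N \/ r = 2%N by lia.
    have xe : xi e <= zeta j by rewrite Pxi; lia.
    have xe1 : zeta j < xi e.+1 by rewrite ltNge Pxi; lia.
    have ee : (phi j <= e < phi j.+1)%N by lia.
    rewrite /coef (le_lt_trans xe xe1) /piece ee gt_eqF // divr_gt0 ?(goodc_V ee) //; last exact: le_lt_trans xe xe1.
    apply: (good_V (goodUVc (zeta_gt ee (le_lt_trans xe xe1)))); rewrite xe1 /=.
    by apply: xi_le; lia.
  have xe : zeta j <= xi e by apply: xi_le; lia.
  have xe1 : xi e.+1 <= zeta j by rewrite Pxi; lia.
  have xe2 : zeta j < xi e.+2 by rewrite ltNge Pxi; lia.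
  have le12 := le_lt_trans xe1 xe2.
  rewrite coef_prev // /piece ifF; last by lia.
  have ee : (phi j.+1 <= e.+1 < phi j.+2)%N by lia.
  rewrite ee; have -> : xi e.+1 = zeta j.+1.
    apply/le_anti; rewrite (xi_le (i := phi j.+1)) ?andbT; last by lia.
    by rewrite (le_trans xe1) //; apply: xi_le; lia.
  by rewrite divff ?oner_neq0 // gt_eqF // (goodc_U ee).
move=> k kn'; apply: contraNT; rewrite -ltnNge => ke; apply/eqP.
rewrite /coef; case: ifP => [h|h].
  by rewrite before //; lia.
case: ifP => // h'; have [k2|k2] := ltnP k.+2 C; first exact: before.
have kC : k.+2 = C by lia.
have rE : r = 1%N by lia.
have xk1 : xi k.+1 <= zeta j by rewrite Pxi; lia.
have kk : (phi j <= k.+1 < phi j.+1)%N by lia.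
rewrite /piece kk; have -> : xi k.+1 = zeta j.
  by apply/le_anti; rewrite xk1 /=; apply: xi_le; lia.
by rewrite (good_Va (goodUVc (zeta_gt kk h'))) mul0r.
Qed.

Lemma coef_max j : (phi j.+2 < nk)%N -> zeta j < zeta j.+2 ->
  extreme false (nk - 2) (max_key xi phi nk 0 j) (coef j).
Proof.
move=> jn hj; have p0 := phi_lt j; have p1 := phi_lt j.+1.
have jn' : (phi (j + 2) < nk)%N by rewrite addn2.
set z := zeta j.+2 in hj.
have [r _ [rm rC kE Pr phir]] := key_count xi_le phi_lt (@below_down _ z) jn'.
have {}kE : max_key xi phi nk 0 j = (count (below z \o xi) (iota 0 nk) - r)%N.
  by rewrite -kE /max_key addn2.
have Pxi k : (k < nk)%N -> (xi k < z) = (k < count (below z \o xi) (iota 0 nk))%N.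
  by move=> kn; rewrite -(P_xi xi_le) //; exact: below_down.
move: Pxi rC kE phir; set C := count _ _ => Pxi rC kE phir.
have [kn _ _ _] := max_keyP xi_le phi_lt jn'.
have r0 : (0 < r)%N by rewrite -(Pr 0%N isT) addn0.
have r2 : (r <= 2)%N.
  by rewrite leqNgt -(Pr 2%N isT) addn2 /= /below ltxx.
have pr0 := phir 0%N isT; have pr1 := phir 1%N isT; have pr2 := phir 2%N isT.
rewrite addn0 addn1 addn2 in pr0 pr1 pr2.
have Cn : (C <= nk)%N by apply: leq_trans (count_size _ _) _; rewrite size_iota.
set e := max_key _ _ _ _ _ in kE kn *.
(* the intervals after the coarse support *)
have after k x : (C <= k)%N -> (k.+1 < nk)%N -> xi k < xi k.+1 -> piece j k x = 0.
  move=> kC kn' h; have kj : (phi j.+2 <= k)%N.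
    rewrite leqNgt; apply/negP => jk; have : xi k.+1 <= z by exact: xi_le.
    by rewrite leNgt (le_lt_trans _ h) // leNgt Pxi; lia.
  by rewrite /piece !ifF //; lia.
split; first by lia.
  have xe : xi e < z by rewrite Pxi; lia.
  have [rE|rE] : r = 1%N \/ r = 2%N by lia.
    have xe1 : z <= xi e.+1 by rewrite leNgt Pxi; lia.
    have ee : (phi j <= e < phi j.+1)%N by lia.
    have h := lt_le_trans xe xe1.
    rewrite /coef h /piece ee; have -> : xi e.+1 = zeta j.+1.
      apply/le_anti; rewrite xi_le /=; last by lia.
      by apply: le_trans xe1; apply: xi_le; lia.
    by rewrite divff ?oner_neq0 // gt_eqF // (goodc_V ee).
  have xe1 : xi e.+1 < z by rewrite Pxi; lia.
  have xe2 : z <= xi e.+2 by rewrite leNgt Pxi; lia.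
  have U0 k : (phi j.+1 <= k < phi j.+2)%N -> xi k < xi k.+1 -> xi e.+1 < z ->
      (phi j.+1 <= e.+1)%N -> Uc j.+1 (xi e.+1) / Uc j.+1 (zeta j.+1) != 0.
    move=> kk hk _ je; rewrite gt_eqF // divr_gt0 ?(goodc_U kk) //.
    apply: (good_U (goodUVc (zeta_gt kk hk))); rewrite xe1 andbT; exact: xi_le.
  rewrite /coef; case: ifP => [h|_].
    rewrite /piece; case: ifP => [ee|ne].
      have -> : e.+1 = phi j.+1 by lia.
      by rewrite divff ?oner_neq0 // gt_eqF // (goodc_V ee).
    have ee : (phi j.+1 <= e < phi j.+2)%N by lia.
    by rewrite ee; apply: (U0 e) => //; lia.
  have h := lt_le_trans xe1 xe2; rewrite h /piece ifF; last by lia.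
  have ee : (phi j.+1 <= e.+1 < phi j.+2)%N by lia.
  by rewrite ee; apply: (U0 e.+1) => //; lia.
move=> k kn'; apply: contraNT; rewrite -ltnNge => ke; apply/eqP.
rewrite /coef; case: ifP => [h|h].
  have [k1|k1] := leqP C k; first by rewrite after //; lia.
  have kC : k.+1 = C by lia.
  have rE : r = 2%N by lia.
  rewrite /piece ifF; last by lia.
  case: ifP => // kk; have -> : xi k.+1 = z.
    apply/le_anti; rewrite [X in X && _]xi_le /=; last by lia.
    by rewrite leNgt Pxi; lia.
  by rewrite (good_Ub (goodUVc (zeta_gt kk h))) mul0r.
by case: ifP => // h'; rewrite after //; lia.
Qed.

Theorem knot_insertion b m : insertion_level xi U V phi Uc Vc nk b m.
Proof.
elim: m => [|m IH]; last by apply: insertion_step IH.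
move=> j; rewrite addn2 => jn h; exists (coef j).
  by move=> x; rewrite hat_insertion.
by rewrite /extreme_key; case: b; [exact: coef_min|exact: coef_max].
Qed.

End InsertionBase.

(** * Generators of Chebyshev spaces *)

Section Generators.
Variable R : realType.
Implicit Types (a b c d : R) (D E : set R) (f g h u v : R -> R).

Lemma derivative_on_sub D E f g f' : E `<=` D -> (forall x, E x -> f x = g x) ->
  derivative_on D f f' -> derivative_on E g f'.
Proof.
move=> ED fg df x Ex; apply: cvg_trans (df x (ED x Ex)) => P /=.
rewrite !nbhs_simpl /within /=; apply: filterS => y h Ey.
by rewrite -!fg //; apply: h; exact: ED.
Qed.

Lemma Ck_derivative_on_sub D E k f g h : E `<=` D -> (forall x, E x -> f x = g x) ->
  Ck_derivative_on D k f h -> Ck_derivative_on E k g h.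
Proof.
move=> ED; elim: k f g => [|k IH] f g fg /=.
  move=> [cf fh]; split.
    apply: (@subspace_eq_continuous _ E _ f); first by move=> x; rewrite inE => /fg.
    exact: continuous_subspaceW cf.
  by move=> x; rewrite inE => Ex; rewrite -fg // fh // inE; exact: ED.
move=> [f' df hf]; exists f'; first exact: derivative_on_sub df.
exact: IH hf.
Qed.

Lemma Ck_derivative_on_continuous D k f h :
  Ck_derivative_on D k f h -> {within D, continuous h}.
Proof.
elim: k f => [|k IH] f /=; last by case=> f' _; exact: IH.
by case=> cf fh; apply: subspace_eq_continuous cf => x; exact: fh.
Qed.

(** Every point of a nondegenerate interval is a limit of other points of it, so
    that derivatives on the interval are unique. *)
Lemma within_itv_proper a b x : a < b -> a <= x <= b ->
  ProperFilter (within `[a, b] x^').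
Proof.
move=> ab /andP[ax xb]; apply: Build_ProperFilter_ex => P.
rewrite /within /= => -[/= e e0 he].
have [y [yx ye yab]] : exists y, [/\ y != x, `|x - y| < e & a <= y <= b].
  have [xb'|bx] := ltP x b.
    exists (Num.min b (x + e / 2)).
    have : x < Num.min b (x + e / 2) by rewrite lt_min xb' ltrDl divr_gt0.
    have : Num.min b (x + e / 2) <= x + e / 2 by rewrite ge_min lexx orbT.
    have : Num.min b (x + e / 2) <= b by rewrite ge_min lexx.
    move: (Num.min _ _) => y y1 y2 y3; split; first by rewrite gt_eqF.
      by rewrite ltr0_norm; lra.
    by apply/andP; split; lra.
  exists (Num.max a (x - e / 2)).
  have : Num.max a (x - e / 2) < x by rewrite gt_max; apply/andP; split; lra.
  have : x - e / 2 <= Num.max a (x - e / 2) by rewrite le_max lexx orbT.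
  have : a <= Num.max a (x - e / 2) by rewrite le_max lexx.
  move: (Num.max _ _) => y y1 y2 y3; split; first by rewrite lt_eqF.
    by rewrite gtr0_norm; lra.
  by apply/andP; split; lra.
by exists y; apply: (he y ye yx); rewrite /= in_itv.
Qed.

Lemma derivative_on_unique a b f f1 f2 : a < b ->
  derivative_on `[a, b] f f1 -> derivative_on `[a, b] f f2 ->
  forall x, `[a, b]%classic x -> f1 x = f2 x.
Proof.
move=> ab d1 d2 x xab.
have PF : ProperFilter (within `[a, b] x^').
  by apply: within_itv_proper => //; move: xab; rewrite /= in_itv.
exact: (cvg_unique (@norm_hausdorff _ _) (d1 x xab) (d2 x xab)).
Qed.

Lemma Ck_derivative_on_unique a b k f h1 h2 : a < b ->
  Ck_derivative_on `[a, b] k f h1 -> Ck_derivative_on `[a, b] k f h2 ->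
  forall x, `[a, b]%classic x -> h1 x = h2 x.
Proof.
move=> ab; elim: k f => [|k IH] f /=.
  by move=> [_ e1] [_ e2] x xab; rewrite -e1 ?inE // -e2 ?inE.
move=> [f1 d1 c1] [f2 d2 c2]; apply: IH c1 _.
apply: Ck_derivative_on_sub c2 => // x xab.
by apply: (derivative_on_unique ab d2 d1).
Qed.

Lemma span2_sub a b c d f g h : `[c, d] `<=` `[a, b] ->
  span2 `[a, b] f g h -> span2 `[c, d] f g h.
Proof. by move=> cd [al [be E]]; exists al, be => x /cd; exact: E. Qed.

Lemma eq_span2 D f g f' g' : (forall x, D x -> f x = f' x) ->
  (forall x, D x -> g x = g' x) -> span2 D f g = span2 D f' g'.
Proof.
move=> ff gg; apply/seteqP; split => h [al [be E]]; exists al, be => x Dx.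
  by rewrite E // ff // gg.
by rewrite E // ff // gg.
Qed.

Lemma span2_continuous D f g h : {within D, continuous f} ->
  {within D, continuous g} -> span2 D f g h -> {within D, continuous h}.
Proof.
move=> cf cg [al [be E]].
apply: (@subspace_eq_continuous _ D _ (fun x => al * f x + be * g x)).
  by move=> x; rewrite inE => /E.
move=> x; apply: cvgD; (apply: cvgM; first exact: cvg_cst); [exact: cf|exact: cg].
Qed.

(** Generators with the required zeros exist because W, the determinant of the
    values of f and g at both ends, does not vanish: otherwise some nontrivial
    combination would have two zeros. *)
Lemma generators_nonempty p a b u v : a < b -> admissible_pair p a b u v ->
  exists UV, generators p a b u v UV.
Proof.
move=> ab [f [g [du dv [li zeros]]]].
have Da : `[a, b]%classic a by rewrite /= in_itv /= lexx ltW.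
have Db : `[a, b]%classic b by rewrite /= in_itv /= lexx ltW.
have ab' : a <> b by move=> E; rewrite E ltxx in ab.
have triv al be : al * f a + be * g a = 0 -> al * f b + be * g b = 0 -> al = 0 /\ be = 0.
  move=> za zb; apply: li => x Dx; apply/eqP/negPn/negP => nz.
  apply: ab'; apply: (zeros (fun x => al * f x + be * g x)) => //.
    by exists al, be.
  by exists x.
pose W := g b * f a - f b * g a.
have W0 : W != 0.
  apply/negP => /eqP W0.
  have [gb0 /eqP] : g b = 0 /\ - f b = 0 by apply: triv; rewrite /W in W0; lra.
  rewrite oppr_eq0 => /eqP fb0.
  have [ga0 /eqP] : g a = 0 /\ - f a = 0 by apply: triv; rewrite ?gb0 ?fb0; lra.
  rewrite oppr_eq0 => /eqP fa0.
  have [/eqP] : (1 : R) = 0 /\ (0 : R) = 0 by apply: triv; rewrite ?fa0 ?fb0 ?ga0 ?gb0; lra.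
  by rewrite oner_eq0.
exists (fun x => (g b * f x - f b * g x) / W, fun x => (f a * g x - g a * f x) / W).
exists f, g; split => //=.
- apply/seteqP; split => h [al [be E]].
    exists ((al * g b - be * g a) / W), ((be * f a - al * f b) / W) => x Dx.
    by rewrite E //; ring.
  exists (al * f a + be * g a), (al * f b + be * g b) => x Dx.
  by rewrite E // /W; field.
- split; last by rewrite [g b * _]mulrC subrr mul0r.
  by rewrite -/W divff.
- split; first by rewrite [f a * _]mulrC subrr mul0r.
  by rewrite [X in X / W](_ : _ = W) ?divff // /W; ring.
Qed.

Lemma generator_pairP p a b u v : a < b -> admissible_pair p a b u v ->
  generators p a b u v (generator_pair p a b u v).
Proof.
move=> ab /(generators_nonempty ab) [UV hUV].
by rewrite /generator_pair; apply: xgetI hUV.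
Qed.

(** Derivatives being unique, the span of the chosen generators does not depend on
    the derivatives that witness the choice. *)
Lemma generator_pair_span p a b u v f g : a < b -> admissible_pair p a b u v ->
  Ck_derivative_on `[a, b] (p - 2) u f -> Ck_derivative_on `[a, b] (p - 2) v g ->
  span2 `[a, b] (generator_pair p a b u v).1 (generator_pair p a b u v).2 =
  span2 `[a, b] f g.
Proof.
move=> ab adm du dv; have [f' [g' [du' dv' -> _ _]]] := generator_pairP ab adm.
by apply: eq_span2; apply: Ck_derivative_on_unique; eassumption.
Qed.

(** All signs follow from the intermediate value theorem: where a combination of U
    and V changed sign it would have one zero too many. *)
Lemma generator_pair_good p a b u v : a < b -> admissible_pair p a b u v ->
  good_pair a b (generator_pair p a b u v).1 (generator_pair p a b u v).2.
Proof.
move=> ab adm; have [_ [_ [_ _ _ [Ua Ub] [Va Vb]]]] := generator_pairP ab adm.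
have [f [g [du dv [_ zeros]]]] := adm.
have := generator_pair_span ab adm du dv.
move: (generator_pair _ _ _ _ _) Ua Ub Va Vb => [U V] /= Ua Ub Va Vb sp.
have in_span al be : span2 `[a, b] f g (fun x => al * U x + be * V x).
  by rewrite -sp; exists al, be.
have cont al be : {within `[a, b], continuous (fun x => al * U x + be * V x)}.
  by apply: span2_continuous (in_span al be);
     apply: Ck_derivative_on_continuous; eassumption.
have eqU : (fun x => 1 * U x + 0 * V x) = U by apply/funext => x; rewrite mul1r mul0r addr0.
have eqV : (fun x => 0 * U x + 1 * V x) = V by apply/funext => x; rewrite mul1r mul0r add0r.
have Da : a \in `[a, b] by rewrite in_itv /= lexx ltW.
have Db : b \in `[a, b] by rewrite in_itv /= lexx ltW.
have one_zero al be x y z : let h t := al * U t + be * V t in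
    x \in `[a, b] -> y \in `[a, b] -> z \in `[a, b] ->
    0 < h x -> h y = 0 -> h z = 0 -> y = z.
  move=> h xab yab zab hx hy hz; apply: (zeros h) => //; first exact: in_span.
  by exists x => //; rewrite gt_eqF.
have cU := cont 1 0; have cV := cont 0 1; rewrite eqU in cU; rewrite eqV in cV.
have U_gt0 x : a <= x < b -> 0 < U x.
  move=> /andP[ax xb]; rewrite ltNge; apply/negP => Ux.
  have sub : `[a, x] `<=` `[a, b] by apply: subset_itvl; rewrite bnd_simp ltW.
  have [c cax Uc] : exists2 c, c \in `[a, x] & U c = 0.
    apply: IVT => //; first exact: continuous_subspaceW cU.
    by rewrite ge_min Ux orbT le_max ltW.
  have : c = b.
    by apply: (one_zero 1 0 a); rewrite ?mul0r ?addr0 ?mul1r //; exact: sub.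
  by move: cax; rewrite in_itv /= => /andP[_ cx] cb; move: xb; rewrite -cb ltNge cx.
have V_gt0 x : a < x <= b -> 0 < V x.
  move=> /andP[ax xb]; rewrite ltNge; apply/negP => Vx.
  have sub : `[x, b] `<=` `[a, b] by apply: subset_itvr; rewrite bnd_simp ltW.
  have [c cxb Vc] : exists2 c, c \in `[x, b] & V c = 0.
    apply: IVT => //; first exact: continuous_subspaceW cV.
    by rewrite ge_min Vx le_max (ltW Vb) orbT.
  have : c = a.
    by apply: (one_zero 0 1 b); rewrite ?mul0r ?add0r ?mul1r //; exact: sub.
  by move: cxb; rewrite in_itv /= => /andP[xc _] ca; move: ax; rewrite -ca ltNge xc.
split => // x y ax xy yb.
rewrite ltNge; apply/negP => h.
(* the combination of U and V that vanishes at y and is positive at a *)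
pose H z := V y * U z + (- U y) * V z.
have Vy : 0 < V y by apply: V_gt0; rewrite (le_lt_trans ax) //= ltW.
have sub : `[a, x] `<=` `[a, b] by apply: subset_itvl; rewrite bnd_simp ltW // (lt_trans xy).
have Ha : 0 < H a by rewrite /H Va mulr0 addr0 mulr_gt0.
have Hx : H x <= 0 by rewrite /H; lra.
have Hy : H y = 0 by rewrite /H; ring.
have [c cax Hc] : exists2 c, c \in `[a, x] & H c = 0.
  apply: IVT => //; first exact: continuous_subspaceW (cont _ _).
  by rewrite ge_min Hx orbT le_max ltW.
have cy : c = y.
  apply: (one_zero (V y) (- U y) a) => //; first exact: sub.
  by rewrite in_itv /= (le_trans ax (ltW xy)) ltW.
by move: cax; rewrite cy in_itv /= => /andP[_]; rewrite leNgt xy.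
Qed.

(** Derivatives restrict to subintervals, hence the space of a coarse knot interval
    restricts into the space of each fine interval that it contains. *)
Lemma generator_pair_restrict p a b c d u v u' v' : a < b -> c < d ->
  `[c, d] `<=` `[a, b] ->
  admissible_pair p a b u v -> admissible_pair p c d u' v' ->
  (forall x, `[c, d]%classic x -> u x = u' x) -> (forall x, `[c, d]%classic x -> v x = v' x) ->
  let UV := generator_pair p a b u v in let UV' := generator_pair p c d u' v' in
  forall h, h = UV.1 \/ h = UV.2 ->
  exists al be, forall x, c <= x <= d -> h x = al * UV'.1 x + be * UV'.2 x.
Proof.
move=> ab cd sub adm adm' uu vv UV UV' h hUV.
have [f [g [du dv _]]] := adm.
have hspan : span2 `[a, b] UV.1 UV.2 h.
  case: hUV => ->; [exists 1, 0|exists 0, 1] => x _; rewrite mul1r mul0r ?addr0 ?add0r //.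
rewrite (generator_pair_span ab adm du dv) in hspan.
have := span2_sub sub hspan.
rewrite -(generator_pair_span cd adm' (Ck_derivative_on_sub sub uu du)
  (Ck_derivative_on_sub sub vv dv)) => -[al [be E]].
by exists al, be => x xcd; apply: E; rewrite /= in_itv.
Qed.

End Generators.

(** * Local splines and the keys of local index vectors *)

Lemma eq_spl (R : realType) (xi xi' : nat -> R) (U V U' V' : nat -> R -> R) m i i' :
  (forall k, (k <= m.+2)%N -> xi (i + k)%N = xi' (i' + k)%N) ->
  (forall k, (k < m.+2)%N -> U (i + k)%N = U' (i' + k)%N /\ V (i + k)%N = V' (i' + k)%N) ->
  spl xi U V m i = spl xi' U' V' m i'.
Proof.
elim: m i i' => [|m IH] i i' hxi hUV /=.
  have := hxi 0%N isT; have := hxi 1%N isT; have := hxi 2%N isT.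
  have [_] := hUV 0%N isT; have [+ _] := hUV 1%N isT.
  rewrite !addn0 !addn1 !addn2 => -> -> e2 e1 e0.
  by apply/funext => x; rewrite e0 e1 e2.
rewrite (IH i i'); last 2 first.
- by move=> k kn; apply: hxi; lia.
- by move=> k kn; apply: hUV; lia.
rewrite (IH i.+1 i'.+1); last 2 first.
- by move=> k kn; rewrite !addSnnS; apply: hxi; lia.
- by move=> k kn; rewrite !addSnnS; apply: hUV; lia.
by apply/funext => x; rewrite !addSnnS !hxi.
Qed.

Lemma gbN_spl (R : realType) p (l : seq R) (u v : seq (R -> R)) m i :
  gbN p l u v m i = spl (nth 0 l) (genU p l u v) (genV p l u v) m i.
Proof. by elim: m i => [//|m IH] i /=; rewrite !IH. Qed.

Section Univariate.
Variables (R : realType) (p n : nat) (s : 'I_n -> R) (us vs : 'I_n -> R -> R).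
Implicit Types I J : seq 'I_n.

Definition full_knots : seq R := map s (enum 'I_n).

Definition key_knot (b : bool) I : R :=
  if b then head 0 (local_knots s I) else last 0 (local_knots s I).

Definition key_pred (b : bool) (y : R) : pred R :=
  if b then at_most y else below y.

(** The key of [min_key] (if b holds) or [max_key], computed from the lists of
    knots. *)
Definition knot_key (b : bool) I : nat :=
  (count (key_pred b (key_knot b I)) full_knots
   - count (key_pred b (key_knot b I)) (local_knots s I))%N.

Hypothesis s_le : forall i j : 'I_n, (i <= j)%N -> s i <= s j.

Section Window.
Variable I : seq 'I_n.
Hypothesis sub_I : subseq I (enum 'I_n).
Hypothesis size_I : size I = p.+1.

Lemma nth_window_lt d i j : (i < j)%N -> (j < p.+1)%N -> (nth d I i < nth d I j)%N.
Proof.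
move=> ij jp; have ip := ltn_trans ij jp.
have sI : sorted ltn (map val I).
  apply: (subseq_sorted ltn_trans (s2 := iota 0 n)); last exact: iota_ltn_sorted.
  by rewrite -val_enum_ord; exact: map_subseq.
have := sorted_ltn_nth ltn_trans 0%N sI.
move=> /(_ i j); rewrite !inE !size_map size_I => /(_ ip jp ij).
by rewrite !(nth_map d) ?size_I.
Qed.

Lemma s_nth_window d i j : (i <= j)%N -> (j < p.+1)%N -> s (nth d I i) <= s (nth d I j).
Proof.
rewrite leq_eqVlt => /predU1P[->//|ij] jp; apply: s_le; apply: ltnW.
exact: nth_window_lt.
Qed.

Lemma local_knots_subseq : subseq (local_knots s I) full_knots.
Proof. exact: map_subseq. Qed.

Lemma mem_local_knots y : y \in local_knots s I ->
  key_knot true I <= y <= key_knot false I.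
Proof.
move=> /(nthP 0)[i]; rewrite size_map size_I => ip <-.
case: I size_I s_nth_window => [//|i0 J] size_J H.
have iJ : (i < size (i0 :: J))%N by rewrite size_J.
have lE : key_knot false (i0 :: J) = s (nth i0 (i0 :: J) p).
  rewrite /key_knot /local_knots /= last_map (last_nth i0).
  by case: size_J => ->.
rewrite lE (nth_map i0) // /key_knot /=.
rewrite (H i0 0%N i) //= H //; move: ip; lia.
Qed.

Lemma key_knot_mem b : key_knot b I \in local_knots s I.
Proof.
case: I size_I => [//|i0 J] _; rewrite /key_knot /local_knots /=.
by case: b; [exact: mem_head|exact: mem_last].
Qed.

End Window.

(** If the extreme knots differ, the number of fine knots up to the smaller one
    separates the keys.  If they agree, the keys differ by the difference of the
    multiplicities. *)
Lemma knot_key_inj b I1 I2 : subseq I1 (enum 'I_n) -> subseq I2 (enum 'I_n) ->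
  size I1 = p.+1 -> size I2 = p.+1 -> knot_key b I1 = knot_key b I2 ->
  key_knot b I1 = key_knot b I2 /\
  count_mem (key_knot b I1) (local_knots s I1) =
  count_mem (key_knot b I2) (local_knots s I2).
Proof.
have wlog_lt J1 J2 : subseq J1 (enum 'I_n) -> subseq J2 (enum 'I_n) ->
    size J1 = p.+1 -> size J2 = p.+1 -> key_knot b J1 < key_knot b J2 ->
    (knot_key b J1 < knot_key b J2)%N.
  move=> u1 u2 z1 z2 lt12.
  have m1 := mem_local_knots u1 z1; have m2 := mem_local_knots u2 z2.
  have k1 := key_knot_mem z1 b; have k2 := key_knot_mem z2 b.
  have c1 := fun P => leq_count_subseq P (local_knots_subseq u1).
  have c2 := fun P => leq_count_subseq P (local_knots_subseq u2).
  rewrite /knot_key; move: m1 m2 k1 k2 lt12; case: b; rewrite /key_pred.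
    set x1 := key_knot true J1; set x2 := key_knot true J2 => m1 m2 k1 k2 x12.
    pose between : pred R := fun y => (x1 < y) && at_most x2 y.
    have e1 : count (at_most x2) full_knots = (count (at_most x1) full_knots +
        count between full_knots)%N.
      rewrite -count_predUI [X in (_ + X)%N](_ : _ = 0%N) ?addn0; last first.
        rewrite -[RHS](count_pred0 full_knots); apply: eq_count => y /=.
        by rewrite /between /at_most; case: ltP => //=; rewrite ?andbF.
      apply: eq_count => y /=; rewrite /between /at_most; case: (ltP x1 y) => //= h.
      by rewrite (le_trans h) // ltW.
    have e2 : count between (local_knots s J2) =
       count (at_most x2) (local_knots s J2).
      apply: eq_in_count => y /m2 /andP[h _] /=.
      by rewrite /between (lt_le_trans x12 h).
    have h0 : (0 < count (at_most x1) (local_knots s J1))%N.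
      by rewrite -has_count; apply/hasP; exists x1; rewrite /at_most //=.
    move: (c1 (at_most x1)) (c2 between) h0; rewrite e2 e1.
    set a1 := count (at_most x1) (local_knots s J1); set a2 := count (at_most x2) _.
    by set a3 := count (at_most x1) _; set a4 := count between _; lia.
  set x1 := key_knot false J1; set x2 := key_knot false J2 => m1 m2 k1 k2 x12.
  have e1 : (count (below x1) full_knots + count_mem x1 full_knots
      <= count (below x2) full_knots)%N.
    rewrite -count_predUI [X in (_ + X)%N](_ : _ = 0%N) ?addn0; last first.
      rewrite -[RHS](count_pred0 full_knots); apply: eq_count => y /=.
      by rewrite /below; case: eqP => [->|]; rewrite ?ltxx ?andbF.
    apply: sub_count => y /=; rewrite /below => /orP[/lt_trans|/eqP ->]; auto.
  have e2 : (count (below x1) (local_knots s J1) + count_mem x1 (local_knots s J1) = p.+1)%N.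
    rewrite -count_predUI [X in (_ + X)%N](_ : _ = 0%N) ?addn0; last first.
      rewrite -[RHS](count_pred0 (local_knots s J1)); apply: eq_count => y /=.
      by rewrite /below; case: eqP => [->|]; rewrite ?ltxx ?andbF.
    rewrite -z1 -[RHS](size_map s); apply/eqP; rewrite -all_count; apply/allP => y /m1 /andP[_].
    by rewrite /= /below le_eqVlt orbC.
  have h2 : (count (below x2) (local_knots s J2) <= p)%N.
    rewrite -ltnS -z2 -[X in (_ < X)%N](size_map s) -(count_predC (below x2)).
    rewrite -[X in (X < _)%N]addn0 ltn_add2l -has_count; apply/hasP; exists x2 => //.
    by rewrite /= /below ltxx.
  have h1 : (0 < count_mem x1 (local_knots s J1))%N.
    by rewrite -has_count; apply/hasP; exists x1 => /=.
  move: e1 e2 h1 h2 (c1 (below x1)) (c1 (pred1 x1)) (c2 (below x2)).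
  set a1 := count (below x1) full_knots; set a2 := count (below x2) full_knots.
  set a3 := count_mem x1 full_knots; set a4 := count (below x1) _.
  by set a5 := count_mem x1 _; set a6 := count (below x2) _; lia.
move=> u1 u2 z1 z2 E.
have [lt12|lt12|eq12] := ltgtP (key_knot b I1) (key_knot b I2).
- by have := wlog_lt _ _ u1 u2 z1 z2 lt12; rewrite E ltnn.
- by have := wlog_lt _ _ u2 u1 z2 z1 lt12; rewrite E ltnn.
split => //.
have c1 := fun P => leq_count_subseq P (local_knots_subseq u1).
have c2 := fun P => leq_count_subseq P (local_knots_subseq u2).
have m1 := mem_local_knots u1 z1; have m2 := mem_local_knots u2 z2.
move: E m1 m2 eq12; rewrite /knot_key; case: b {wlog_lt} => E m1 m2 eq12.
  have e J : (forall y, y \in local_knots s J -> key_knot true J <= y <= key_knot false J) ->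
     count_mem (key_knot true J) (local_knots s J) = count (at_most (key_knot true J)) (local_knots s J).
    by move=> mJ; apply: eq_in_count => y /mJ /andP[h _]; rewrite /= /at_most eq_le h andbT.
  rewrite !e //; move: E; rewrite /key_pred -eq12.
  move: (c1 (at_most (key_knot true I1))) (c2 (at_most (key_knot true I1))).
  set a1 := count _ full_knots; set a2 := count _ (local_knots s I1).
  by set a3 := count _ (local_knots s I2); lia.
have e J : (forall y, y \in local_knots s J -> key_knot true J <= y <= key_knot false J) ->
   size J = (count_mem (key_knot false J) (local_knots s J) + count (below (key_knot false J)) (local_knots s J))%N.
  move=> mJ; rewrite -(size_map s) -(count_predC (pred1 (key_knot false J))); congr (_ + _)%N.
  by apply: eq_in_count => y /mJ /andP[_ h]; rewrite /= /below lt_neqAle h andbT.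
move: E (e _ m1) (e _ m2) (c1 (below (key_knot false I1))) (c2 (below (key_knot false I1))).
rewrite z1 z2 /key_pred -eq12; set a1 := count _ full_knots; set k := key_knot false I1.
set a2 := count (below k) (local_knots s I1); set a3 := count (below k) (local_knots s I2).
by set a4 := count _ (local_knots s I1); set a5 := count _ (local_knots s I2); lia.
Qed.

End Univariate.

(** * Expansion of a local spline *)

Section UnivariateInsertion.
Variables (R : realType) (m n : nat).
Local Notation p := m.+2.
Variables (s : 'I_n -> R) (us vs : 'I_n -> R -> R).
Hypothesis hs : knot_vector p s.
Hypothesis huv : function_vectors p s us vs.

Lemma local_gb_spline_spl d (I : seq 'I_n) (xi : nat -> R) U V i :
  size I = p.+1 ->
  (forall k, (k <= p)%N -> xi (i + k)%N = s (nth d I k)) ->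
  (forall k, (k < p)%N -> (U (i + k)%N, V (i + k)%N) =
     generator_pair p (xi (i + k)%N) (xi (i + k).+1)
       (us (nth d I k)) (vs (nth d I k))) ->
  local_gb_spline p s us vs I = spl xi U V m i.
Proof.
move=> szI hxi hUV; rewrite /local_gb_spline /gb_spline gbN_spl !subSS subn0 szI /=.
have szJ : size (take p I) = p by rewrite size_takel // szI.
have knotE k : (k <= p)%N -> (local_knots s I)`_k = xi (i + k)%N.
  by move=> kp; rewrite (nth_map d) ?szI // hxi.
have funE (f : 'I_n -> R -> R) k : (k < p)%N -> nth (cst 0) (map f (take p I)) k = f (nth d I k).
  by move=> kp; rewrite (nth_map d) ?szJ // nth_take.
apply: eq_spl => k kp; rewrite add0n ?knotE //.
rewrite /genU /genV !funE // !knotE ?addnS //; last exact: ltnW.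
by rewrite -hUV.
Qed.

(** The list of knots of a direction is prolonged by repeating the last knot, which
    only adds empty intervals.  The p + 1 indices in I are prolonged by consecutive
    ones, so that the coarse intervals added in this way are fine intervals. *)
Theorem univariate_insertion b (J : seq 'I_n) a (I := take p.+1 (drop a J)) :
  subseq J (enum 'I_n) -> size I = p.+1 -> insertion_compatible p s us vs J ->
  exists2 c : nat -> R,
    forall x, local_gb_spline p s us vs I x =
      \sum_(k < n - p) c k *
        local_gb_spline p s us vs (take p.+1 (drop k (enum 'I_n))) x
  & extreme b (n - p) (knot_key s b I) c.
Proof.
move=> subJ szI compat; case: (hs) => s_le s_mult.
have subI : subseq I (enum 'I_n).
  by apply: subseq_trans subJ; apply: subseq_trans (take_subseq _ _) (drop_subseq _ _).
have n0 : (0 < n)%N.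
  by rewrite -(size_enum_ord n); apply: leq_trans (size_subseq subI); rewrite szI.
have n1 : (n.-1 < n)%N by rewrite ltn_predL.
pose last_ord : 'I_n := Ordinal n1.
pose ord k := insubd last_ord k.
have ordE k : (k < n)%N -> ord k = k :> nat by move=> kn; rewrite /ord val_insubd kn.
have ordK (i : 'I_n) : ord i = i by exact: valKd.
have ord_last k : (n <= k)%N -> ord k = n.-1 :> nat.
  by move=> kn; rewrite /ord val_insubd ltnNge kn.
pose xi k := s (ord k).
have xi_le i j : (i <= j)%N -> xi i <= xi j.
  move=> ij; apply: s_le; have [jn|jn] := ltnP j n.
    by rewrite !ordE //; exact: leq_ltn_trans jn.
  by rewrite (ord_last j) //; have := ltn_ord (ord i); lia.
pose nthI := nth last_ord I.
have szJ : (a + p.+1 <= size J)%N.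
  move: szI; rewrite /I size_take size_drop; case: ltnP => h h'; lia.
have nthIE j : (j < p.+1)%N -> nthI j = nth last_ord J (a + j).
  by move=> jp; rewrite /nthI /I nth_take // nth_drop.
pose phi j := if (j <= p)%N then val (nthI j) else (nthI p + (j - p))%N.
have nthI_lt i j : (i < j)%N -> (j < p.+1)%N -> (nthI i < nthI j)%N.
  exact: (nth_window_lt subI szI).
have phi_lt j : (phi j < phi j.+1)%N.
  rewrite /phi; have [jp|jp|->] := ltngtP j p.
  - exact: nthI_lt.
  - by lia.
  - by rewrite /=; lia.
have phi_n j : (j <= p)%N -> (phi j < n)%N by move=> jp; rewrite /phi jp; exact: ltn_ord.
have ord_phi j : (j <= p)%N -> ord (phi j) = nthI j by move=> jp; rewrite /phi jp ordK.
pose gen k l := generator_pair p (xi k) (xi l) (us (ord k)) (vs (ord k)).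
pose U k := (gen k k.+1).1; pose V k := (gen k k.+1).2.
pose Uc j := (gen (phi j) (phi j.+1)).1; pose Vc j := (gen (phi j) (phi j.+1)).2.
have adm k : xi k < xi k.+1 ->
    admissible_pair p (xi k) (xi k.+1) (us (ord k)) (vs (ord k)).
  move=> h; apply: huv (h); have [kn|kn] := ltnP k.+1 n.
    by rewrite !ordE //; exact: ltnW.
  have E : ord k = ord k.+1.
    apply: val_inj; rewrite /= (ord_last k.+1) //.
    by case: (ltnP k n) => kn'; [rewrite ordE //; lia|exact: ord_last].
  by move: h; rewrite /xi E ltxx.
have admc j : (xi \o phi) j < (xi \o phi) j.+1 ->
    admissible_pair p (xi (phi j)) (xi (phi j.+1)) (us (ord (phi j))) (vs (ord (phi j))) /\
    (forall k x, (phi j <= k < phi j.+1)%N -> xi (phi j) <= x <= xi (phi j.+1) ->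
       us (ord (phi j)) x = us (ord k) x /\ vs (ord (phi j)) x = vs (ord k) x).
  move=> /= h; have [jp|pj] := ltnP j p; last first.
    have phiS : phi j.+1 = (phi j).+1.
      by rewrite /phi (leqNgt j.+1) ltnS pj /=; case: (ltngtP j p) pj => [//|h' _|-> _] /=; lia.
    rewrite phiS in h *; split; first exact: adm.
    by move=> k x hk _; have -> : k = phi j by lia.
  have inJ i : (i <= p)%N -> nthI i \in J.
    by move=> ip; rewrite nthIE // mem_nth //; apply: leq_trans szJ; rewrite ltn_add2l.
  have [|||k kJ||] := compat (nthI j) (nthI j.+1).
  - by apply: inJ; exact: ltnW.
  - exact: inJ.
  - exact: nthI_lt.
  - apply: contraTN kJ => /andP[h1 h2]; apply/negP => /(nthP last_ord)[l lJ lE].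
    have sJ : sorted ltn (map val J).
      apply: (subseq_sorted ltn_trans (s2 := iota 0 n)); last exact: iota_ltn_sorted.
      by rewrite -val_enum_ord; exact: map_subseq.
    have mono i i' : (i < size J)%N -> (i' < size J)%N ->
        (nth last_ord J i < nth last_ord J i')%N -> (i < i')%N.
      move=> iJ iJ' lt; rewrite ltnNge leq_eqVlt; apply/negP => /predU1P[E|ii'].
        by move: lt; rewrite E ltnn.
      have := sorted_ltn_nth ltn_trans 0%N sJ.
      move=> /(_ i' i); rewrite !inE !size_map => /(_ iJ' iJ ii').
      by rewrite !(nth_map last_ord) //= => /(ltn_trans lt); rewrite ltnn.
    rewrite -lE in h1 h2; rewrite !nthIE // in h1 h2; last exact: ltnW.
    have := mono _ _ _ lJ h1; have := mono _ _ lJ _ h2.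
    by rewrite addnS; lia.
  - by rewrite -!ord_phi // ltnW.
  rewrite -!ord_phi //; last exact: ltnW.
  move=> A B; split => // k x hk xk.
  have kn : (k < n)%N.
    by case/andP: hk => _ h2; apply: ltn_trans h2 _; exact: phi_n.
  have [|B1 B2] := B (ord k); first by rewrite !ordE // phi_n // ltnW.
  by rewrite B1 ?B2 // in_itv.
have goodUV k : xi k < xi k.+1 -> good_pair (xi k) (xi k.+1) (U k) (V k).
  by move=> h; apply: generator_pair_good => //; exact: adm.
have goodUVc j : (xi \o phi) j < (xi \o phi) j.+1 ->
    good_pair ((xi \o phi) j) ((xi \o phi) j.+1) (Uc j) (Vc j).
  by move=> h; apply: generator_pair_good => //; have [] := admc j h.
have spanUVc j k : (phi j <= k < phi j.+1)%N -> xi k < xi k.+1 ->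
    forall f, f = Uc j \/ f = Vc j ->
    exists al be, forall x, xi k <= x <= xi k.+1 -> f x = al * U k x + be * V k x.
  move=> hk h; have /andP[k1 k2] := hk.
  have le1 : xi (phi j) <= xi k by exact: xi_le.
  have le2 : xi k.+1 <= xi (phi j.+1) by exact: xi_le.
  have hj : (xi \o phi) j < (xi \o phi) j.+1.
    by rewrite /=; apply: le_lt_trans le1 _; apply: lt_le_trans h _.
  have [A B] := admc j hj.
  apply: (generator_pair_restrict (u' := us (ord k)) (v' := vs (ord k)) hj h _ A (adm k h)).
  - by move=> x /=; rewrite !in_itv /= => /andP[x1 x2]; rewrite (le_trans le1) // (le_trans x2).
  - move=> x /=; rewrite in_itv /= => /andP[x1 x2]; have [] // := B k x hk.
    by rewrite (le_trans le1) // (le_trans x2).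
  - move=> x /=; rewrite in_itv /= => /andP[x1 x2]; have [] // := B k x hk.
    by rewrite (le_trans le1) // (le_trans x2).
(* p + 1 equal knots would exceed the multiplicity p *)
have zeta_nontriv : (xi \o phi) 0%N < (xi \o phi) (0 + p)%N.
  rewrite add0n lt_neqAle zeta_le // andbT; apply/negP => /eqP /= E.
  have := s_mult (nthI 0%N).
  have -> : #|[pred j | s j == s (nthI 0%N)]| = count_mem (s (nthI 0%N)) (map s (enum 'I_n)).
    by rewrite count_map -size_filter cardE enumT.
  apply/negP; rewrite -ltnNge.
  have := leq_count_subseq (pred1 (s (nthI 0%N))) (local_knots_subseq s subI).
  rewrite [X in (X <= _)%N](_ : _ = p.+1) //.
  rewrite -szI -[RHS](size_map s); apply/eqP; rewrite -all_count; apply/allP => y.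
  move=> /(nthP 0)[j]; rewrite size_map szI => jp <-.
  rewrite (nth_map last_ord) ?szI //=.
  have e0 : xi (phi 0%N) = s (nthI 0%N) by rewrite /xi ord_phi.
  have ep : xi (phi p) = s (nthI p) by rewrite /xi ord_phi.
  apply/eqP/le_anti; rewrite -{1}e0 E ep.
  by rewrite !(s_nth_window s_le subI szI) //; lia.
have phip : (phi (0 + p)%N < n)%N by rewrite add0n phi_n.
have [c cE cext] := knot_insertion xi_le goodUV phi_lt goodUVc spanUVc b phip zeta_nontriv.
exists c.
  move=> x; rewrite (@local_gb_spline_spl last_ord I (xi \o phi) Uc Vc 0) //; last 2 first.
  - by move=> k kp; rewrite /= add0n /xi ord_phi.
  - by move=> k kp; rewrite /Uc /Vc /gen add0n -surjective_pairing ord_phi // ltnW.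
  rewrite cE; apply: eq_bigr => k _; congr (_ * _).
  have kn := ltn_ord k.
  have nthk l : (l <= p)%N -> nth last_ord (take p.+1 (drop k (enum 'I_n))) l = ord (k + l)%N.
    move=> lp; rewrite nth_take // nth_drop; apply: val_inj.
    by rewrite /= ordE ?nth_enum_ord //; lia.
  rewrite (@local_gb_spline_spl last_ord _ xi U V k) //.
  - by rewrite size_takel // size_drop size_enum_ord; lia.
  - by move=> l lp; rewrite nthk.
  - by move=> l lp; rewrite /U /V /gen -surjective_pairing nthk // ltnW.
suff -> : knot_key s b I = extreme_key xi phi n b m 0 by [].
have fullE (P : pred R) : count (P \o xi) (iota 0 n) = count P (full_knots s).
  rewrite -val_enum_ord /full_knots !count_map; apply: eq_count => i /=.
  by rewrite /xi ordK.
have localE (P : pred R) : count (P \o (xi \o phi)) (iota 0 m.+3) = count P (local_knots s I).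
  rewrite -count_map; congr (count _ _).
  apply: (@eq_from_nth _ 0); rewrite !size_map ?size_iota ?szI // => i ip.
  by rewrite (nth_map 0%N) ?size_iota // (nth_map last_ord) ?szI // nth_iota //= /xi ord_phi.
have e0 : xi (phi 0%N) = key_knot s true I.
  rewrite /xi ord_phi // /key_knot /nthI; case: (I) szI => [//|i0 I'] _ //=.
have ep : xi (phi p) = key_knot s false I.
  rewrite /xi ord_phi // /key_knot /nthI /local_knots; case: (I) szI => [//|i0 I'] [szI'].
  by rewrite /= last_map (last_nth last_ord) /= szI'.
rewrite /extreme_key /knot_key /min_key /max_key /key !fullE !localE add0n /= e0 ep.
by case: (b).
Qed.

End UnivariateInsertion.

(** * Grid coordinates and windows *)

Section Grid.
Variables (R : realType) (o n : nat).
Local Notation idx := 'I_(n + o./2.*2).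
Local Notation coord := (@grid_coord R o n).
Implicit Types (i j l : idx) (a : idx * idx).

Lemma natr_lt1 (k l : nat) : (k < l)%N -> k%:R + 1 <= l%:R :> R.
Proof. by move=> kl; rewrite natr1 ler_nat. Qed.

Lemma coord_le i j : (coord i <= coord j) = (i <= j)%N.
Proof. by rewrite /grid_coord lerD2r lerD2r ler_nat. Qed.

Lemma coord_lt i j : (coord i < coord j) = (i < j)%N.
Proof. by rewrite /grid_coord ltrD2r ltrD2r ltr_nat. Qed.

Lemma coord_inj i j : coord i = coord j -> i = j.
Proof. by move=> E; apply/val_inj/eqP; rewrite eqn_leq -!coord_le E lexx. Qed.

Lemma coord_lt1 i j : (i < j)%N -> coord i + 1 <= coord j.
Proof. by move=> /natr_lt1; rewrite /grid_coord; lra. Qed.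

(** Coordinates are integers up to a common shift; adding 1 / 2 to one of them
    gives a point that lies strictly between two consecutive grid lines. *)
Lemma coord_half i j : coord i + 1 / 2 <> coord j.
Proof.
move=> E; have [ij|ji] := ltnP i j; first by have := coord_lt1 ij; lra.
by move: ji; rewrite -coord_le; lra.
Qed.

Lemma coord_half_lt i j : (coord i < coord j + 1 / 2) = (i <= j)%N.
Proof.
have [ij|ji] := leqP i j; first by move: ij; rewrite -coord_le; lra.
by apply/negbTE; rewrite -leNgt; have := coord_lt1 ji; lra.
Qed.

Lemma coord_half_gt i j : (coord j + 1 / 2 < coord i) = (j < i)%N.
Proof.
have [ij|ji] := leqP i j; last by have := coord_lt1 ji; lra.
by apply/negbTE; rewrite -leNgt; move: ij; rewrite -coord_le; lra.
Qed.

Lemma coord_ge1 i : (1 <= coord i) = (o./2 <= i)%N.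
Proof. by rewrite /grid_coord lerDr subr_ge0 ler_nat. Qed.

Lemma coord_le1 i : (coord i <= 1) = (i <= o./2)%N.
Proof. by rewrite /grid_coord gerDr subr_le0 ler_nat. Qed.

Lemma coord_len i : (coord i <= n%:R) = (i < n + o./2)%N.
Proof. by rewrite /grid_coord addrAC lerBlDr natr1 -natrD ler_nat. Qed.

Lemma coord_gen i : (n%:R <= coord i) = (n + o./2 <= i.+1)%N.
Proof. by rewrite /grid_coord addrAC lerBrDr natr1 -natrD ler_nat. Qed.

Lemma coord_extent i : (extent o n : set R) (coord i).
Proof.
rewrite /extent /= in_itv /= /grid_coord; have := ltn_ord i; move: (nat_of_ord i) => k.
rewrite -addnn addnA => /natr_lt1; rewrite !natrD; have : 0 <= k%:R :> R by []; lra.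
Qed.

Lemma side_coord i : (side (i, i) : set R) (coord i).
Proof. by rewrite /side /= eqxx. Qed.

Lemma side_diag i x : (side (i, i) : set R) x -> x = coord i.
Proof. by rewrite /side /= eqxx. Qed.

Lemma side_open a x : (a.1 < a.2)%N -> (side a : set R) x <-> coord a.1 < x < coord a.2.
Proof.
by move=> h; rewrite /side /= ifF //; apply/negbTE/eqP => E; rewrite E ltnn in h.
Qed.

Lemma side_mid a : (a.1 < a.2)%N -> (side a : set R) (coord a.1 + 1 / 2).
Proof. by move=> h; apply/(side_open _ h); rewrite coord_half_lt coord_half_gt leqnn. Qed.

Lemma side_nonempty a : (a.1 <= a.2)%N -> exists x, (side a : set R) x.
Proof.
rewrite leq_eqVlt => /predU1P[/val_inj|h]; last by exists (coord a.1 + 1 / 2); exact: side_mid.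
by case: a => i j /= ->; exists (coord j); exact: side_coord.
Qed.

Lemma side_closed a x : (a.1 <= a.2)%N -> (side a : set R) x -> coord a.1 <= x <= coord a.2.
Proof.
rewrite leq_eqVlt => /predU1P[/val_inj|h].
  by case: a => i j /= -> /side_diag ->; rewrite lexx.
by move=> /(side_open _ h) /andP[h1 h2]; rewrite !ltW.
Qed.

Lemma side_activeP a : (a.1 <= a.2)%N ->
  ((side a : set R) `<=` `[1, n%:R]) <-> (o./2 <= a.1)%N /\ (a.2 < n + o./2)%N.
Proof.
move=> le12; split => [|[h1 h2] x /(side_closed le12) /andP[x1 x2]]; last first.
  rewrite /= in_itv /=; rewrite -coord_ge1 in h1; rewrite -coord_len in h2.
  by rewrite (le_trans h1) // (le_trans x2).
move: le12; rewrite leq_eqVlt => /predU1P[/val_inj|h] sub.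
  case: a sub => i j /= E; subst j => sub.
  by have := sub _ (side_coord i); rewrite /= in_itv /= coord_ge1 coord_len => /andP.
have := sub _ (side_mid h); rewrite /= in_itv /= => /andP[h1 _]; split.
  rewrite leqNgt; apply/negP => /natr_lt1; move: h1; rewrite /grid_coord; lra.
have : (side a : set R) (coord a.2 - 1 / 2).
  by apply/(side_open _ h); have := coord_lt1 h; lra.
move=> /sub; rewrite /= in_itv /= => /andP[_ h2].
rewrite ltnNge; apply/negP; rewrite -(ler_nat R) natrD; move: h2; rewrite /grid_coord; lra.
Qed.

(** At least o / 2 outer indices precede i in the index vector.  After i there are
    at least o / 2 + 1 outer ones if o is odd, and o / 2 if o is even, when i itself
    may be an outer index. *)
Lemma size_window (P : pred idx) i :
  (forall l, (l <= o./2)%N || (n + o./2 <= l.+1)%N -> P l) ->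
  P i -> (o./2 <= i)%N -> (i + odd o < n + o./2)%N ->
  size (window o [seq l <- enum idx | P l] i) = o.+1.
Proof.
move=> Pout Pi oi io; have iN := ltn_ord i.
have enumE : enum idx = take i (enum idx) ++ i :: drop i.+1 (enum idx).
  rewrite -{1}(cat_take_drop i (enum idx)) (drop_nth i) ?size_enum_ord //.
  by rewrite nth_ord_enum.
have szI := size_enum_ord (n + o./2.*2).
have itake : i \notin take i (enum idx).
  rewrite -has_pred1 has_take_leq ?szI ?(ltnW iN) // -leqNgt.
  by rewrite -[find _ _]/(index i (enum idx)) index_enum_ord.
set I := seq.filter P (enum idx).
have IE : I = seq.filter P (take i (enum idx)) ++ i :: seq.filter P (drop i.+1 (enum idx)).
  by rewrite /I enumE filter_cat /= Pi -enumE.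
have idxI : index i I = count P (take i (enum idx)).
  rewrite IE index_cat mem_filter (negbTE itake) andbF /= eqxx addn0.
  by rewrite size_filter.
have c1 : (o./2 <= count P (take i (enum idx)))%N.
  have ti : take i (enum idx) = take o./2 (enum idx) ++ drop o./2 (take i (enum idx)).
    by rewrite -{1}(cat_take_drop o./2 (take i (enum idx))) take_takel.
  rewrite ti count_cat; apply: leq_trans (leq_addr _ _).
  have szt : size (take o./2 (enum idx)) = o./2 by rewrite size_takel // szI; lia.
  rewrite -[X in (X <= _)%N]szt -[X in (X <= _)%N](count_predT) leq_eqVlt; apply/orP; left.
  apply/eqP/eq_in_count => l /(nthP i)[k]; rewrite szt => ko <-.
  by rewrite nth_take //= Pout // nth_enum_ord ?(ltnW ko) //; lia.
have c2 : (o./2 + odd o <= count P (drop i.+1 (enum idx)))%N.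
  set e := (n + o./2 - odd o)%N.
  have de : drop i.+1 (enum idx) = take (e - i.+1) (drop i.+1 (enum idx)) ++ drop e (enum idx).
    rewrite -{1}(cat_take_drop (e - i.+1) (drop i.+1 (enum idx))) drop_drop subnK //.
    by rewrite /e; lia.
  rewrite de count_cat; apply: leq_trans (leq_addl _ _).
  have szd : size (drop e (enum idx)) = (o./2 + odd o)%N.
    by rewrite size_drop szI /e -addnn; lia.
  rewrite -[X in (X <= _)%N]szd -[X in (X <= _)%N](count_predT) leq_eqVlt; apply/orP; left.
  apply/eqP/eq_in_count => l /(nthP i)[k]; rewrite szd => ko <-.
  rewrite nth_drop /= Pout // nth_enum_ord; last by rewrite /e -addnn; lia.
  by apply/orP; right; rewrite /e; lia.
have szI' : size I = (count P (take i (enum idx)) + (count P (drop i.+1 (enum idx))).+1)%N.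
  by rewrite IE size_cat /= !size_filter.
rewrite /window -/I size_takel // size_drop idxI szI'.
move: c1 c2; set a := count _ _; set b := count _ _.
by have := odd_double_half o; rewrite -addnn; lia.
Qed.

End Grid.

(** * Index vectors of an admissible mesh *)

Section Mesh.
Variables (R : realType) (p q mu nu : nat).
Variable M : {set box p q mu nu}.
Implicit Types (A c e : box p q mu nu) (i : idx p mu) (j : idx q nu).

Local Notation coordp := (@grid_coord R p mu).
Local Notation coordq := (@grid_coord R q nu).
Local Notation vS := (@vS R p q mu nu M).
Local Notation hS := (@hS R p q mu nu M).

Lemma verticesP A : A \in vertices M -> exists i j, A = vtx i j.
Proof. by case/imsetP => w _ ->; exists w.1, w.2. Qed.

Lemma vtx_in i j c : c \in M -> (i == c.1.1) || (i == c.1.2) ->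
  (j == c.2.1) || (j == c.2.2) -> vtx i j \in vertices M.
Proof.
move=> cM hi hj; apply/imsetP; exists (i, j) => //; rewrite inE /=.
by apply/existsP; exists c; rewrite cM hi hj.
Qed.

Lemma vtx_vS i j : vtx i j \in vertices M -> vS (coordp i, coordq j).
Proof.
move=> h; exists (vtx i j); first by rewrite /= inE h orbT.
by split; exact: side_coord.
Qed.

Lemma vtx_hS i j : vtx i j \in vertices M -> hS (coordp i, coordq j).
Proof.
move=> h; exists (vtx i j); first by rewrite /= inE h orbT.
by split; exact: side_coord.
Qed.

Lemma vedge_vS e x y : e \in vedges R M -> x = coordp e.1.1 ->
  coordq e.2.1 < y < coordq e.2.2 -> vS (x, y).
Proof.
move=> eE -> hy; exists e; first by rewrite /= inE eE.
move: eE; rewrite inE => /and4P[/eqP e1 e2 _ _].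
split; last by apply/side_open.
by move: e1; case: (e) => -[a b] ? /= <-; exact: side_coord.
Qed.

Lemma hedge_hS e x y : e \in hedges R M -> y = coordq e.2.1 ->
  coordp e.1.1 < x < coordp e.1.2 -> hS (x, y).
Proof.
move=> eE -> hx; exists e; first by rewrite /= inE eE.
move: eE; rewrite inE => /and4P[e1 /eqP e2 _ _].
split; first by apply/side_open.
by move: e2; case: (e) => ? [a b] /= <-; exact: side_coord.
Qed.

(** The point just above lies on no horizontal edge and is not a vertex, so the
    mesh contains it only if some vertical edge does.  The closure of this edge
    contains the given point, and its ends are vertices. *)
Lemma meshS_vS i j : meshS M (coordp i, coordq j + 1 / 2) -> vS (coordp i, coordq j).
Proof.
case=> -[A /=]; rewrite inE => /orP[hA|/verticesP[i' [j' ->]]] [/= h1 h2].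
- move: hA; rewrite inE => /and4P[_ /eqP E _ _].
  by move: E h2; case: (A.2) => a b /= -> /side_diag /coord_half.
- by have /coord_half := side_diag h2.
- have := hA; rewrite inE => /and5P[/eqP E lt v1 _ _].
  have ei : coordp i = coordp A.1.1.
    by move: E h1; case: (A.1) => a b /= <- /side_diag.
  have {}ei := coord_inj ei; subst i.
  move/(side_open _ lt): h2; rewrite coord_half_lt coord_half_gt => /andP[le1 lt2].
  move: le1; rewrite leq_eqVlt => /predU1P[/val_inj <-|lt1]; first exact: vtx_vS.
  by apply: (vedge_vS hA) => //; rewrite !coord_lt lt1.
- by have /coord_half := side_diag h2.
Qed.

Lemma meshS_hS i j : meshS M (coordp i + 1 / 2, coordq j) -> hS (coordp i, coordq j).
Proof.
case=> -[A /=]; rewrite inE => /orP[hA|/verticesP[i' [j' ->]]] [/= h1 h2].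
- have := hA; rewrite inE => /and5P[lt /eqP E v1 _ _].
  have ei : coordq j = coordq A.2.1.
    by move: E h2; case: (A.2) => a b /= <- /side_diag.
  have {}ei := coord_inj ei; subst j.
  move/(side_open _ lt): h1; rewrite coord_half_lt coord_half_gt => /andP[le1 lt2].
  move: le1; rewrite leq_eqVlt => /predU1P[/val_inj <-|lt1]; first exact: vtx_hS.
  by apply: (hedge_hS hA) => //; rewrite !coord_lt lt1.
- by have /coord_half := side_diag h1.
- move: hA; rewrite inE => /and4P[/eqP E _ _ _].
  by move: E h1; case: (A.1) => a b /= -> /side_diag /coord_half.
- by have /coord_half := side_diag h1.
Qed.

Lemma meshS_cases x y : meshS M (x, y) ->
  (vS (x, y) \/ exists j, y = coordq j) /\ (hS (x, y) \/ exists i, x = coordp i).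
Proof.
case=> -[A /=]; rewrite inE => /orP[hA|/[dup] vA /verticesP[i' [j' EA]]] [/= h1 h2].
- split; last by left; exists A => //=; rewrite inE hA.
  right; exists A.2.1; move: hA; rewrite inE => /and4P[_ /eqP E _ _].
  by move: E h2; case: (A.2) => a b /= <- /side_diag.
- by split; left; exists A => //=; rewrite inE vA orbT.
- split; first by left; exists A => //=; rewrite inE hA.
  right; exists A.1.1; move: hA; rewrite inE => /and4P[/eqP E _ _ _].
  by move: E h1; case: (A.1) => a b /= <- /side_diag.
- by split; left; exists A => //=; rewrite inE vA orbT.
Qed.

Hypothesis cells : forall c, c \in M -> (c.1.1 < c.1.2)%N /\ (c.2.1 < c.2.2)%N.

Lemma anchor_sides A : A \in anchors R M ->
  [/\ (A.1.1 <= A.1.2)%N, (A.1.1 < A.1.2)%N = odd p,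
      (A.2.1 <= A.2.2)%N & (A.2.1 < A.2.2)%N = odd q].
Proof.
rewrite inE => /andP[+ _].
case: (odd p); case: (odd q) => hA.
- by have [h1 h2] := cells hA; rewrite (ltnW h1) (ltnW h2) h1 h2.
- move: hA; rewrite inE => /and4P[h1 /eqP E _ _].
  by rewrite E ltnn leqnn h1 (ltnW h1).
- move: hA; rewrite inE => /and4P[/eqP E h1 _ _].
  by rewrite E ltnn leqnn h1 (ltnW h1).
- by have [i [j ->]] := verticesP hA; rewrite /= !ltnn !leqnn.
Qed.

Lemma anchor_active A : A \in anchors R M ->
  [/\ (p./2 <= A.1.1)%N, (A.1.2 < mu + p./2)%N,
      (q./2 <= A.2.1)%N & (A.2.2 < nu + q./2)%N].
Proof.
move=> hA; have [le1 _ le2 _] := anchor_sides hA.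
move: hA; rewrite inE => /andP[_ /asboolP act].
have [x hx] := side_nonempty R le1; have [y hy] := side_nonempty R le2.
have [|h1 h2] := (side_activeP R le1).1.
  by move=> x' hx'; have [] := act (x', y) (conj hx' hy).
have [|h3 h4] := (side_activeP R le2).1; last by split.
by move=> y' hy'; have [] := act (x, y') (conj hx hy').
Qed.

Hypothesis hM : index_tmesh R M.

(** A cell that meets the left side of another one would overlap it, because it
    extends to the right of that side by at least one unit. *)
Lemma cell_left c y : c \in M -> coordq c.2.1 < y < coordq c.2.2 ->
  skeleton M (coordp c.1.1, y).
Proof.
case: hM => _ disj cover cM hy; have [lt1 lt2] := cells cM.
split.
  rewrite -cover; exists c => //; split => /=; rewrite in_itv /=.
    by rewrite lexx coord_le ltnW.
  by case/andP: hy => h1 h2; rewrite (ltW h1) (ltW h2).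
move=> [d dM [/= dx dy]]; have [dl1 dl2] := cells dM.
have [cd|cd] := eqVneq c d.
  by move/(side_open _ dl1): dx; rewrite cd ltxx.
have := disj c d cM dM cd; apply/eqP/set0P.
exists (coordp c.1.1 + 1 / 2, y); split; split => //=.
- exact: side_mid.
- exact/side_open.
- apply/(side_open _ dl1); move/(side_open _ dl1): dx; rewrite !coord_lt => /andP[h1 h2].
  by rewrite coord_half_lt coord_half_gt h2 ltnW.
Qed.

Lemma cell_bottom c x : c \in M -> coordp c.1.1 < x < coordp c.1.2 ->
  skeleton M (x, coordq c.2.1).
Proof.
case: hM => _ disj cover cM hx; have [lt1 lt2] := cells cM.
split.
  rewrite -cover; exists c => //; split => /=; rewrite in_itv /=; last first.
    by rewrite lexx coord_le ltnW.
  by case/andP: hx => h1 h2; rewrite (ltW h1) (ltW h2).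
move=> [d dM [/= dx dy]]; have [dl1 dl2] := cells dM.
have [cd|cd] := eqVneq c d.
  by move/(side_open _ dl2): dy; rewrite cd ltxx.
have := disj c d cM dM cd; apply/eqP/set0P.
exists (x, coordq c.2.1 + 1 / 2); split; split => //=.
- exact/side_open.
- exact: side_mid.
- apply/(side_open _ dl2); move/(side_open _ dl2): dy; rewrite !coord_lt => /andP[h1 h2].
  by rewrite coord_half_lt coord_half_gt h2 ltnW.
Qed.

(** Such a point lies between two consecutive vertices of the side, or is one, since
    the two ends of the side are vertices. *)
Lemma cell_left_vS c : c \in M -> [set coordp c.1.1] `*` side c.2 `<=` vS.
Proof.
move=> cM [x y] [/= -> hy]; have [_ lt2] := cells cM.
have {}hy : coordq c.2.1 < y < coordq c.2.2 by exact/side_open.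
have /andP[hy1 hy2] := hy.
pose lo k := (vtx c.1.1 k \in vertices M) && (coordq k <= y).
pose hi k := (vtx c.1.1 k \in vertices M) && (y < coordq k).
have lo1 : lo c.2.1 by rewrite /lo (ltW hy1) andbT; apply: (vtx_in cM); rewrite eqxx ?orbT.
have hi2 : hi c.2.2 by rewrite /hi hy2 andbT; apply: (vtx_in cM); rewrite eqxx ?orbT.
case: (arg_maxnP (fun k : idx q nu => k : nat) lo1) => k1 /andP[v1 k1y] k1max.
case: (arg_minnP (fun k : idx q nu => k : nat) hi2) => k2 /andP[v2 yk2] k2min.
move: k1y; rewrite le_eqVlt => /predU1P[<-|k1y]; first exact: vtx_vS.
have k12 : (k1 < k2)%N by rewrite -(coord_lt R) (lt_trans k1y).
apply: (@vedge_vS ((c.1.1, c.1.1), (k1, k2))) => //; last by rewrite /= k1y.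
rewrite inE /= eqxx k12 v1 v2 /=; apply/andP; split.
  apply/negP => /existsP[k /andP[/andP[h1 h2] vk]].
  have [ky|yk] := leP (coordq k) y.
    by have := k1max k; rewrite /lo vk ky => /(_ isT) /=; rewrite leqNgt h1.
  by have := k2min k; rewrite /hi vk yk => /(_ isT) /=; rewrite leqNgt h2.
apply/asboolP => -[x' y'] [/= /side_diag -> /(side_open (a := (k1, k2)) _ k12)] /= /andP[h1 h2].
apply: (cell_left cM); apply/andP; split.
  by apply: le_lt_trans h1; rewrite coord_le; exact: k1max lo1.
by apply: lt_le_trans h2 _; rewrite coord_le; exact: k2min hi2.
Qed.

Lemma cell_bottom_hS c : c \in M -> side c.1 `*` [set coordq c.2.1] `<=` hS.
Proof.
move=> cM [x y] [/= hx ->]; have [lt1 _] := cells cM.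
have {}hx : coordp c.1.1 < x < coordp c.1.2 by exact/side_open.
have /andP[hx1 hx2] := hx.
pose lo k := (vtx k c.2.1 \in vertices M) && (coordp k <= x).
pose hi k := (vtx k c.2.1 \in vertices M) && (x < coordp k).
have lo1 : lo c.1.1 by rewrite /lo (ltW hx1) andbT; apply: (vtx_in cM); rewrite eqxx ?orbT.
have hi2 : hi c.1.2 by rewrite /hi hx2 andbT; apply: (vtx_in cM); rewrite eqxx ?orbT.
case: (arg_maxnP (fun k : idx p mu => k : nat) lo1) => k1 /andP[v1 k1x] k1max.
case: (arg_minnP (fun k : idx p mu => k : nat) hi2) => k2 /andP[v2 xk2] k2min.
move: k1x; rewrite le_eqVlt => /predU1P[<-|k1x]; first exact: vtx_hS.
have k12 : (k1 < k2)%N by rewrite -(coord_lt R) (lt_trans k1x).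
apply: (@hedge_hS ((k1, k2), (c.2.1, c.2.1))) => //; last by rewrite /= k1x.
rewrite inE /= eqxx k12 v1 v2 /=; apply/andP; split.
  apply/negP => /existsP[k /andP[/andP[h1 h2] vk]].
  have [kx|xk] := leP (coordp k) x.
    by have := k1max k; rewrite /lo vk kx => /(_ isT) /=; rewrite leqNgt h1.
  by have := k2min k; rewrite /hi vk xk => /(_ isT) /=; rewrite leqNgt h2.
apply/asboolP => -[x' y'] [/= /(side_open (a := (k1, k2)) _ k12) /= /andP[h1 h2] /side_diag ->].
apply: (cell_bottom cM); apply/andP; split.
  by apply: le_lt_trans h1; rewrite coord_le; exact: k1max lo1.
by apply: lt_le_trans h2 _; rewrite coord_le; exact: k2min hi2.
Qed.

Lemma anchor_own_h A : A \in anchors R M -> [set coordp A.1.1] `*` side A.2 `<=` vS.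
Proof.
move=> hA; have [_ s1 _ s2] := anchor_sides hA.
move: hA; rewrite inE => /andP[+ _]; move: s1 s2.
case: (odd p); case: (odd q) => s1 s2 hA.
- exact: cell_left_vS.
- move: hA; rewrite inE => /and4P[_ /eqP E v1 _] [x y] [/= ->].
  by move: E v1; case: (A.2) => a b /= <- v1 /side_diag ->; exact: vtx_vS.
- have := hA; rewrite inE => /and4P[/eqP E h1 _ _] [x y] [/= -> hy].
  by apply: (vedge_vS hA) => //; exact/side_open.
- have [i [j EA]] := verticesP hA; move: hA; rewrite EA => hA [x y] [/= -> /side_diag ->].
  exact: vtx_vS.
Qed.

Lemma anchor_own_v A : A \in anchors R M -> side A.1 `*` [set coordq A.2.1] `<=` hS.
Proof.
move=> hA; have [_ s1 _ s2] := anchor_sides hA.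
move: hA; rewrite inE => /andP[+ _]; move: s1 s2.
case: (odd p); case: (odd q) => s1 s2 hA.
- exact: cell_bottom_hS.
- have := hA; rewrite inE => /and4P[h1 /eqP E _ _] [x y] [/= hx ->].
  by apply: (hedge_hS hA) => //; exact/side_open.
- move: hA; rewrite inE => /and4P[/eqP E _ v1 _] [x y] [/= + ->].
  by move: E v1; case: (A.1) => a b /= <- v1 /side_diag ->; exact: vtx_hS.
- have [i [j EA]] := verticesP hA; move: hA; rewrite EA => hA [x y] [/= /side_diag -> ->].
  exact: vtx_hS.
Qed.

End Mesh.

Section AdmissibleMesh.
Variables (R : realType) (p q mu nu : nat).
Hypotheses (hp : (2 <= p)%N) (hq : (2 <= q)%N).
Variable M : {set box p q mu nu}.
Hypothesis hM : admissible R M.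

Let hT : index_tmesh R M. Proof. by case: hM. Qed.

Let hC : forall c, c \in M -> (c.1.1 < c.1.2)%N /\ (c.2.1 < c.2.2)%N.
Proof. by case: hT. Qed.

Lemma half_extent o n (y : R) : (2 <= o)%N -> 1 <= y <= n%:R ->
  (extent o n : set R) y /\ (extent o n : set R) (y + 1 / 2).
Proof.
move=> ho /andP[y1 y2]; have h : (1 : R) <= (o./2)%:R by rewrite ler1n half_gt0.
by rewrite /extent /= !in_itv /=; split; apply/andP; split; lra.
Qed.

(** Admissibility provides the points of a frame line in the union of all edges;
    [meshS_vS] sorts out the vertical ones. *)
Lemma anchor_frame_h A (l : idx p mu) : A \in anchors R M ->
  (l <= p./2)%N || (mu + p./2 <= l.+1)%N ->
  [set @grid_coord R p mu l] `*` side A.2 `<=` @vS R p q mu nu M.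
Proof.
move=> hA hl [x y] [/= -> hy].
have [_ _ le2 _] := anchor_sides hC hA; have [_ _ a1 a2] := anchor_active hC hA.
have ynu : 1 <= y <= nu%:R by have := (side_activeP R le2).2 (conj a1 a2) y hy; rewrite /= in_itv.
have [e1 e2] := half_extent hq ynu.
have hl' : grid_coord R l <= 1 \/ mu%:R <= grid_coord R l.
  by case/orP: hl => h; [left; rewrite coord_le1|right; rewrite coord_gen].
have frame := (let: And4 _ h _ _ := hM in h) l hl'.
have [m1 _] := frame (grid_coord R l, y) (conj erefl e1).
have [m2 _] := frame (grid_coord R l, y + 1 / 2) (conj erefl e2).
have [[//|[j yj]] _] := meshS_cases m1.
by rewrite yj in m2 *; exact: meshS_vS.
Qed.

Lemma anchor_frame_v A (l : idx q nu) : A \in anchors R M ->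
  (l <= q./2)%N || (nu + q./2 <= l.+1)%N ->
  side A.1 `*` [set @grid_coord R q nu l] `<=` @hS R p q mu nu M.
Proof.
move=> hA hl [x y] [/= hx ->].
have [le1 _ _ _] := anchor_sides hC hA; have [a1 a2 _ _] := anchor_active hC hA.
have xmu : 1 <= x <= mu%:R by have := (side_activeP R le1).2 (conj a1 a2) x hx; rewrite /= in_itv.
have [e1 e2] := half_extent hp xmu.
have hl' : grid_coord R l <= 1 \/ nu%:R <= grid_coord R l.
  by case/orP: hl => h; [left; rewrite coord_le1|right; rewrite coord_gen].
have frame := (let: And4 _ _ h _ := hM in h) l hl'.
have [m1 _] := frame (x, grid_coord R l) (conj e1 erefl).
have [m2 _] := frame (x + 1 / 2, grid_coord R l) (conj e2 erefl).
have [_ [//|[i xi]]] := meshS_cases m1.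
by rewrite xi in m2 *; exact: meshS_hS.
Qed.

Lemma size_hlocal A : A \in anchors R M -> size (hlocal R M A) = p.+1.
Proof.
move=> hA; have [le1 s1 _ _] := anchor_sides hC hA; have [h1 h2 _ _] := anchor_active hC hA.
apply: size_window => //.
- by move=> l hl; apply/asboolP; exact: anchor_frame_h.
- by apply/asboolP; exact: anchor_own_h.
- by move: s1 h2; case: (odd p) => /=; lia.
Qed.

Lemma size_vlocal A : A \in anchors R M -> size (vlocal R M A) = q.+1.
Proof.
move=> hA; have [_ _ le2 s2] := anchor_sides hC hA; have [_ _ h1 h2] := anchor_active hC hA.
apply: size_window => //.
- by move=> l hl; apply/asboolP; exact: anchor_frame_v.
- by apply/asboolP; exact: anchor_own_v.
- by move: s2 h2; case: (odd q) => /=; lia.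
Qed.

End AdmissibleMesh.

(** * The anchors of the tensor-product mesh *)

Lemma start_lt o n k b : (k < n + o./2.*2 - o)%N -> (b <= odd o)%N ->
  (k + o./2 + b < n + o./2.*2)%N.
Proof. by have := odd_double_half o; rewrite -addnn; lia. Qed.

Lemma start_range o n a b : b = (a + odd o)%N -> (o./2 <= a)%N -> (b < n + o./2)%N ->
  (a - o./2 < n + o./2.*2 - o)%N.
Proof. by have := odd_double_half o; rewrite -addnn; lia. Qed.

Lemma start_active o n k : (k < n + o./2.*2 - o)%N -> (k + o./2 + odd o < n + o./2)%N.
Proof. by have := odd_double_half o; rewrite -addnn; lia. Qed.

Section TensorMesh.
Variables (R : realType) (p q mu nu : nat).
Hypotheses (hp : (2 <= p)%N) (hq : (2 <= q)%N) (hmu : (0 < mu)%N) (hnu : (0 < nu)%N).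
Local Notation Mhat := (tensor_mesh p q mu nu).
Local Notation coordp := (@grid_coord R p mu).
Local Notation coordq := (@grid_coord R q nu).
Implicit Types (A c e : box p q mu nu) (i : idx p mu) (j : idx q nu).

Lemma tensor_cells c : c \in Mhat -> (c.1.1 < c.1.2)%N /\ (c.2.1 < c.2.2)%N.
Proof. by rewrite inE => /andP[/eqP -> /eqP ->]. Qed.

Lemma unit_interval_at n (i : 'I_n) : (1 < n)%N ->
  exists a : 'I_n * 'I_n, a.2 = a.1.+1 :> nat /\ (i == a.1) || (i == a.2).
Proof.
move=> n1; have [h|h] := ltnP i.+1 n.
  by exists (i, Ordinal h); rewrite /= eqxx.
have h' : (i.-1 < n)%N by have := ltn_ord i; lia.
by exists (Ordinal h', i); rewrite /= eqxx orbT; split => //; lia.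
Qed.

Lemma tensor_vtx i j : vtx i j \in vertices Mhat.
Proof.
have [|a [a1 ha]] := unit_interval_at i; first by rewrite -addnn; have := half_gt0 p; lia.
have [|b [b1 hb]] := unit_interval_at j; first by rewrite -addnn; have := half_gt0 q; lia.
by apply: (vtx_in (c := (a, b))); rewrite // inE /= a1 b1 !eqxx.
Qed.

Lemma tensor_skeleton x y :
  index_domain (R := R) p q mu nu (x, y) -> (exists i, x = coordp i) \/ (exists j, y = coordq j) ->
  skeleton Mhat (x, y).
Proof.
move=> dom h; split => // -[c /= cM [/= hx hy]].
have [l1 l2] := tensor_cells cM; move: cM; rewrite inE => /andP[/eqP c1 /eqP c2].
case: h => -[k kE]; subst.
  by move/(side_open _ l1): hx; rewrite !coord_lt c1; lia.
by move/(side_open _ l2): hy; rewrite !coord_lt c2; lia.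
Qed.

Lemma coord_extent_between o n (i j : 'I_(n + o./2.*2)) (x : R) :
  grid_coord R i < x < grid_coord R j -> (extent o n : set R) x.
Proof.
move=> /andP[h1 h2]; have := coord_extent R i; have := coord_extent R j.
by rewrite /extent /= !in_itv /= => /andP[_ e1] /andP[e2 _]; apply/andP; split; lra.
Qed.

Lemma tensor_vedge i (b : idx q nu * idx q nu) : b.2 = b.1.+1 :> nat ->
  ((i, i), b) \in vedges R Mhat.
Proof.
move=> b1; have lt : (b.1 < b.2)%N by rewrite b1.
rewrite inE /= eqxx lt !tensor_vtx /=; apply/andP; split.
  by apply/negP => /existsP[k /andP[h _]]; move: h; rewrite b1; lia.
apply/asboolP => -[x y] [/= /side_diag -> /(side_open _ lt) hy].
apply: tensor_skeleton; last by left; exists i.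
by split => /=; [exact: coord_extent|exact: coord_extent_between hy].
Qed.

Lemma tensor_hedge j (a : idx p mu * idx p mu) : a.2 = a.1.+1 :> nat ->
  (a, (j, j)) \in hedges R Mhat.
Proof.
move=> a1; have lt : (a.1 < a.2)%N by rewrite a1.
rewrite inE /= eqxx lt !tensor_vtx /=; apply/andP; split.
  by apply/negP => /existsP[k /andP[h _]]; move: h; rewrite a1; lia.
apply/asboolP => -[x y] [/= /(side_open _ lt) hx /side_diag ->].
apply: tensor_skeleton; last by right; exists j.
by split => /=; [exact: coord_extent_between hx|exact: coord_extent].
Qed.

Lemma tensor_anchor_unit A : A \in anchors R Mhat ->
  A.1.2 = (A.1.1 + odd p)%N :> nat /\ A.2.2 = (A.2.1 + odd q)%N :> nat.
Proof.
have no_between n (P : pred 'I_n) (a b : 'I_n) : (forall k, P k) -> (a < b)%N ->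
    ~~ [exists k : 'I_n, (a < k < b)%N && P k] -> b = (a + 1)%N :> nat.
  move=> hP ab; rewrite negb_exists => /forallP h.
  have [ab1|ab1] := ltnP a.+1 b; last by lia.
  have kn : (a.+1 < n)%N by apply: ltn_trans ab1 _.
  by have := h (Ordinal kn); rewrite hP /= ltnSn ab1.
rewrite inE => /andP[+ _]; case: (odd p); case: (odd q) => hA.
- by move: hA; rewrite inE => /andP[/eqP -> /eqP ->]; rewrite !addn1.
- move: hA; rewrite inE => /and5P[h1 /eqP E _ _ /andP[h2 _]].
  rewrite E addn0; split => //; apply: no_between h1 h2 => k; exact: tensor_vtx.
- move: hA; rewrite inE => /and5P[/eqP E h1 _ _ /andP[h2 _]].
  rewrite E addn0; split => //; apply: no_between h1 h2 => k; exact: tensor_vtx.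
- by have [i [j ->]] := verticesP hA; rewrite /= !addn0.
Qed.

Lemma tensor_anchor A : A.1.2 = (A.1.1 + odd p)%N :> nat ->
  A.2.2 = (A.2.1 + odd q)%N :> nat ->
  (p./2 <= A.1.1)%N -> (A.1.2 < mu + p./2)%N ->
  (q./2 <= A.2.1)%N -> (A.2.2 < nu + q./2)%N -> A \in anchors R Mhat.
Proof.
move=> E1 E2 h1 h2 h3 h4; rewrite inE; apply/andP; split; last first.
  apply/asboolP => -[x y] [/= hx hy]; split => /=.
    by apply: ((side_activeP R (a := A.1) _).2 (conj h1 h2)); rewrite // E1 leq_addr.
  by apply: ((side_activeP R (a := A.2) _).2 (conj h3 h4)); rewrite // E2 leq_addr.
move: A E1 E2 {h1 h2 h3 h4} => [[a1 a2] [b1 b2]] /=.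
case: (odd p); case: (odd q); rewrite ?addn0 ?addn1 => E1 E2.
- by rewrite inE /= E1 E2 !eqxx.
- have {E2} -> := val_inj E2; exact: tensor_hedge.
- have {E1} -> := val_inj E1; exact: tensor_vedge.
- have {E1} -> := val_inj E1; have {E2} -> := val_inj E2; exact: tensor_vtx.
Qed.

Lemma tensor_hindex A : A \in anchors R Mhat -> hindex R Mhat A = enum (idx p mu).
Proof.
move=> hA; apply/all_filterP/allP => i _; apply/asboolP => -[x y] [/= -> hy].
have [_ E2] := tensor_anchor_unit hA; have [_ _ _ s2] := anchor_sides tensor_cells hA.
move: E2 s2 hy; case: (A.2) => b1 b2 /=; case: (odd q); rewrite ?addn0 ?addn1 => E2 s2 hy.
  exists ((i, i), (b1, b2)); last by split => //; exact: side_coord.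
  by rewrite /= inE tensor_vedge.
have Eb := val_inj E2; subst b2; rewrite (side_diag hy).
by apply: vtx_vS; exact: tensor_vtx.
Qed.

Lemma tensor_vindex A : A \in anchors R Mhat -> vindex R Mhat A = enum (idx q nu).
Proof.
move=> hA; apply/all_filterP/allP => j _; apply/asboolP => -[x y] [/= hx ->].
have [E1 _] := tensor_anchor_unit hA; have [_ s1 _ _] := anchor_sides tensor_cells hA.
move: E1 s1 hx; case: (A.1) => a1 a2 /=; case: (odd p); rewrite ?addn0 ?addn1 => E1 s1 hx.
  exists ((a1, a2), (j, j)); last by split => //; exact: side_coord.
  by rewrite /= inE tensor_hedge.
have Ea := val_inj E1; subst a2; rewrite (side_diag hx).
by apply: vtx_hS; exact: tensor_vtx.
Qed.

Lemma tensor_hlocal A : A \in anchors R Mhat ->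
  hlocal R Mhat A = take p.+1 (drop (A.1.1 - p./2) (enum (idx p mu))).
Proof. by move=> hA; rewrite /hlocal /window tensor_hindex // index_enum_ord. Qed.

Lemma tensor_vlocal A : A \in anchors R Mhat ->
  vlocal R Mhat A = take q.+1 (drop (A.2.1 - q./2) (enum (idx q nu))).
Proof. by move=> hA; rewrite /vlocal /window tensor_vindex // index_enum_ord. Qed.

Let Ns := (mu + p./2.*2 - p)%N.
Let Nt := (nu + q./2.*2 - q)%N.

(** The anchor whose local index vectors start at w.1 and w.2. *)
Definition tensor_anchor_at (w : 'I_Ns * 'I_Nt) : box p q mu nu :=
  ((Ordinal (start_lt (ltn_ord w.1) (leq0n _)), Ordinal (start_lt (ltn_ord w.1) (leqnn _))),
   (Ordinal (start_lt (ltn_ord w.2) (leq0n _)), Ordinal (start_lt (ltn_ord w.2) (leqnn _)))).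

Lemma tensor_anchor_at_start w : ((tensor_anchor_at w).1.1 - p./2)%N = w.1 /\
  ((tensor_anchor_at w).2.1 - q./2)%N = w.2.
Proof. by rewrite /= !addn0 !addnK. Qed.

Lemma tensor_anchor_at_inj : injective tensor_anchor_at.
Proof.
move=> w w' E; have [s1 s2] := tensor_anchor_at_start w.
have := tensor_anchor_at_start w'; rewrite -E s1 s2 => -[/val_inj e1 /val_inj e2].
by case: w w' e1 e2 {E s1 s2} => [? ?] [? ?] /= -> ->.
Qed.

Lemma tensor_anchorsE : anchors R Mhat = (tensor_anchor_at @: [set: 'I_Ns * 'I_Nt])%SET.
Proof.
apply/setP => A; apply/idP/imsetP => [hA|[[w1 w2] _ ->]].
  have [E1 E2] := tensor_anchor_unit hA.
  have [h1 h2 h3 h4] := anchor_active tensor_cells hA.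
  have k1 : (A.1.1 - p./2 < Ns)%N by exact: start_range E1 h1 h2.
  have k2 : (A.2.1 - q./2 < Nt)%N by exact: start_range E2 h3 h4.
  exists (Ordinal k1, Ordinal k2) => //; move: A E1 E2 h1 h3 k1 k2 {hA h2 h4}.
  move=> [[a1 a2] [b1 b2]] /= E1 E2 h1 h3 k1 k2.
  by congr (_, _); congr (_, _); apply: val_inj => /=; lia.
have k1 := start_active (ltn_ord w1); have k2 := start_active (ltn_ord w2).
by apply: tensor_anchor; rewrite /= ?addn0 // leq_addl.
Qed.

End TensorMesh.

(** * Column reduction *)

Section Reduction.
Variables (R : realType) (m n : nat) (A : 'M[R]_(m, n)).
Variables (lead : 'I_n -> 'I_m) (rank : 'I_n -> nat).
Hypothesis lead_neq0 : forall i, A (lead i) i != 0.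
Hypothesis lead_rank : forall i k, k != i -> A (lead i) k != 0 -> (rank k < rank i)%N.

(** A remaining column of least rank is innocuous: the other columns with a nonzero
    entry in its leading row have smaller rank.  This row is still there, because
    rows are removed only when they are zero on the remaining columns. *)
Lemma column_reduction_void : column_reduction A = (finset.set0, finset.set0).
Proof.
pose inv (X : {set 'I_m} * {set 'I_n}) := forall r c, c \in X.2 -> A r c != 0 -> r \in X.1.
have inv_step X : inv X -> inv (reduction_step A X).
  move=> iX r c; rewrite /= !inE => /andP[cX cn] rc.
  rewrite (iX r c) //=; apply/existsP; exists c.
  by rewrite !inE cX cn.
have card_step X : inv X -> (#|(reduction_step A X).2| <= #|X.2|.-1)%N.
  move=> iX; have [X0|[c0 c0X]] := set_0Vmem X.2.
    rewrite X0 cards0 leqn0 cards_eq0; apply/eqP/setP => c.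
    by rewrite /= !inE X0 inE.
  have [c cX cmin] : exists2 c, c \in X.2 & forall k, k \in X.2 -> (rank c <= rank k)%N.
    by case: (arg_minnP rank c0X) => c cX cmin; exists c.
  have sub : (reduction_step A X).2 \subset X.2 :\ c.
    apply/fintype.subsetP => k; rewrite !inE => /andP[kX kn]; rewrite kX andbT.
    apply: contraNneq kn => ->; rewrite /innocuous cX /=.
    apply/existsP; exists (lead c); rewrite (iX _ c) //= lead_neq0 /=.
    apply/forallP => l; apply/implyP => lX; apply/implyP => lc.
    rewrite -[_ == _]negbK; apply/negP => /(lead_rank lc).
    by rewrite ltnNge cmin.
  by apply: leq_trans (subset_leq_card sub) _; rewrite (cardsD1 c X.2) cX.
have inv_iter k : inv (iter k (reduction_step A) (finset.setT, finset.setT)).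
  elim: k => [|k IH]; first by move=> r c _ _; rewrite inE.
  exact: inv_step.
have card_iter k : (#|(iter k (reduction_step A) (finset.setT, finset.setT)).2| <= n - k)%N.
  elim: k => [|k IH]; first by rewrite subn0 /= cardsT card_ord.
  by rewrite iterS; have := card_step _ (inv_iter k); lia.
have empty_cols k : iter k.+1 (reduction_step A) (finset.setT, finset.setT) =
    ((iter k.+1 (reduction_step A) (finset.setT, finset.setT)).1, finset.set0) ->
    iter k.+1 (reduction_step A) (finset.setT, finset.setT) = (finset.set0, finset.set0).
  rewrite iterS; set X := iter k _ _ => -[E].
  rewrite {1}/reduction_step E; congr (_, _); apply/setP => r; rewrite !inE.
  by apply/negbTE/negP => /andP[_ /existsP[c]]; rewrite inE.
rewrite /column_reduction; have := card_iter (m + n)%N.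
case E : (m + n)%N => [|k].
  move=> _; have m0 : m = 0%N by lia.
  have n0 : n = 0%N by lia.
  congr (_, _); apply/setP => -[i hi]; exfalso; move: hi; rewrite ?m0 ?n0 //.
rewrite -E => h; rewrite E in h *; apply: empty_cols; rewrite {1}[LHS]surjective_pairing.
congr (_, _); apply/eqP; rewrite -cards_eq0 -leqn0; apply: leq_trans h _; lia.
Qed.

End Reduction.

(** * Shifted anchors *)

Lemma expansion_exists (R : realType) (p n : nat) (s : 'I_n -> R) (us vs : 'I_n -> R -> R)
    b (J : seq 'I_n) a (I := take p.+1 (drop a J)) : (2 <= p)%N ->
  knot_vector p s -> function_vectors p s us vs ->
  subseq J (enum 'I_n) -> size I = p.+1 -> insertion_compatible p s us vs J ->
  exists c : nat -> R,
    (forall x, local_gb_spline p s us vs I x =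
      \sum_(k < n - p) c k *
        local_gb_spline p s us vs (take p.+1 (drop k (enum 'I_n))) x) /\
    extreme b (n - p) (knot_key s b I) c.
Proof.
case: p @I => [|[|m]] // I _ hs huv subJ szI comp.
by have [c cE cext] := univariate_insertion hs huv b subJ szI comp; exists c.
Qed.

Definition shifted (R : realType) n (s : 'I_n -> R) (b : bool) (I1 I2 : seq 'I_n) : Prop :=
  if b then min_shifted s I1 I2 else max_shifted s I1 I2.

Lemma shifted_key (R : realType) p n (s : 'I_n -> R) b (I1 I2 : seq 'I_n) :
  knot_vector p s -> subseq I1 (enum 'I_n) -> subseq I2 (enum 'I_n) ->
  size I1 = p.+1 -> size I2 = p.+1 ->
  shifted s b I1 I2 -> knot_key s b I1 <> knot_key s b I2.
Proof.
move=> [s_le _] u1 u2 z1 z2 sh E.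
have [Ek Ec] := knot_key_inj s_le u1 u2 z1 z2 E.
by move: sh Ek Ec; case: b {E} => -[_ sh] /sh.
Qed.

Lemma window_subseq n o (I : seq 'I_n) i : subseq (window o I i) I.
Proof. exact: subseq_trans (take_subseq _ _) (drop_subseq _ _). Qed.

Section Main.
Variables (R : realType) (p q mu nu : nat).
Hypotheses (hp : (2 <= p)%N) (hq : (2 <= q)%N) (hmu : (0 < mu)%N) (hnu : (0 < nu)%N).
Variables (s : idx p mu -> R) (us vs : idx p mu -> R -> R).
Variables (t : idx q nu -> R) (ut vt : idx q nu -> R -> R).
Hypotheses (hs : knot_vector p s) (ht : knot_vector q t).
Hypotheses (huvs : function_vectors p s us vs) (huvt : function_vectors q t ut vt).
Variable M : {set box p q mu nu}.
Hypothesis hM : admissible R M.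
Hypothesis hcs : forall A, A \in anchors R M ->
  insertion_compatible p s us vs (hindex R M A).
Hypothesis hct : forall A, A \in anchors R M ->
  insertion_compatible q t ut vt (vindex R M A).

Local Notation Mhat := (tensor_mesh p q mu nu).
Let Ns := (mu + p./2.*2 - p)%N.
Let Nt := (nu + q./2.*2 - q)%N.

Variables (bs bt : bool).
Hypothesis separated : forall A1 A2, A1 \in anchors R M -> A2 \in anchors R M -> A1 != A2 ->
  shifted s bs (hlocal R M A1) (hlocal R M A2) \/ shifted t bt (vlocal R M A1) (vlocal R M A2).

Let hindex_sub A : subseq (hindex R M A) (enum (idx p mu)).
Proof. exact: filter_subseq. Qed.

Let vindex_sub A : subseq (vindex R M A) (enum (idx q nu)).
Proof. exact: filter_subseq. Qed.

Let skey A := knot_key s bs (hlocal R M A).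
Let tkey A := knot_key t bt (vlocal R M A).

Let key_inj A1 A2 : A1 \in anchors R M -> A2 \in anchors R M -> A1 != A2 ->
  (skey A1 != skey A2) || (tkey A1 != tkey A2).
Proof.
move=> h1 h2 ne; have [sh|sh] := separated h1 h2 ne.
  apply/orP; left; apply/eqP; apply: (shifted_key hs) sh; rewrite ?size_hlocal //;
    exact: subseq_trans (window_subseq _ _ _) (hindex_sub _).
apply/orP; right; apply/eqP; apply: (shifted_key ht) sh; rewrite ?size_vlocal //;
  exact: subseq_trans (window_subseq _ _ _) (vindex_sub _).
Qed.

Let hspl k := local_gb_spline p s us vs (take p.+1 (drop k (enum (idx p mu)))).
Let vspl k := local_gb_spline q t ut vt (take q.+1 (drop k (enum (idx q nu)))).

(** The anchors of the tensor-product mesh are the pairs of starting indices, and a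
    sum of products over pairs is a product of sums. *)
Lemma tensor_sum (c d : nat -> R) x y :
  \sum_(j < #|anchors R Mhat|)
     (c ((enum_val j).1.1 - p./2)%N * d ((enum_val j).2.1 - q./2)%N) *
     gt_spline s us vs t ut vt Mhat (enum_val j) x y =
  (\sum_(k < Ns) c k * hspl k x) * (\sum_(k < Nt) d k * vspl k y).
Proof.
pose F (A : box p q mu nu) := c (A.1.1 - p./2)%N * d (A.2.1 - q./2)%N * (hspl (A.1.1 - p./2)%N x * vspl (A.2.1 - q./2)%N y).
transitivity (\sum_(j < #|anchors R Mhat|) F (enum_val j)).
  apply: eq_bigr => j _; have hj := enum_valP j.
  by rewrite /gt_spline (tensor_hlocal hp hq hmu hnu hj) (tensor_vlocal hp hq hmu hnu hj).
rewrite -(big_enum_val F) (tensor_anchorsE R hp hq hmu hnu).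
rewrite big_imset /=; last by move=> w w' _ _; exact: tensor_anchor_at_inj.
rewrite big_distrlr /= pair_bigA /=; apply: eq_big => [w|w _]; first by rewrite inE.
have [e1 e2] := tensor_anchor_at_start w.
by rewrite /F e1 e2; ring.
Qed.

Lemma shifted_anchors_VMCR : VMCR s us vs t ut vt M.
Proof.
have /choice[cs hcsE] : forall i : 'I_#|anchors R M|, exists c : nat -> R,
    (forall x, local_gb_spline p s us vs (hlocal R M (enum_val i)) x =
       \sum_(k < Ns) c k * hspl k x) /\ extreme bs Ns (skey (enum_val i)) c.
  move=> i; have hi := enum_valP i.
  by apply: expansion_exists => //; [exact: size_hlocal|exact: hcs].
have /choice[ct hctE] : forall i : 'I_#|anchors R M|, exists c : nat -> R,
    (forall x, local_gb_spline q t ut vt (vlocal R M (enum_val i)) x =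
       \sum_(k < Nt) c k * vspl k x) /\ extreme bt Nt (tkey (enum_val i)) c.
  move=> i; have hi := enum_valP i.
  by apply: expansion_exists => //; [exact: size_vlocal|exact: hct].
pose C : 'M[R]_(#|anchors R M|, #|anchors R Mhat|) := \matrix_(i, j)
  let B : box p q mu nu := enum_val j in
  cs i (B.1.1 - p./2)%N * ct i (B.2.1 - q./2)%N.
exists C.
  move=> i x y; rewrite /gt_spline (hcsE i).1 (hctE i).1 -tensor_sum.
  by apply: eq_bigr => j _; rewrite mxE.
have sN (i : 'I_#|anchors R M|) : (skey (enum_val i) < Ns)%N by have [_ []] := hcsE i.
have tN (i : 'I_#|anchors R M|) : (tkey (enum_val i) < Nt)%N by have [_ []] := hctE i.
pose at_ i := tensor_anchor_at (Ordinal (sN i), Ordinal (tN i)).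
have at_in i : at_ i \in anchors R Mhat.
  by rewrite (tensor_anchorsE R hp hq hmu hnu); apply: imset_f; rewrite inE.
pose lead i := enum_rank_in (at_in i) (at_ i).
have leadE i : enum_val (lead i) = at_ i by rewrite enum_rankK_in.
have leadC i k : C^T (lead i) k = cs k (skey (enum_val i)) * ct k (tkey (enum_val i)).
  rewrite !mxE leadE /at_ -/Ns -/Nt.
  by have [-> ->] := tensor_anchor_at_start (Ordinal (sN i), Ordinal (tN i)).
(* last coefficients are ranked backwards; the sum is strictly monotone because
   the pairs of keys are distinct *)
pose rank (i : 'I_#|anchors R M|) := ((if bs then skey (enum_val i) else Ns - skey (enum_val i)) +
  (if bt then tkey (enum_val i) else Nt - tkey (enum_val i)))%N.
apply: (column_reduction_void (lead := lead) (rank := rank)) => [i|i k ki].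
  rewrite leadC; have [_ [_ h1 _]] := hcsE i; have [_ [_ h2 _]] := hctE i.
  by rewrite mulf_neq0.
rewrite leadC mulf_eq0 negb_or => /andP[n1 n2].
have [_ [_ _ /(_ _ (sN i) n1) h1]] := hcsE k.
have [_ [_ _ /(_ _ (tN i) n2) h2]] := hctE k.
have := key_inj (enum_valP k) (enum_valP i).
rewrite (inj_eq enum_val_inj) => /(_ ki).
move: h1 h2 (sN i) (sN k) (tN i) (tN k); rewrite /rank.
by case: (bs); case: (bt); lia.
Qed.

End Main.

Theorem theorem4p18 (R : realType) (p q mu nu : nat)
    (hp : (2 <= p)%N) (hq : (2 <= q)%N) (hmu : (0 < mu)%N) (hnu : (0 < nu)%N)
    (s : idx p mu -> R) (us vs : idx p mu -> R -> R)
    (t : idx q nu -> R) (ut vt : idx q nu -> R -> R)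
    (hs : knot_vector p s) (ht : knot_vector q t)
    (huvs : function_vectors p s us vs) (huvt : function_vectors q t ut vt)
    (M : {set box p q mu nu}) (hM : admissible R M)
    (hcs : forall A, A \in anchors R M ->
       insertion_compatible p s us vs (hindex R M A))
    (hct : forall A, A \in anchors R M ->
       insertion_compatible q t ut vt (vindex R M A))
    (ty : wdc_type) (hwdc : weakly_dual_compatible s t ty M) :
  VMCR s us vs t ut vt M.
Proof.
case: ty hwdc => hwdc.
- exact: (shifted_anchors_VMCR hp hq hmu hnu hs ht huvs huvt hM hcs hct (bs := false) (bt := true)) hwdc.
- exact: (shifted_anchors_VMCR hp hq hmu hnu hs ht huvs huvt hM hcs hct (bs := false) (bt := false)) hwdc.
- exact: (shifted_anchors_VMCR hp hq hmu hnu hs ht huvs huvt hM hcs hct (bs := true) (bt := true)) hwdc.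
- exact: (shifted_anchors_VMCR hp hq hmu hnu hs ht huvs huvt hM hcs hct (bs := true) (bt := false)) hwdc.
Qed.
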